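(* Let $X$ be a complex Banach space and let $T\in B(X)$ be a Fredholm operator such that $0$ is an accumulation point of $\sigma(T)$. Suppose that for each $\lambda\in\sigma(T)\setminus\overline{\rho_{sf}^\pm(T)}$ and each $\epsilon>0$, the open ball $B(\lambda,\epsilon)$ contains a connected component of $\sigma_{sf}(T)\cup\pi_0(T)$. Then $\sigma$ is $\nu$-continuous at $T$, i.e. $\sigma(T_n)\to\sigma(T)$ in the Hausdorff metric for every sequence $(T_n)$ in $B(X)$ with $T_n\overset{\nu}{\to}T$.
   Context: $B(X)$ is the algebra of bounded linear operators on $X$. For $S\in B(X)$: $S$ is semi-Fredholm if $R(S)$ is closed and at least one of $\alpha(S)=\dim N(S)$, $\beta(S)=\dim X/R(S)$ is finite; it is Fredholm if both are finite; its index is $i(S)=\alpha(S)-\beta(S)\in\mathbb{Z}\cup\{\pm\infty\}$. $\sigma_{sf}(T)$ is the set of $\lambda$ with $T-\lambda$ not semi-Fredholm; $\rho_{sf}^\pm(T)$ is the set of $\lambda$ with $T-\lambda$ semi-Fredholm and $i(T-\lambda)\neq0$. $\pi_0(T)$ is the set of isolated points of $\sigma(T)$ that are eigenvalues of finite algebraic multiplicity. A sequence $T_n\in B(X)$ is $\nu$-convergent to $T$, $T_n\overset{\nu}{\to}T$, if $(\|T_n\|)$ is bounded, $\|(T_n-T)T\|\to0$ and $\|(T_n-T)T_n\|\to0$. *)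

(* Defs.v *)
From Stdlib Require Import Reals List Lia.
From Coquelicot Require Import Coquelicot.
Open Scope R_scope.

Notation CC := Complex.C.

Section Ops.
Context {X : CompleteNormedModule C_AbsRing}.

Definition is_linear (A : X -> X) : Prop :=
  (forall x y, A (plus x y) = plus (A x) (A y)) /\
  (forall (c : CC) x, A (scal c x) = scal c (A x)).

Definition is_bounded (A : X -> X) : Prop :=
  exists M : R, forall x, norm (A x) <= M * norm x.

Definition bounded_op (A : X -> X) : Prop := is_linear A /\ is_bounded A.

Definition opnorm_le (A : X -> X) (c : R) : Prop :=
  forall x, norm (A x) <= c * norm x.

Definition op_sub (A B : X -> X) : X -> X := fun x => minus (A x) (B x).
Definition op_comp (A B : X -> X) : X -> X := fun x => A (B x).
Definition op_shift (T : X -> X) (l : CC) : X -> X := fun x => minus (T x) (scal l x).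

Definition invertible_op (A : X -> X) : Prop :=
  exists B : X -> X, bounded_op B /\ (forall x, B (A x) = x) /\ (forall x, A (B x) = x).

Definition spectrum (T : X -> X) : CC -> Prop :=
  fun l => ~ invertible_op (op_shift T l).

Fixpoint lincomb (cs : list CC) (l : list X) : X :=
  match cs, l with
  | c :: cs', v :: l' => plus (scal c v) (lincomb cs' l')
  | _, _ => zero
  end.

Definition lin_indep (l : list X) : Prop :=
  forall cs : list CC, length cs = length l -> lincomb cs l = zero ->
    List.Forall (fun c => c = (RtoC 0)) cs.

Definition subspace_dim (P : X -> Prop) (n : nat) : Prop :=
  exists l : list X, length l = n /\ List.Forall P l /\ lin_indep l /\
    forall x, P x -> exists cs, length cs = n /\ x = lincomb cs l.

Definition kernel (S : X -> X) : X -> Prop := fun x => S x = zero.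
Definition range (S : X -> X) : X -> Prop := fun y => exists x, y = S x.

Definition alpha_is (S : X -> X) (n : nat) : Prop := subspace_dim (kernel S) n.

(** beta(S) = dim X/R(S) = n : there are n vectors, linearly independent
    modulo R(S), spanning X modulo R(S) (a basis of the quotient). *)
Definition beta_is (S : X -> X) (n : nat) : Prop :=
  exists l : list X, length l = n /\
    (forall cs, length cs = n -> range S (lincomb cs l) -> List.Forall (fun c => c = (RtoC 0)) cs) /\
    (forall x, exists cs y, length cs = n /\ range S y /\ x = plus (lincomb cs l) y).

Definition alpha_finite (S : X -> X) : Prop := exists n, alpha_is S n.
Definition beta_finite (S : X -> X) : Prop := exists n, beta_is S n.

Definition semi_fredholm (S : X -> X) : Prop :=
  closed (range S) /\ (alpha_finite S \/ beta_finite S).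

Definition fredholm (S : X -> X) : Prop :=
  closed (range S) /\ alpha_finite S /\ beta_finite S.

(** i(S) = k for an integer k (both defects finite). i(S) = +-oo otherwise. *)
Definition index_is (S : X -> X) (k : Z) : Prop :=
  exists a b, alpha_is S a /\ beta_is S b /\ k = (Z.of_nat a - Z.of_nat b)%Z.

Definition sigma_sf (T : X -> X) : CC -> Prop :=
  fun l => ~ semi_fredholm (op_shift T l).

Definition rho_sf_pm (T : X -> X) : CC -> Prop :=
  fun l => semi_fredholm (op_shift T l) /\ ~ index_is (op_shift T l) 0%Z.

Definition isolated_in (S : CC -> Prop) (l : CC) : Prop :=
  S l /\ exists e, 0 < e /\ forall m, S m -> Cmod (Cminus m l) < e -> m = l.

Definition gen_eigenspace (T : X -> X) (l : CC) : X -> Prop :=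
  fun x => exists k : nat, Nat.iter k (op_shift T l) x = zero.

Definition pi0 (T : X -> X) : CC -> Prop :=
  fun l => isolated_in (spectrum T) l /\
    (exists x, x <> zero /\ T x = scal l x) /\
    (exists n, subspace_dim (gen_eigenspace T l) n).

Definition nu_converges (Tn : nat -> X -> X) (T : X -> X) : Prop :=
  (exists M, forall n, opnorm_le (Tn n) M) /\
  (forall eps, 0 < eps -> exists N, forall n, (N <= n)%nat ->
      opnorm_le (op_comp (op_sub (Tn n) T) T) eps) /\
  (forall eps, 0 < eps -> exists N, forall n, (N <= n)%nat ->
      opnorm_le (op_comp (op_sub (Tn n) T) (Tn n)) eps).

End Ops.

Definition cdist (z w : CC) : R := Cmod (Cminus z w).

Definition open_ball (l : CC) (e : R) : CC -> Prop := fun z => cdist z l < e.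

Definition C_open (U : CC -> Prop) : Prop :=
  forall z, U z -> exists e, 0 < e /\ forall w, cdist w z < e -> U w.

Definition C_closure (S : CC -> Prop) : CC -> Prop :=
  fun z => forall e, 0 < e -> exists w, S w /\ cdist w z < e.

Definition accumulation_point (S : CC -> Prop) (z : CC) : Prop :=
  forall e, 0 < e -> exists w, S w /\ w <> z /\ cdist w z < e.

Definition C_connected (A : CC -> Prop) : Prop :=
  forall U V : CC -> Prop, C_open U -> C_open V ->
    (forall z, A z -> U z \/ V z) ->
    (forall z, ~ (A z /\ U z /\ V z)) ->
    (forall z, ~ (A z /\ U z)) \/ (forall z, ~ (A z /\ V z)).

Definition connected_component_of (S K : CC -> Prop) : Prop :=
  (exists z, K z) /\ (forall z, K z -> S z) /\ C_connected K /\
  forall L : CC -> Prop, C_connected L -> (forall z, L z -> S z) ->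
    (exists z, L z /\ K z) -> forall z, L z -> K z.

Definition hausdorff_converges (An : nat -> CC -> Prop) (A : CC -> Prop) : Prop :=
  forall eps, 0 < eps -> exists N, forall n, (N <= n)%nat ->
    (forall z, An n z -> exists w, A w /\ cdist z w < eps) /\
    (forall w, A w -> exists z, An n z /\ cdist z w < eps).

(* Main.v *)
From Stdlib Require Import Reals List Lra Lia Classical ClassicalEpsilon.
From Coquelicot Require Import Coquelicot.
Require Import Defs.
Open Scope R_scope.
Set Bullet Behavior "Strict Subproofs".

(** Write [D_n = T_n - T]. Since [T] is Fredholm, the hypothesis [D_n T -> 0] splits [D_n] into an
    operator [E_n] of small norm and a finite-rank operator, by means of the projection along the
    range of [T].

    Upper semicontinuity: for [z <> 0] outside the spectrum of [T], with resolvent [R], the operator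
    [(D_n R)^2] is small because [z R = T R - I], so [T_n - z = (I + D_n R)(T - z)] is invertible. At
    [z = 0] there is nothing to show, as [0] lies in the spectrum of [T].

    Lower semicontinuity at [l]: if [l] is in the closure of the set where [T - z] is semi-Fredholm of
    nonzero index, stability of the index under [E_n] and under finite-rank operators keeps some
    nearby [z] in the spectrum of [T_n]. Otherwise a small ball around [l] contains a component of
    [sigma_sf T \/ pi0 T]; suppose that infinitely many [T_n] have no spectrum in this ball.
    If the component meets [pi0], the resolvents of these [T_n] are uniformly bounded on a small
    circle around an isolated point [z0 <> 0], hence at [z0] by the maximum principle, which forces
    [T - z0] to be invertible. If it meets [sigma_sf], a relatively clopen piece of [sigma_sf] is
    surrounded by points where [T - z] is Fredholm of index zero. There the resolvents of [T_n] are
    uniformly bounded modulo finite-dimensional subspaces of the target; by the maximum principle for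
    this seminorm they are so on the piece itself, which forces [T - z] to be semi-Fredholm there.

    Measuring operators modulo finite-dimensional subspaces of the target, and comparing dimensions
    through Riesz sequences, avoids bounded projections onto kernels and thus Hahn-Banach. *)

(** * Linear combinations and dimension *)

(** Since [T_n - T] need not become small in norm, the openness of the Fredholm operators cannot be
    applied to it directly. Two substitutes share the work. Away from [0], the products controlled
    by nu-convergence carry invertibility, with bounds, from [T] to [T_n] and back. Modulo a
    finite-rank operator that need not be small, the difference is small at every point; this second
    form is the one needed around a piece of [sigma_sf T], because the surrounding region may
    contain [0]. Thresholds have to be fixed from [T - z] alone, before [T_n] and its finite-rank
    part are known; hence subspaces are compared with constants that depend only on a dimension. The
    maximum principle uses no contour integral: averaging the resolvent over four points removes the
    Taylor terms of orders one to three. It holds on any compact set, whatever its boundary looks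
    like, so a piece of the spectrum can be surrounded by means of chains of short steps instead of
    curves. *)

Section ModuleTactic.
Context {X : CompleteNormedModule C_AbsRing}.

(** Reflected vector expressions: a linear identity in [X] reduces to one scalar identity per atom,
    which [ring] or [field] closes. *)
Inductive mexp :=
| MAtom (n : nat) | MZero | MPlus (a b : mexp) | MOpp (a : mexp)
| MMinus (a b : mexp) | MScal (c : CC) (a : mexp).

Fixpoint meval (env : list X) (e : mexp) : X :=
  match e with
  | MAtom n => nth n env zero
  | MZero => zero
  | MPlus a b => plus (meval env a) (meval env b)
  | MOpp a => opp (meval env a)
  | MMinus a b => minus (meval env a) (meval env b)
  | MScal c a => scal c (meval env a)
  end.

Fixpoint mcoef (e : mexp) (i : nat) : CC :=
  match e with
  | MAtom n => if Nat.eqb n i then RtoC 1 else RtoC 0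
  | MZero => RtoC 0
  | MPlus a b => Cplus (mcoef a i) (mcoef b i)
  | MOpp a => Copp (mcoef a i)
  | MMinus a b => Cminus (mcoef a i) (mcoef b i)
  | MScal c a => Cmult c (mcoef a i)
  end.

Fixpoint mlc (f : nat -> CC) (env : list X) : X :=
  match env with
  | nil => zero
  | v :: r => plus (scal (f O) v) (mlc (fun i => f (S i)) r)
  end.

Lemma mlc_ext f g env : (forall i, (i < length env)%nat -> f i = g i) -> mlc f env = mlc g env.
Proof.
  revert f g; induction env as [|v r IH]; intros f g H; simpl; auto.
  rewrite (H O) by (simpl; lia). rewrite (IH (fun i => f (S i)) (fun i => g (S i))); auto.
  intros i Hi; apply H; simpl; lia.
Qed.

Lemma scal_C0 (x : X) : scal (RtoC 0) x = zero.
Proof. exact (scal_zero_l x). Qed.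

Lemma scal_C1 (x : X) : scal (RtoC 1) x = x.
Proof. exact (scal_one x). Qed.

Lemma scal_Cplus (a b : CC) (x : X) : scal (Cplus a b) x = plus (scal a x) (scal b x).
Proof. exact (scal_distr_r a b x). Qed.

Lemma scal_Cmult (a b : CC) (x : X) : scal (Cmult a b) x = scal a (scal b x).
Proof. symmetry; exact (scal_assoc a b x). Qed.

Lemma mlc_zero env : mlc (fun _ => RtoC 0) env = zero.
Proof.
  induction env as [|v r IH]; simpl; auto.
  rewrite IH, scal_C0. apply plus_zero_l.
Qed.

Lemma mlc_plus f g env : mlc (fun i => Cplus (f i) (g i)) env = plus (mlc f env) (mlc g env).
Proof.
  revert f g; induction env as [|v r IH]; intros f g; simpl.
  - now rewrite plus_zero_l.
  - rewrite (IH (fun i => f (S i)) (fun i => g (S i))), scal_Cplus.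
    rewrite <- !plus_assoc. f_equal.
    rewrite !plus_assoc. f_equal. apply plus_comm.
Qed.

Lemma mlc_scal c f env : mlc (fun i => Cmult c (f i)) env = scal c (mlc f env).
Proof.
  revert f; induction env as [|v r IH]; intros f; simpl.
  - symmetry; exact (@scal_zero_r C_Ring X c).
  - rewrite (IH (fun i => f (S i))), scal_Cmult.
    symmetry; exact (@scal_distr_l C_Ring X c _ _).
Qed.

Lemma opp_scal_C (x : X) : opp x = scal (Copp (RtoC 1)) x.
Proof. symmetry; exact (@scal_opp_one C_Ring X x). Qed.

Lemma mlc_opp f env : mlc (fun i => Copp (f i)) env = opp (mlc f env).
Proof.
  rewrite opp_scal_C, <- mlc_scal. apply mlc_ext; intros; ring.
Qed.

Lemma mlc_atom n env : mlc (mcoef (MAtom n)) env = nth n env zero.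
Proof.
  revert n; induction env as [|v r IH]; intros n; simpl.
  - now destruct n.
  - destruct n as [|n]; simpl.
    + rewrite mlc_zero, scal_C1. apply plus_zero_r.
    + rewrite scal_C0, plus_zero_l. apply (IH n).
Qed.

Lemma meval_mlc env e : meval env e = mlc (mcoef e) env.
Proof.
  induction e as [n| |a IHa b IHb|a IHa|a IHa b IHb|c a IHa]; cbn [meval].
  - symmetry; apply mlc_atom.
  - symmetry; apply mlc_zero.
  - rewrite IHa, IHb. symmetry; apply (mlc_plus (mcoef a) (mcoef b)).
  - rewrite IHa. symmetry; apply (mlc_opp (mcoef a)).
  - unfold minus. rewrite IHa, IHb, <- mlc_opp.
    symmetry; apply (mlc_plus (mcoef a) (fun i => Copp (mcoef b i))).
  - rewrite IHa. symmetry; apply (mlc_scal c (mcoef a)).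
Qed.

(** A nested conjunction instead of a bounded quantifier, so that [cbn] and [split] leave finitely
    many scalar goals. *)
Fixpoint mcoef_eq (f g : nat -> CC) (n : nat) : Prop :=
  match n with
  | O => True
  | S n => f n = g n /\ mcoef_eq f g n
  end.

Lemma meval_eq env e1 e2 :
  mcoef_eq (mcoef e1) (mcoef e2) (length env) -> meval env e1 = meval env e2.
Proof.
  intros H. rewrite !meval_mlc. apply mlc_ext.
  revert H; generalize (length env); induction n as [|n IH]; simpl; intros H i Hi; [lia|].
  destruct H as [H1 H2]. destruct (Nat.eq_dec i n) as [->|]; auto. apply IH; auto; lia.
Qed.

End ModuleTactic.

Ltac mod_index x l :=
  match l with
  | x :: _ => constr:(O)
  | _ :: ?r => let n := mod_index x r in constr:(S n)
  end.
Ltac mod_mem x l :=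
  match l with
  | x :: _ => constr:(true)
  | _ :: ?r => mod_mem x r
  | _ => constr:(false)
  end.
Ltac mod_atoms e l :=
  lazymatch e with
  | plus ?a ?b => let l := mod_atoms a l in mod_atoms b l
  | minus ?a ?b => let l := mod_atoms a l in mod_atoms b l
  | opp ?a => mod_atoms a l
  | scal _ ?a => mod_atoms a l
  | zero => l
  | _ => let b := mod_mem e l in
         lazymatch b with true => l | false => constr:(e :: l) end
  end.
Ltac mod_reify e l :=
  lazymatch e with
  | plus ?a ?b => let a := mod_reify a l in let b := mod_reify b l in constr:(MPlus a b)
  | minus ?a ?b => let a := mod_reify a l in let b := mod_reify b l in constr:(MMinus a b)
  | opp ?a => let a := mod_reify a l in constr:(MOpp a)
  | scal ?c ?a => let a := mod_reify a l in constr:(MScal c a)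
  | zero => constr:(MZero)
  | _ => let n := mod_index e l in constr:(MAtom n)
  end.
Ltac mod_pre :=
  lazymatch goal with
  | |- @eq ?T ?a ?b =>
    let l := mod_atoms a (@nil T) in
    let l := mod_atoms b l in
    let ea := mod_reify a l in
    let eb := mod_reify b l in
    refine (meval_eq l ea eb _);
    cbn [mcoef mcoef_eq length Nat.eqb]; repeat split
  end.
(* Proves an equality of linear combinations by comparing the coefficients of every atom. *)
Ltac mod_eq := mod_pre; first [ring | field; auto].
(* Replaces the last argument of the goal by an equal linear combination. *)
Ltac as_mod t :=
  lazymatch goal with
  | |- ?P ?a => refine (eq_ind t P _ a _); [|mod_eq]
  end.
Ltac norm_as_in H t :=
  match type of H with
  | context [norm ?e] => let E := fresh in assert (E : e = t) by mod_eq; rewrite E in H; clear E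
  end.
Ltac norm_as t :=
  match goal with
  | |- context [norm ?e] => let E := fresh in assert (E : e = t) by mod_eq; rewrite E; clear E
  end.

(** * Spans, independence and the exchange argument modulo a subspace *)

Section LinAlg.
Context {X : CompleteNormedModule C_AbsRing}.
Implicit Types (P Q Y : X -> Prop) (l : list X).

Definition subsp P : Prop :=
  P zero /\ (forall x y, P x -> P y -> P (plus x y)) /\ (forall (c : CC) x, P x -> P (scal c x)).

Definition only0 : X -> Prop := fun x => x = zero.

Lemma subsp_plus P x y : subsp P -> P x -> P y -> P (plus x y).
Proof. intros H; apply H. Qed.

Lemma subsp_scal P (c : CC) x : subsp P -> P x -> P (scal c x).
Proof. intros H; apply H. Qed.

Lemma subsp_minus P x y : subsp P -> P x -> P y -> P (minus x y).
Proof.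
  intros [_ [Hp Hs]] Hx Hy. replace (minus x y) with (plus x (scal (Copp (RtoC 1)) y)) by mod_eq.
  auto.
Qed.

Lemma subsp_only0 : subsp only0.
Proof.
  unfold only0. split; [|split]; auto.
  - intros x y -> ->. mod_eq.
  - intros c x ->. mod_eq.
Qed.

Definition add1 P (v : X) : X -> Prop := fun x => exists a : CC, P (minus x (scal a v)).

(** Everything is relative to a subspace [P], so that one theory serves [X] itself ([P] is [only0],
    for kernels) and the quotient by a range (for cokernels) without forming quotient spaces. *)
Fixpoint spanmod P l : X -> Prop :=
  match l with
  | nil => P
  | v :: r => add1 (spanmod P r) v
  end.

Fixpoint indmod P l : Prop :=
  match l with
  | nil => True
  | v :: r => ~ spanmod P r v /\ indmod P r
  end.

Definition span l := spanmod only0 l.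

Lemma subsp_add1 P v : subsp P -> subsp (add1 P v).
Proof.
  intros [H0 [Hp Hs]]. split; [|split].
  - exists (RtoC 0). as_mod (@zero X). auto.
  - intros x y [a Ha] [b Hb]. exists (Cplus a b).
    as_mod (plus (minus x (scal a v)) (minus y (scal b v))). auto.
  - intros c x [a Ha]. exists (Cmult c a).
    as_mod (scal c (minus x (scal a v))). auto.
Qed.

Lemma subsp_spanmod P l : subsp P -> subsp (spanmod P l).
Proof. intros H; induction l; simpl; auto using subsp_add1. Qed.

Lemma subsp_span l : subsp (span l).
Proof. apply subsp_spanmod, subsp_only0. Qed.

Lemma add1_mono P Q v x : (forall y, P y -> Q y) -> add1 P v x -> add1 Q v x.
Proof. intros H [a Ha]; exists a; auto. Qed.

Lemma add1_base P v x : P x -> add1 P v x.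
Proof. intros H. exists (RtoC 0). as_mod x. auto. Qed.

Lemma add1_gen P v : subsp P -> add1 P v v.
Proof. intros [H _]. exists (RtoC 1). as_mod (@zero X). auto. Qed.

Lemma add1_least P Q v x : subsp Q -> (forall y, P y -> Q y) -> Q v -> add1 P v x -> Q x.
Proof.
  intros HQ H Hv [a Ha]. replace x with (plus (minus x (scal a v)) (scal a v)) by mod_eq.
  apply HQ; auto. apply HQ; auto.
Qed.

Lemma add1_swap P u v x : add1 (add1 P u) v x -> add1 (add1 P v) u x.
Proof.
  intros [a [b H]]. exists b, a.
  as_mod (minus (minus x (scal a v)) (scal b u)). auto.
Qed.

Lemma spanmod_mono P Q l x : (forall y, P y -> Q y) -> spanmod P l x -> spanmod Q l x.
Proof.
  intros H; revert x; induction l as [|v r IH]; simpl; intros x; auto.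
  apply add1_mono; auto.
Qed.

Lemma spanmod_base P l x : P x -> spanmod P l x.
Proof. intros H; induction l; simpl; auto using add1_base. Qed.

Lemma spanmod_gen P l v : subsp P -> In v l -> spanmod P l v.
Proof.
  intros HP; induction l as [|w r IH]; simpl; [tauto|]. intros [->|H].
  - apply add1_gen, subsp_spanmod; auto.
  - apply add1_base; auto.
Qed.

Lemma spanmod_least P Q l x :
  subsp Q -> (forall y, P y -> Q y) -> (forall v, In v l -> Q v) -> spanmod P l x -> Q x.
Proof.
  intros HQ H; revert x; induction l as [|v r IH]; simpl; intros x Hl; auto.
  apply add1_least; auto.
Qed.

Lemma spanmod_incl P l l' x : subsp P -> incl l l' -> spanmod P l x -> spanmod P l' x.
Proof.
  intros HP Hl. apply spanmod_least; auto using subsp_spanmod, spanmod_base.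
  intros v Hv; apply spanmod_gen; auto.
Qed.

Lemma spanmod_app P l l' x : spanmod P (l ++ l') x <-> spanmod (spanmod P l') l x.
Proof.
  revert x; induction l as [|v r IH]; simpl; intros x; [tauto|].
  split; apply add1_mono; intros; apply IH; auto.
Qed.

Lemma spanmod_add1 P v l x : spanmod (add1 P v) l x <-> add1 (spanmod P l) v x.
Proof.
  revert x; induction l as [|w r IH]; simpl; intros x; [tauto|]. split; intros H.
  - apply add1_swap. revert H; apply add1_mono; intros; apply IH; auto.
  - apply add1_swap in H. revert H; apply add1_mono; intros; apply IH; auto.
Qed.

Lemma add1_exchange P v x : subsp P -> add1 P v x -> ~ P x -> add1 P x v.
Proof.
  intros HP [a Ha] Hx. destruct (classic (a = RtoC 0)) as [->|Hn].
  - exfalso; apply Hx. replace x with (minus x (scal (RtoC 0) v)) by mod_eq. auto.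
  - exists (Cinv a). as_mod (scal (Copp (Cinv a)) (minus x (scal a v))); auto.
    apply HP; auto.
Qed.

Lemma indmod_mono P Q l : (forall y, Q y -> P y) -> indmod P l -> indmod Q l.
Proof.
  intros H; induction l as [|v r IH]; simpl; auto. intros [H1 H2]; split; auto.
  intros H3; apply H1; revert H3; apply spanmod_mono; auto.
Qed.

Lemma indmod_app P l l' : indmod (spanmod P l') l -> indmod P l' -> indmod P (l ++ l').
Proof.
  induction l as [|v r IH]; simpl; auto. intros [H1 H2] H3; split; auto.
  rewrite spanmod_app; auto.
Qed.

Lemma indmod_add1 P v l : subsp P -> ~ spanmod P l v -> indmod P l -> indmod (add1 P v) l.
Proof.
  intros HP; induction l as [|y r IH]; simpl; auto. intros Hv [H1 H2]; split.
  - rewrite spanmod_add1. intros H3. apply Hv. apply add1_exchange; auto using subsp_spanmod.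
  - apply IH; auto. intros H3; apply Hv, add1_base; auto.
Qed.

(** Enlarging [P] by one vector costs at most one member of the list. If [x] becomes dependent on
    the rest [r], then [r] stays independent: otherwise [v] would lie in the span of [r] modulo [P],
    and so would [x]. *)
Lemma indmod_drop P v l : subsp P -> indmod P l ->
  exists l', incl l' l /\ (length l <= S (length l'))%nat /\ indmod (add1 P v) l'.
Proof.
  intros HP; induction l as [|x r IH]; simpl.
  - exists nil; simpl; repeat split; auto. apply incl_refl.
  - intros [H1 H2]. destruct (classic (spanmod (add1 P v) r x)) as [H|H].
    + exists r; repeat split; auto.
      * apply incl_tl, incl_refl.
      * apply indmod_add1; auto. intros H3. apply H1.
        rewrite spanmod_add1 in H. revert H; apply add1_least; auto using subsp_spanmod.
    + destruct (IH H2) as [l' [Hi [Hl Hn]]]. exists (x :: l'); simpl; repeat split; auto; try lia.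
      * intros y [->|Hy]; simpl; auto.
      * intros H3; apply H; revert H3; apply spanmod_incl; auto using subsp_add1.
Qed.

(** Induction on the spanning list: its head is absorbed into [P], and [indmod_drop] bounds the loss
    in [l]. *)
Lemma steinitz P l m : subsp P -> indmod P l -> (forall x, In x l -> spanmod P m x) ->
  (length l <= length m)%nat.
Proof.
  revert P l; induction m as [|v m IH]; simpl; intros P l HP Hl Hs.
  - destruct l as [|x r]; simpl; auto. exfalso.
    destruct Hl as [H _]; apply H, spanmod_base, Hs; simpl; auto.
  - destruct (indmod_drop P v l HP Hl) as [l' [Hi [Hle Hn]]].
    apply IH in Hn; auto using subsp_add1; [lia|].
    intros x Hx. rewrite spanmod_add1. apply Hs; auto.
Qed.

(** Replaces a dimension function with possibly infinite values: a set either contains [N]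
    independent vectors or has a basis of fewer than [N]. *)
Lemma dim_dichotomy P Q N : subsp P ->
  (exists l, length l = N /\ (forall x, In x l -> Q x) /\ indmod P l) \/
  (exists l, (length l < N)%nat /\ (forall x, In x l -> Q x) /\ indmod P l /\
             forall x, Q x -> spanmod P l x).
Proof.
  intros HP; induction N as [|N IH].
  - left; exists nil; simpl; repeat split; auto; tauto.
  - destruct IH as [[l [Hl [HQ Hi]]]|[l [Hl H]]].
    + destruct (classic (forall x, Q x -> spanmod P l x)) as [H|H].
      * right; exists l; repeat split; auto; lia.
      * apply not_all_ex_not in H. destruct H as [x H]. apply imply_to_and in H. destruct H as [H1 H2].
        left; exists (x :: l); simpl; repeat split; auto. intros y [->|Hy]; auto.
    + right; exists l; split; [lia|auto].
Qed.

Lemma basis_exists P Q N : subsp P ->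
  (forall l, (forall x, In x l -> Q x) -> indmod P l -> (length l <= N)%nat) ->
  exists l, (length l <= N)%nat /\ (forall x, In x l -> Q x) /\ indmod P l /\
            forall x, Q x -> spanmod P l x.
Proof.
  intros HP H. destruct (dim_dichotomy P Q (S N) HP) as [[l [Hl [HQ Hi]]]|[l [Hl H']]].
  - apply H in HQ; auto. lia.
  - exists l; split; auto; lia.
Qed.

(** Bridge from the recursive spans to the coefficient lists in which [alpha_is] and [beta_is] are
    phrased. *)
Lemma spanmod_lincomb P l x : subsp P ->
  (spanmod P l x <-> exists cs, length cs = length l /\ P (minus x (lincomb cs l))).
Proof.
  intros HP; revert x; induction l as [|v r IH]; simpl; intros x.
  - split.
    + intros H; exists nil; split; auto.
      change (lincomb nil nil) with (@zero X). as_mod x. auto.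
    + intros [[|c cs] [H1 H2]]; simpl in H1; [|lia].
      change (lincomb nil nil) with (@zero X) in H2. as_mod (minus x zero). auto.
  - split.
    + intros [a Ha]. apply IH in Ha. destruct Ha as [cs [H1 H2]]. exists (a :: cs); simpl.
      split; [lia|]. as_mod (minus (minus x (scal a v)) (lincomb cs r)). auto.
    + intros [[|c cs] [H1 H2]]; simpl in *; [lia|]. exists c. apply IH. exists cs. split; [lia|].
      as_mod (minus x (plus (scal c v) (lincomb cs r))). auto.
Qed.

Lemma indmod_lincomb P l : subsp P ->
  (indmod P l <-> forall cs, length cs = length l -> P (lincomb cs l) -> List.Forall (fun c => c = RtoC 0) cs).
Proof.
  intros HP; induction l as [|v r IH]; simpl.
  - split; auto. intros _ [|c cs] H; simpl in *; [auto|lia].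
  - split.
    + intros [H1 H2] [|c cs] Hl H; simpl in *; [lia|].
      destruct (classic (c = RtoC 0)) as [->|Hn].
      * constructor; auto. apply IH; auto.
        replace (lincomb cs r) with (plus (scal (RtoC 0) v) (lincomb cs r)) by mod_eq. auto.
      * exfalso; apply H1.
        assert (Hs : spanmod P r (scal c v)).
        { replace (scal c v) with (minus (plus (scal c v) (lincomb cs r)) (lincomb cs r)) by mod_eq.
          apply subsp_minus; auto using subsp_spanmod, spanmod_base.
          apply spanmod_lincomb; auto. exists cs. split; [lia|].
          as_mod (@zero X). apply HP. }
        replace v with (scal (Cinv c) (scal c v)) by mod_eq.
        apply subsp_spanmod; auto.
    + intros H; split.
      * intros Hs. apply spanmod_lincomb in Hs; auto. destruct Hs as [cs [Hl Hp]].
        assert (HF : List.Forall (fun c => c = RtoC 0) (Copp (RtoC 1) :: cs)).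
        { apply H; simpl; [lia|].
          as_mod (scal (Copp (RtoC 1)) (minus v (lincomb cs r))).
          apply HP; auto. }
        inversion HF as [|? ? Ha Hb]. injection Ha. intros; lra.
      * apply IH. intros cs Hl Hp.
        assert (HF : List.Forall (fun c => c = RtoC 0) (RtoC 0 :: cs)).
        { apply H; simpl; [lia|]. as_mod (lincomb cs r). auto. }
        inversion HF; auto.
Qed.

End LinAlg.

(** * Images and preimages of spans under linear operators *)

Section LinOps.
Context {X : CompleteNormedModule C_AbsRing}.
Implicit Types (P Q Y : X -> Prop) (l : list X) (A G V R : X -> X).

Lemma lin_minus A x y : is_linear A -> A (minus x y) = minus (A x) (A y).
Proof.
  intros [Hp Hs]. replace (minus x y) with (plus x (scal (Copp (RtoC 1)) y)) by mod_eq.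
  rewrite Hp, Hs. mod_eq.
Qed.

Lemma lin_zero A : is_linear A -> A zero = zero.
Proof.
  intros [_ Hs]. transitivity (A (scal (RtoC 0) zero)).
  - f_equal. symmetry; apply scal_C0.
  - rewrite Hs. apply scal_C0.
Qed.

Lemma is_linear_shift A (z : CC) : is_linear A -> is_linear (op_shift A z).
Proof.
  intros [Hp Hs]; split; intros; unfold op_shift; rewrite ?Hp, ?Hs; mod_eq.
Qed.

Lemma subsp_range A : is_linear A -> subsp (range A).
Proof.
  intros H. split; [|split].
  - exists zero. symmetry; apply lin_zero; auto.
  - intros x y [a ->] [b ->]. exists (plus a b). symmetry; apply H.
  - intros c x [a ->]. exists (scal c a). symmetry; apply H.
Qed.

Lemma subsp_preim A P : is_linear A -> subsp P -> subsp (fun x => P (A x)).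
Proof.
  intros H HP. split; [|split].
  - rewrite lin_zero by auto. apply HP.
  - intros x y Hx Hy. destruct H as [Hp _]. rewrite Hp. apply HP; auto.
  - intros c x Hx. destruct H as [_ Hs]. rewrite Hs. apply HP; auto.
Qed.

Lemma subsp_kernel A : is_linear A -> subsp (kernel A).
Proof. intros H. apply (subsp_preim A only0); auto. apply subsp_only0. Qed.

Lemma spanmod_map A P Q l x : is_linear A -> (forall y, P y -> Q (A y)) ->
  spanmod P l x -> spanmod Q (map A l) (A x).
Proof.
  intros HA H; revert x; induction l as [|v r IH]; simpl; intros x; auto.
  intros [a Ha]. exists a. apply IH in Ha. rewrite lin_minus in Ha by auto.
  destruct HA as [_ Hs]. rewrite Hs in Ha. auto.
Qed.

Lemma indmod_of_map A P Q l : is_linear A -> (forall y, P y -> Q (A y)) ->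
  indmod Q (map A l) -> indmod P l.
Proof.
  intros HA H; induction l as [|v r IH]; simpl; auto. intros [H1 H2]; split; auto.
  intros H3; apply H1. revert H3; apply spanmod_map; auto.
Qed.

Lemma spanmod_shift P l l' x : subsp P -> Forall2 (fun a b : X => P (minus a b)) l l' ->
  spanmod P l x -> spanmod P l' x.
Proof.
  intros HP H; revert x; induction H as [|a b l l' Hab H IH]; simpl; intros x; auto.
  intros [c Hc]. exists c. apply IH in Hc.
  as_mod (plus (minus x (scal c a)) (scal c (minus a b))).
  apply subsp_spanmod; auto. apply subsp_spanmod; auto. apply spanmod_base; auto.
Qed.

Lemma indmod_shift P l l' : subsp P -> Forall2 (fun a b : X => P (minus a b)) l l' ->
  indmod P l -> indmod P l'.
Proof.
  intros HP H; induction H as [|a b l l' Hab H IH]; simpl; auto.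
  intros [H1 H2]; split; auto. intros H3; apply H1.
  assert (H4 : spanmod P l b).
  { revert H3; apply spanmod_shift; auto. clear -H HP. induction H; constructor; auto.
    as_mod (scal (Copp (RtoC 1)) (minus x y)). apply HP; auto. }
  as_mod (plus b (minus a b)). apply subsp_spanmod; auto. apply spanmod_base; auto.
Qed.

(** If some [G z] lies in [P] plus the line of [u] but not in [P], the exchange property lets [G z]
    replace [u]; if there is no such [z], the preimage does not grow at all. *)
Lemma preim_add1 G P u : is_linear G -> subsp P ->
  exists z, forall y, add1 P u (G y) -> add1 (fun x => P (G x)) z y.
Proof.
  intros HG HP. destruct (classic (exists z, add1 P u (G z) /\ ~ P (G z))) as [[z [H1 H2]]|H].
  - exists z. intros y Hy.
    assert (Hu : add1 P (G z) u) by (apply add1_exchange; auto).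
    assert (H3 : add1 P (G z) (G y)).
    { revert Hy; apply add1_least; auto using subsp_add1, add1_base. }
    destruct H3 as [a Ha]. exists a. rewrite lin_minus by auto.
    destruct HG as [_ Hs]; rewrite Hs; auto.
  - exists zero. intros y Hy. apply add1_base. apply NNPP. intros H'; apply H; exists y; auto.
Qed.

Lemma preim_spanmod G P l : is_linear G -> subsp P ->
  exists l', length l' = length l /\
    forall y, spanmod P l (G y) -> spanmod (fun x => P (G x)) l' y.
Proof.
  intros HG HP; induction l as [|u r [r' [Hl H]]]; simpl.
  - exists nil; auto.
  - destruct (preim_add1 G (spanmod P r) u) as [z Hz]; auto using subsp_spanmod.
    exists (z :: r'); simpl; split; auto. intros y Hy. apply Hz in Hy.
    revert Hy; apply add1_mono; auto.
Qed.

Lemma basis_of_span P l : subsp P ->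
  exists b, indmod P b /\ (forall x, In x b -> spanmod P l x) /\ forall x, spanmod P l x -> spanmod P b x.
Proof.
  intros HP. destruct (basis_exists P (spanmod P l) (length l)) as [b [_ [H1 [H2 H3]]]]; auto.
  - intros m Hm Hi. apply steinitz with P; auto.
  - exists b; auto.
Qed.

(* As a finite-rank perturbation of the bijection [V], the operator [G] has index zero; this and
   the next lemma are the two inequalities hidden in that statement. *)
Lemma preim_dim_ge V R G (f v : list X) :
  is_linear V -> is_linear R -> is_linear G -> (forall x, V (R x) = x) ->
  (forall x, span f (minus (V x) (G x))) -> indmod only0 v ->
  exists z, length z = length v /\ indmod only0 z /\ forall x, In x z -> span v (G x).
Proof.
  intros HV HR HG HVR Hf Hv.
  destruct (dim_dichotomy only0 (fun x => span v (G x)) (length v) subsp_only0)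
    as [[z [H1 [H2 H3]]]|[l [Hl [_ [_ Hs]]]]]; [exists z; auto|exfalso].
  (* The preimage under [G] of the span of [f'] and [v] would be spanned by fewer than
     [length f' + length v] vectors. It contains [R y] for every [y] in [f' ++ v], since [G (R y)]
     is [y] minus a vector of the span of [f], and these [R y] are independent because [V] maps them
     back. *)
  destruct (basis_of_span (span v) f (subsp_span v)) as [f' [Hf1 [_ Hf2]]].
  destruct (preim_spanmod G (span v) f') as [l' [Hl' Hp]]; auto using subsp_span.
  assert (HB : indmod only0 (map R (f' ++ v))).
  { apply indmod_of_map with V only0; auto.
    - unfold only0; intros y ->; apply lin_zero; auto.
    - rewrite map_map. rewrite (map_ext _ (fun x => x)), map_id by auto. apply indmod_app; auto. }
  apply (steinitz only0 _ (l' ++ l) subsp_only0) in HB.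
  - rewrite length_map, !length_app in HB. lia.
  - intros x Hx. apply in_map_iff in Hx. destruct Hx as [y [<- Hy]].
    apply spanmod_app. apply spanmod_mono with (fun x => span v (G x)); auto.
    apply Hp. assert (E : G (R y) = minus y (minus (V (R y)) (G (R y)))) by (rewrite HVR; mod_eq).
    rewrite E. apply subsp_minus; auto using subsp_spanmod, subsp_span.
    + apply spanmod_app. apply spanmod_gen; auto using subsp_only0.
    + apply Hf2. specialize (Hf (R y)). revert Hf; apply spanmod_mono.
      unfold only0; intros ? ->; apply subsp_span.
Qed.

Lemma preim_dim_le V R G (f w z : list X) :
  is_linear V -> is_linear R -> is_linear G -> (forall x, R (V x) = x) ->
  (forall x, span f (minus (V x) (G x))) ->
  (forall x : X, exists y, span w (minus x (G y))) ->
  indmod only0 z -> (forall x, In x z -> span w (G x)) -> (length z <= length w)%nat.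
Proof.
  intros HV HR HG HRV Hf Hw Hz HzG.
  (* The vectors of [f'] are lifted to [xs] with [G xs] equal to [f'] modulo [w]. Then [xs ++ z] is
     independent and lies in the image under [R] of the span of [f' ++ w]; counting and cancelling
     [length f'] gives the bound. *)
  destruct (basis_of_span (span w) f (subsp_span w)) as [f' [Hf1 [_ Hf2]]].
  assert (Hxs : exists xs, Forall2 (fun a b : X => span w (minus a b)) f' (map G xs)).
  { clear -Hw. induction f' as [|a r [xs IH]].
    - exists nil; constructor.
    - destruct (Hw a) as [y Hy]. exists (y :: xs); constructor; auto. }
  destruct Hxs as [xs Hxs].
  assert (Hlen : length f' = length xs) 
    by (apply Forall2_length in Hxs; rewrite length_map in Hxs; exact Hxs).
  assert (Hi : indmod only0 (xs ++ z)).
  { apply indmod_app; auto. apply indmod_mono with (fun x => span w (G x)).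
    - intros y. apply (spanmod_least only0 (fun x => span w (G x)) z y); auto.
      + apply subsp_preim; auto using subsp_span.
      + unfold only0; intros ? ->. rewrite lin_zero by auto. apply subsp_span.
    - apply indmod_of_map with G (span w); auto.
      apply indmod_shift with f'; auto using subsp_span. }
  assert (Hsp : forall x, spanmod (span w) f' (G x) -> spanmod only0 (map R (f' ++ w)) x).
  { intros x Hx. rewrite <- (HRV x). apply spanmod_map with only0; auto.
    - unfold only0; intros y ->; apply lin_zero; auto.
    - apply spanmod_app. as_mod (plus (G x) (minus (V x) (G x))).
      apply (subsp_plus (spanmod (span w) f')); auto using subsp_spanmod, subsp_span. apply Hf2.
      specialize (Hf x). revert Hf; apply spanmod_mono.
      unfold only0; intros ? ->; apply subsp_span. }
  apply (steinitz only0 _ (map R (f' ++ w)) subsp_only0) in Hi.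
  - rewrite length_map, !length_app in Hi. lia.
  - intros x Hx. apply Hsp. apply in_app_iff in Hx. destruct Hx as [Hx|Hx].
    + assert (HG' : In (G x) (map G xs)) by (apply in_map; auto).
      apply spanmod_shift with (map G xs); auto using subsp_span.
      * clear -Hxs. induction Hxs; constructor; auto.
        as_mod (scal (Copp (RtoC 1)) (minus x y)). apply subsp_span; auto.
      * apply spanmod_gen; auto using subsp_span.
    + apply spanmod_base; auto.
Qed.

Lemma alpha_is_basis A n : is_linear A ->
  (alpha_is A n <-> exists l, length l = n /\ (forall x, In x l -> kernel A x) /\ indmod only0 l /\
     forall x, kernel A x -> span l x).
Proof.
  intros HA. unfold alpha_is, subspace_dim. split; intros [l [H1 [H2 [H3 H4]]]]; exists l.
  - repeat split; auto.
    + apply Forall_forall; auto.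
    + apply indmod_lincomb; auto using subsp_only0.
    + intros x Hx. destruct (H4 x Hx) as [cs [Hc ->]]. apply spanmod_lincomb; auto using subsp_only0.
      exists cs; split; [lia|]. unfold only0. mod_eq.
  - split; [|split; [|split]]; auto.
    + apply Forall_forall; auto.
    + unfold lin_indep. intros cs Hl H0. apply (proj1 (indmod_lincomb only0 l subsp_only0)); auto.
    + intros x Hx. apply H4 in Hx. apply spanmod_lincomb in Hx; auto using subsp_only0.
      destruct Hx as [cs [Hc Hx]]. exists cs; split; [lia|]. unfold only0 in Hx.
      replace x with (plus (minus x (lincomb cs l)) (lincomb cs l)) by mod_eq. rewrite Hx. mod_eq.
Qed.

Lemma beta_is_basis A n : is_linear A ->
  (beta_is A n <-> exists l, length l = n /\ indmod (range A) l /\ forall x, spanmod (range A) l x).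
Proof.
  intros HA. pose proof (subsp_range A HA) as HR. unfold beta_is.
  split; intros [l [H1 [H2 H3]]]; exists l; split; auto; split.
  - apply indmod_lincomb; auto. intros cs Hc; apply H2; lia.
  - intros x. destruct (H3 x) as [cs [y [Hc [Hy ->]]]]. apply spanmod_lincomb; auto.
    exists cs; split; [lia|]. as_mod y. auto.
  - intros cs Hc. apply (proj1 (indmod_lincomb (range A) l HR)); auto; lia.
  - intros x. specialize (H3 x). apply spanmod_lincomb in H3; auto. destruct H3 as [cs [Hc Hx]].
    exists cs, (minus x (lincomb cs l)). repeat split; auto; try lia. mod_eq.
Qed.

End LinOps.

(** * Closed subspaces, Riesz sequences and the open mapping theorem *)

Lemma inv_INR_lt (e : R) : 0 < e -> exists N, forall n, (N <= n)%nat -> / (INR n + 1) < e.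
Proof.
  intros He. destruct (archimed_cor1 e He) as [N [H1 H2]]. exists N. intros n Hn.
  apply Rle_lt_trans with (/ INR N); auto. apply Rinv_le_contravar.
  - apply lt_0_INR; auto.
  - apply le_INR in Hn. lra.
Qed.

Lemma inv_INR_pos n : 0 < / (INR n + 1).
Proof. apply Rinv_0_lt_compat. pose proof (pos_INR n); lra. Qed.

Lemma epsilon_choice {A B : Type} (P : A -> B -> Prop) :
  (forall a, exists b, P a b) -> exists f, forall a, P a (f a).
Proof.
  intros H. exists (fun a => proj1_sig (constructive_indefinite_description _ (H a))).
  intros a. apply proj2_sig.
Qed.

Lemma bounded_cluster_R (u : nat -> R) (M : R) : (forall n, Rabs (u n) <= M) ->
  exists x, forall e N, 0 < e -> exists n, (N <= n)%nat /\ Rabs (u n - x) < e.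
Proof.
  intros H. destruct (Bolzano_Weierstrass u (fun c => - M <= c <= M)) as [x Hx].
  - apply compact_P3.
  - intros n. specialize (H n). apply Rabs_le_between in H. auto.
  - exists x. intros e N He. destruct (Hx (disc x (mkposreal e He)) N) as [p [Hp1 Hp2]].
    + exists (mkposreal e He). intros y Hy; auto.
    + exists p; split; auto.
Qed.

Lemma Cmod_le_abs (z : CC) : Cmod z <= Rabs (fst z) + Rabs (snd z).
Proof.
  destruct z as [a b]; simpl. unfold Cmod; simpl.
  rewrite <- (sqrt_Rsqr (Rabs a + Rabs b)).
  - apply sqrt_le_1_alt. unfold Rsqr.
    pose proof (Rabs_pos a). pose proof (Rabs_pos b).
    assert (Ha : a * a = Rabs a * Rabs a) by (rewrite <- Rabs_mult; symmetry; apply Rabs_pos_eq; nra).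
    assert (Hb : b * b = Rabs b * Rabs b) by (rewrite <- Rabs_mult; symmetry; apply Rabs_pos_eq; nra).
    nra.
  - pose proof (Rabs_pos a). pose proof (Rabs_pos b). lra.
Qed.

Lemma abs_le_Cmod (z : CC) : Rabs (fst z) <= Cmod z /\ Rabs (snd z) <= Cmod z.
Proof.
  pose proof (Rmax_Cmod z). pose proof (Rmax_l (Rabs (fst z)) (Rabs (snd z))).
  pose proof (Rmax_r (Rabs (fst z)) (Rabs (snd z))). lra.
Qed.

Lemma bounded_cluster (u : nat -> CC) (M : R) : (forall n, Cmod (u n) <= M) ->
  exists z, forall e N, 0 < e -> exists n, (N <= n)%nat /\ Cmod (Cminus (u n) z) < e.
Proof.
  intros H. destruct (bounded_cluster_R (fun n => fst (u n)) M) as [x Hx].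
  { intros n. specialize (H n). pose proof (abs_le_Cmod (u n)). lra. }
  (* A subsequence along which the real parts converge; the imaginary parts are then clustered along
     it. *)
  destruct (epsilon_choice (fun k n => (k <= n)%nat /\ Rabs (fst (u n) - x) < / (INR k + 1)))
    as [f Hf].
  { intros k. apply Hx. apply inv_INR_pos. }
  destruct (bounded_cluster_R (fun n => snd (u (f n))) M) as [y Hy].
  { intros n. specialize (H (f n)). pose proof (abs_le_Cmod (u (f n))). lra. }
  exists (x, y). intros e N He. destruct (inv_INR_lt (e / 2)) as [N1 HN1]; [lra|].
  destruct (Hy (e / 2) (N + N1)%nat) as [k [Hk1 Hk2]]; [lra|].
  destruct (Hf k) as [Hf1 Hf2]. exists (f k). split; [lia|].
  apply Rle_lt_trans with (1 := Cmod_le_abs _). simpl.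
  specialize (HN1 k ltac:(lia)). unfold Rminus in *. lra.
Qed.

Section Analysis.
Context {X : CompleteNormedModule C_AbsRing}.
Implicit Types (P Q Y : X -> Prop) (l : list X) (A G V : X -> X).

Lemma norm_pos (x : X) : 0 <= norm x.
Proof. exact (norm_ge_0 x). Qed.

Lemma norm_0 : norm (@zero X) = 0.
Proof. exact (@norm_zero C_AbsRing X). Qed.

Lemma norm_eq0 (x : X) : norm x = 0 -> x = zero.
Proof. exact (norm_eq_zero x). Qed.

Lemma norm_scal_le (c : CC) (x : X) : norm (scal c x) <= Cmod c * norm x.
Proof. exact (norm_scal c x). Qed.

Lemma norm_scal_C (c : CC) (x : X) : norm (scal c x) = Cmod c * norm x.
Proof.
  apply Rle_antisym; [apply norm_scal_le|].
  destruct (classic (c = RtoC 0)) as [->|Hc].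
  - rewrite Cmod_0. pose proof (norm_pos (scal (RtoC 0) x)). lra.
  - replace x with (scal (Cinv c) (scal c x)) at 1 by mod_eq.
    pose proof (norm_scal_le (Cinv c) (scal c x)) as H. rewrite Cmod_inv in H by auto.
    assert (0 < Cmod c) by (apply Cmod_gt_0; auto).
    apply Rmult_le_compat_l with (r := Cmod c) in H; [|lra].
    rewrite <- Rmult_assoc, Rinv_r, Rmult_1_l in H by lra. auto.
Qed.

Lemma norm_plus_le (x y : X) : norm (plus x y) <= norm x + norm y.
Proof. exact (norm_triangle x y). Qed.

Lemma norm_minus_le (x y : X) : norm (minus x y) <= norm x + norm y.
Proof.
  replace (minus x y) with (plus x (scal (Copp (RtoC 1)) y)) by mod_eq.
  apply Rle_trans with (1 := norm_plus_le _ _). rewrite norm_scal_C, Cmod_opp, Cmod_1. lra.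
Qed.

Lemma norm_minus_sym (x y : X) : norm (minus x y) = norm (minus y x).
Proof.
  replace (minus x y) with (scal (Copp (RtoC 1)) (minus y x)) by mod_eq.
  rewrite norm_scal_C, Cmod_opp, Cmod_1. ring.
Qed.

Lemma norm_minus_tri (x y z : X) : norm (minus x z) <= norm (minus x y) + norm (minus y z).
Proof. replace (minus x z) with (plus (minus x y) (minus y z)) by mod_eq. apply norm_plus_le. Qed.

Lemma norm_minus_ge (x y : X) : norm x - norm y <= norm (minus x y).
Proof.
  pose proof (norm_plus_le (minus x y) y) as H.
  norm_as_in H x. lra.
Qed.

Lemma norm_small_eq (x y : X) : (forall e, 0 < e -> norm (minus x y) < e) -> x = y.
Proof.
  intros H. assert (H0 : minus x y = zero).
  { apply norm_eq0. pose proof (norm_pos (minus x y)).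
    destruct (Req_dec (norm (minus x y)) 0) as [E|E]; auto. specialize (H (norm (minus x y))). lra. }
  replace x with (plus (minus x y) y) by mod_eq. rewrite H0. mod_eq.
Qed.

Definition conv (u : nat -> X) (y : X) : Prop :=
  forall e, 0 < e -> exists N, forall n, (N <= n)%nat -> norm (minus (u n) y) < e.

Lemma complete_seq (u : nat -> X) :
  (forall e, 0 < e -> exists N, forall m n, (N <= m)%nat -> (N <= n)%nat -> norm (minus (u m) (u n)) < e) ->
  exists y, conv u y.
Proof.
  intros H.
  destruct (proj1 (@filterlim_locally_cauchy nat X eventually _ u)) as [y Hy].
  - intros eps. destruct (H (eps)) as [N HN]; [apply cond_pos|].
    exists (fun n => (N <= n)%nat). split; [exists N; auto|].
    intros m n Hm Hn. apply (@norm_compat1 C_AbsRing X). apply HN; auto.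
  - exists y. intros e He.
    assert (HL : locally y (fun z : X => norm (minus z y) < e)).
    { apply (@locally_le_locally_norm C_AbsRing X). exists (mkposreal e He). intros z Hz. exact Hz. }
    apply Hy in HL. destruct HL as [N HN]. exists N; auto.
Qed.

Definition nclosed P : Prop := forall x, (forall e, 0 < e -> exists y, P y /\ norm (minus x y) < e) -> P x.

Lemma closed_nclosed P : closed P <-> nclosed P.
Proof.
  split.
  - intros H x Hx. apply H. intros HL.
    apply (@locally_norm_le_locally C_AbsRing X) in HL. destruct HL as [e He].
    destruct (Hx e (cond_pos e)) as [y [Hy1 Hy2]]. apply (He y); auto.
    unfold ball_norm. rewrite norm_minus_sym. exact Hy2.
  - intros H x Hx. apply H. intros e He. apply NNPP. intros Hn. apply Hx.
    apply (@locally_le_locally_norm C_AbsRing X). exists (mkposreal e He). intros y Hy Hp.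
    apply Hn. exists y. split; auto. rewrite norm_minus_sym. exact Hy.
Qed.

Lemma nclosed_dist P v : nclosed P -> ~ P v -> exists d, 0 < d /\ forall p, P p -> d <= norm (minus v p).
Proof.
  intros HP Hv. apply NNPP. intros H. apply Hv, HP. intros e He. apply NNPP. intros H'. apply H.
  exists e; split; auto. intros p Hp. apply Rnot_lt_le. intros Hl. apply H'; exists p; auto.
Qed.

Lemma nclosed_only0 : nclosed (@only0 X).
Proof.
  intros x Hx. unfold only0 in *. apply norm_small_eq. intros e He.
  destruct (Hx e He) as [y [-> Hy]]. auto.
Qed.

(** After division by [a], the vector [x] becomes [v] minus an element of [P]. This bound on a
    coordinate by a distance takes the place of continuous coordinate functionals. *)
Lemma dist_coef P v (d : R) : subsp P -> (forall p, P p -> d <= norm (minus v p)) ->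
  forall (a : CC) x, P (minus x (scal a v)) -> Cmod a * d <= norm x.
Proof.
  intros HP Hd a x Hx. destruct (classic (a = RtoC 0)) as [->|Ha].
  - rewrite Cmod_0. pose proof (norm_pos x). lra.
  - replace x with (scal a (minus v (scal (Copp (Cinv a)) (minus x (scal a v))))) by mod_eq.
    rewrite norm_scal_C. apply Rmult_le_compat_l; [apply Cmod_ge_0|]. apply Hd, HP; auto.
Qed.

Lemma nclosed_add1 P v : subsp P -> nclosed P -> nclosed (add1 P v).
Proof.
  intros HP Hc x Hx. destruct (classic (P v)) as [Hv|Hv].
  { apply add1_base, Hc. intros e He. destruct (Hx e He) as [y [Hy1 Hy2]]. exists y; split; auto.
    revert Hy1; apply add1_least; auto. }
  destruct (nclosed_dist P v Hc Hv) as [d [Hd0 Hd]].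
  destruct (epsilon_choice (fun k (ya : X * CC) => P (minus (fst ya) (scal (snd ya) v)) /\
     norm (minus x (fst ya)) < / (INR k + 1))) as [f Hf].
  { intros k. destruct (Hx (/ (INR k + 1)) (inv_INR_pos k)) as [y [[a Ha] Hy]]. exists (y, a); auto. }
  (* The coefficients along [v] of the approximating vectors are bounded by [dist_coef], so they
     cluster at some [a], which is the coefficient of the limit. *)
  destruct (bounded_cluster (fun k => snd (f k)) ((norm x + 1) / d)) as [a Ha].
  { intros k. destruct (Hf k) as [H1 H2].
    pose proof (dist_coef P v d HP Hd _ _ H1) as H3.
    assert (H4 : / (INR k + 1) <= 1).
    { rewrite <- Rinv_1. apply Rinv_le_contravar; [lra|]. pose proof (pos_INR k); lra. }
    pose proof (norm_minus_ge (fst (f k)) x) as H5. rewrite norm_minus_sym in H5.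
    apply Rmult_le_reg_r with d; auto. unfold Rdiv. rewrite Rmult_assoc, Rinv_l by lra. lra. }
  exists a. apply Hc. intros e He.
  destruct (inv_INR_lt (e / 2)) as [N HN]; [lra|].
  pose proof (norm_pos v) as Hnv.
  destruct (Ha (e / 2 / (norm v + 1)) N) as [k [Hk1 Hk2]].
  { apply Rdiv_lt_0_compat; lra. }
  destruct (Hf k) as [H1 H2]. exists (minus (fst (f k)) (scal (snd (f k)) v)). split; auto.
  replace (minus (minus x (scal a v)) (minus (fst (f k)) (scal (snd (f k)) v)))
    with (plus (minus x (fst (f k))) (scal (Cminus (snd (f k)) a) v)) by mod_eq.
  apply Rle_lt_trans with (1 := norm_plus_le _ _). rewrite norm_scal_C.
  specialize (HN k Hk1).
  assert (Cmod (Cminus (snd (f k)) a) * norm v <= e / 2).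
  { apply Rle_trans with (e / 2 / (norm v + 1) * (norm v + 1)).
    - apply Rmult_le_compat; try lra. apply Cmod_ge_0.
    - right. field. lra. }
  lra.
Qed.

Lemma nclosed_spanmod P l : subsp P -> nclosed P -> nclosed (spanmod P l).
Proof.
  intros HP Hc; induction l; simpl; auto. apply nclosed_add1; auto using subsp_spanmod.
Qed.

Lemma nclosed_span l : nclosed (span l).
Proof. apply nclosed_spanmod; [apply subsp_only0|apply nclosed_only0]. Qed.

(** This bounds the projection of the direct sum of [span l] and [P] onto [span l]. By induction:
    the first coefficient is controlled by [dist_coef], and the rest by the previous constant. *)
Lemma span_dist P l : subsp P -> nclosed P -> indmod P l ->
  exists C, 0 < C /\ forall x p, span l x -> P p -> norm x <= C * norm (minus x p).
Proof.
  intros HP Hc; induction l as [|v r IH]; simpl.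
  - intros _. exists 1. split; [lra|]. intros x p Hx Hp. assert (H0 : norm x = 0) by (rewrite Hx; apply norm_0).
    pose proof (norm_pos (minus x p)). lra.
  - intros [H1 H2]. destruct (IH H2) as [C [HC H]].
    destruct (nclosed_dist (spanmod P r) v) as [d [Hd0 Hd]]; auto using nclosed_spanmod.
    exists ((norm v + C * norm v) / d + C). pose proof (norm_pos v) as Hnv. split.
    { apply Rplus_le_lt_0_compat; auto. apply Rdiv_le_0_compat; nra. }
    intros x p [a Ha] Hp.
    assert (H3 : Cmod a * d <= norm (minus x p)).
    { apply dist_coef with (spanmod P r) v; auto using subsp_spanmod.
      as_mod (minus (minus x (scal a v)) p). apply subsp_minus; auto using subsp_spanmod, spanmod_base.
      revert Ha; apply spanmod_mono. unfold only0; intros ? ->; apply HP. }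
    assert (H4 : norm (minus x (scal a v)) <= C * norm (minus (minus x (scal a v)) p)) by (apply H; auto).
    assert (H5 : norm (minus (minus x (scal a v)) p) <= norm (minus x p) + Cmod a * norm v).
    { replace (minus (minus x (scal a v)) p) with (minus (minus x p) (scal a v)) by mod_eq.
      rewrite <- norm_scal_C. apply norm_minus_le. }
    assert (H6 : norm x <= norm (minus x (scal a v)) + Cmod a * norm v).
    { rewrite <- norm_scal_C. replace x with (plus (minus x (scal a v)) (scal a v)) at 1 by mod_eq.
      apply norm_plus_le. }
    assert (H7 : Cmod a <= norm (minus x p) / d).
    { apply Rmult_le_reg_r with d; auto. unfold Rdiv. rewrite Rmult_assoc, Rinv_l; lra. }
    pose proof (norm_pos (minus x p)) as H8. pose proof (Cmod_ge_0 a) as H9.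
    assert (H10 : (norm v + C * norm v) * Cmod a <= (norm v + C * norm v) * (norm (minus x p) / d)).
    { apply Rmult_le_compat_l; nra. }
    replace (((norm v + C * norm v) / d + C) * norm (minus x p))
      with ((norm v + C * norm v) * (norm (minus x p) / d) + C * norm (minus x p)) by (field; lra).
    nra.
Qed.

End Analysis.

Section Riesz.
Context {X : CompleteNormedModule C_AbsRing}.
Implicit Types (P Q Y : X -> Prop) (l : list X) (A G V : X -> X).

Lemma riesz P v : subsp P -> nclosed P -> ~ P v ->
  exists (a : CC) p, P p /\ norm (scal a (minus v p)) = 1 /\
    forall q, P q -> / 2 <= norm (minus (scal a (minus v p)) q).
Proof.
  intros HP Hc Hv. destruct (nclosed_dist P v Hc Hv) as [d [Hd0 Hd]].
  (* A best approximation up to the factor 2. Without one, the distance to [v] could be halved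
     forever and would fall below [d]. *)
  assert (H : exists p, P p /\ forall q, P q -> norm (minus v p) / 2 <= norm (minus v q)).
  { apply NNPP. intros Hn.
    assert (Hk : forall k, exists p, P p /\ norm (minus v p) <= norm v * (/ 2) ^ k).
    { induction k as [|k [p [Hp1 Hp2]]].
      - exists zero. split; [apply HP|]. norm_as v. simpl; lra.
      - apply not_ex_all_not with (n := p) in Hn. apply not_and_or in Hn.
        destruct Hn as [Hn|Hn]; [tauto|]. apply not_all_ex_not in Hn. destruct Hn as [q Hq].
        apply imply_to_and in Hq. destruct Hq as [Hq1 Hq2]. exists q; split; auto. simpl. lra. }
    pose proof (norm_pos v) as Hv0.
    destruct (pow_lt_1_zero (/ 2)) with (y := d / (norm v + 1)) as [N HN].
    { rewrite Rabs_pos_eq; lra. }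
    { apply Rdiv_lt_0_compat; lra. }
    specialize (HN N (Nat.le_refl _)).
    assert (0 < (/ 2) ^ N) by (apply pow_lt; lra).
    rewrite Rabs_pos_eq in HN by lra.
    destruct (Hk N) as [p [Hp1 Hp2]]. specialize (Hd p Hp1).
    assert ((norm v + 1) * (/ 2) ^ N < (norm v + 1) * (d / (norm v + 1))) by (apply Rmult_lt_compat_l; lra).
    replace ((norm v + 1) * (d / (norm v + 1))) with d in H0 by (field; lra). lra. }
  destruct H as [p [Hp H]]. assert (Hpos : 0 < norm (minus v p)) by (specialize (Hd p Hp); lra).
  set (t := norm (minus v p)) in *.
  assert (Ht : RtoC t <> RtoC 0) by (intros E; injection E; lra).
  assert (HCt : Cmod (Cinv (RtoC t)) = / t).
  { rewrite Cmod_inv by auto. rewrite Cmod_R, Rabs_pos_eq by lra. auto. }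
  exists (Cinv (RtoC t)), p. split; [auto|split].
  - rewrite norm_scal_C, HCt. unfold t. field. fold t; lra.
  - intros q Hq.
    replace (minus (scal (Cinv (RtoC t)) (minus v p)) q)
      with (scal (Cinv (RtoC t)) (minus v (plus p (scal (RtoC t) q)))) by mod_eq.
    rewrite norm_scal_C, HCt.
    assert (H1 : t / 2 <= norm (minus v (plus p (scal (RtoC t) q)))).
    { apply H. apply subsp_plus, subsp_scal; auto. }
    apply Rmult_le_compat_l with (r := / t) in H1.
    + replace (/ t * (t / 2)) with (/ 2) in H1 by (field; lra). auto.
    + apply Rlt_le, Rinv_0_lt_compat; auto.
Qed.

(** A substitute for a well-conditioned basis: unit vectors, each at distance at least 1/2 from the
    span of the later ones. Coefficients are then bounded by constants that depend on the length
    only. *)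
Fixpoint riesz_seq l : Prop :=
  match l with
  | nil => True
  | v :: r => norm v = 1 /\ (forall q, span r q -> / 2 <= norm (minus v q)) /\ riesz_seq r
  end.

Lemma riesz_seq_exists l : indmod only0 l ->
  exists e, length e = length l /\ riesz_seq e /\ forall x, In x e -> span l x.
Proof.
  induction l as [|v r IH]; simpl.
  - exists nil; simpl; repeat split; auto; tauto.
  - intros [H1 H2]. destruct (IH H2) as [e [He1 [He2 He3]]].
    destruct (riesz (span r) v (subsp_span r) (nclosed_span r) H1) as [a [p [Hp1 [Hp2 Hp3]]]].
    exists (scal a (minus v p) :: e); simpl; repeat split; auto.
    + intros q Hq. apply Hp3. revert Hq. apply spanmod_least; auto using subsp_span.
      unfold only0; intros ? ->; apply subsp_span.
    + intros x [<-|Hx].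
      * apply subsp_scal; [apply (subsp_span (v :: r))|].
        apply subsp_minus; [apply (subsp_span (v :: r))| |].
        -- apply spanmod_gen; simpl; auto using subsp_only0.
        -- apply add1_base; auto.
      * apply add1_base. apply He3; auto.
Qed.

(** Origin of the recursion: for a vector of norm [N], the first coefficient is at most [2 * N] and
    the remainder has norm at most [3 * N]. *)
Fixpoint gap_const (n : nat) : R :=
  match n with O => 0 | S n => 2 + 3 * gap_const n end.

Lemma gap_const_pos n : 0 <= gap_const n.
Proof. induction n; simpl; lra. Qed.

(** The witness keeps the coefficients of [y] and takes them over [e] in place of [e']. *)
Lemma riesz_near (e e' : list X) (h : R) : 0 <= h -> riesz_seq e ->
  Forall2 (fun a b : X => norm (minus a b) <= h) e e' ->
  forall y, span e' y -> exists x, span e x /\ norm (minus x y) <= h * gap_const (length e) * norm x.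
Proof.
  intros Hh He H. induction H as [|v v' r r' Hv H IH]; simpl in *.
  - intros y Hy. exists y. split; auto. norm_as (@zero X). rewrite norm_0. lra.
  - destruct He as [He1 [He2 He3]]. intros y [a Ha].
    destruct (IH He3 _ Ha) as [x [Hx1 Hx2]]. exists (plus x (scal a v)). split.
    { exists a. as_mod x. auto. }
    assert (H1 : Cmod a * / 2 <= norm (plus x (scal a v))).
    { apply dist_coef with (span r) v; auto using subsp_span. as_mod x. auto. }
    assert (H2 : norm x <= norm (plus x (scal a v)) + Cmod a).
    { pose proof (norm_minus_le (plus x (scal a v)) (scal a v)) as H3. norm_as_in H3 x.
      rewrite norm_scal_C, He1 in H3. lra. }
    assert (H3 : norm (minus (plus x (scal a v)) y) <= norm (minus x (minus y (scal a v'))) + Cmod a * h).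
    { replace (minus (plus x (scal a v)) y)
        with (plus (minus x (minus y (scal a v'))) (scal a (minus v v'))) by mod_eq.
      apply Rle_trans with (1 := norm_plus_le _ _). rewrite norm_scal_C.
      apply Rplus_le_compat_l, Rmult_le_compat_l; auto. apply Cmod_ge_0. }
    pose proof (gap_const_pos (length r)) as Hg.
    set (N := norm (plus x (scal a v))) in *. set (g := gap_const (length r)) in *.
    assert (Hg' : 0 <= h * g) by (apply Rmult_le_pos; auto).
    assert (h * g * norm x <= h * g * (3 * N)) by (apply Rmult_le_compat_l; lra).
    assert (Cmod a * h <= 2 * N * h) by (apply Rmult_le_compat_r; lra).
    replace (h * (2 + 3 * g) * N) with (2 * N * h + h * g * (3 * N)) by ring. lra.
Qed.

Lemma riesz_near_indep (e e' : list X) (h : R) : 0 <= h <= / 8 -> h * gap_const (length e) <= / 8 ->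
  riesz_seq e -> Forall2 (fun a b : X => norm (minus a b) <= h) e e' -> indmod only0 e'.
Proof.
  intros Hh Hg He H. induction H as [|v v' r r' Hv H IH]; simpl in *; auto.
  destruct He as [He1 [He2 He3]].
  pose proof (gap_const_pos (length r)) as Hg0.
  assert (Hg' : h * gap_const (length r) <= / 8) by nra.
  split; [|apply IH; auto].
  (* If [v'] were in the span of [r'], a vector [x] of the span of [r] would satisfy
     [norm x <= 9/7], hence lie within 2/7 of [v], against the distance 1/2. *)
  intros Hs. destruct (riesz_near r r' h) with (y := v') as [x [Hx1 Hx2]]; auto; [lra|].
  specialize (He2 x Hx1).
  pose proof (norm_minus_tri v v' x) as H1. rewrite (norm_minus_sym v' x) in H1.
  pose proof (norm_minus_ge x v') as H2.
  pose proof (norm_minus_ge v' v) as H3. rewrite norm_minus_sym in H3.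
  pose proof (norm_pos x) as H4.
  assert (h * gap_const (length r) * norm x <= / 8 * norm x) by (apply Rmult_le_compat_r; auto).
  lra.
Qed.

(** Moving a Riesz basis of [span l] slightly into [span m] keeps it independent. The threshold [h]
    depends on [n] alone, so it can be fixed before the subspaces are known. *)
Lemma gap_dim (n : nat) : exists h, 0 < h /\ forall l m : list X, length l = n -> indmod only0 l ->
  (forall x, span l x -> exists u, span m u /\ norm (minus x u) <= h * norm x) ->
  (n <= length m)%nat.
Proof.
  pose proof (gap_const_pos n) as Hg. exists (/ (8 * (gap_const n + 1))). split.
  { apply Rinv_0_lt_compat. lra. }
  set (h := / (8 * (gap_const n + 1))).
  assert (Hh0 : 0 < h) by (apply Rinv_0_lt_compat; lra).
  assert (Hh : h * gap_const n + h = / 8) by (unfold h; field; lra).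
  assert (Hhg : 0 <= h * gap_const n) by (apply Rmult_le_pos; lra).
  intros l m Hl Hi Hm. destruct (riesz_seq_exists l Hi) as [e [He1 [He2 He3]]].
  assert (He : exists e', Forall2 (fun a b : X => norm (minus a b) <= h) e e' /\ forall x, In x e' -> span m x).
  { clear -He2 He3 Hm Hh0. induction e as [|v r IH].
    - exists nil. split; [constructor|simpl; tauto].
    - simpl in He2. destruct He2 as [H1 [H2 H3]]. destruct IH as [e' [H4 H5]]; auto.
      { intros x Hx; apply He3; simpl; auto. }
      destruct (Hm v) as [u [Hu1 Hu2]]; [apply He3; simpl; auto|].
      exists (u :: e'). split.
      + constructor; auto. rewrite H1 in Hu2. lra.
      + intros x [<-|Hx]; auto. }
  destruct He as [e' [He4 He5]].
  assert (Hi' : indmod only0 e').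
  { apply riesz_near_indep with e h; auto; [lra|]. rewrite He1, Hl. lra. }
  apply Forall2_length in He4.
  apply (steinitz only0 e' m subsp_only0) in Hi'; auto. lia.
Qed.

Lemma bounded_const A : bounded_op A -> exists M, 0 < M /\ forall x, norm (A x) <= M * norm x.
Proof.
  intros [_ [M HM]]. exists (Rabs M + 1). split; [pose proof (Rabs_pos M); lra|].
  intros x. apply Rle_trans with (1 := HM x). apply Rmult_le_compat_r; [apply norm_pos|].
  pose proof (Rle_abs M); lra.
Qed.

Lemma pow_half_lt (a e : R) : 0 <= a -> 0 < e -> exists N, forall n, (N <= n)%nat -> a * (/ 2) ^ n < e.
Proof.
  intros Ha He. destruct (pow_lt_1_zero (/ 2)) with (y := e / (a + 1)) as [N HN].
  { rewrite Rabs_pos_eq; lra. }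
  { apply Rdiv_lt_0_compat; lra. }
  exists N. intros n Hn. specialize (HN n Hn).
  assert (0 < (/ 2) ^ n) by (apply pow_lt; lra). rewrite Rabs_pos_eq in HN by lra.
  apply Rmult_lt_compat_l with (r := a + 1) in HN; [|lra].
  replace ((a + 1) * (e / (a + 1))) with e in HN by (field; lra). lra.
Qed.

Lemma geometric_conv (s : nat -> X) (a : R) : 0 <= a ->
  (forall n, norm (minus (s (S n)) (s n)) <= a * (/ 2) ^ n) ->
  exists x, conv s x /\ forall n, norm (minus x (s n)) <= 2 * a * (/ 2) ^ n.
Proof.
  intros Ha H.
  assert (Hk : forall k n, norm (minus (s (n + k)%nat) (s n)) <= 2 * a * (/ 2) ^ n * (1 - (/ 2) ^ k)).
  { induction k as [|k IH]; intros n.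
    - rewrite Nat.add_0_r. norm_as (@zero X). rewrite norm_0. simpl; lra.
    - rewrite Nat.add_succ_r. apply Rle_trans with (1 := norm_minus_tri _ (s (n + k)%nat) _).
      specialize (IH n). specialize (H (n + k)%nat). rewrite pow_add in H. simpl. lra. }
  assert (Hp : forall n, 0 <= 2 * a * (/ 2) ^ n).
  { intros n. apply Rmult_le_pos; [lra|]. apply pow_le; lra. }
  assert (Hk' : forall k n, norm (minus (s (n + k)%nat) (s n)) <= 2 * a * (/ 2) ^ n).
  { intros k n. apply Rle_trans with (1 := Hk k n).
    assert (0 <= (/ 2) ^ k) by (apply pow_le; lra). specialize (Hp n). nra. }
  destruct (complete_seq s) as [x Hx].
  { intros e He. destruct (pow_half_lt (2 * a) (e / 2)) as [N HN]; try lra.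
    exists N. intros m n Hm Hn.
    assert (Hb : forall k, (N <= k)%nat -> norm (minus (s k) (s N)) < e / 2).
    { intros k Hk0. replace k with (N + (k - N))%nat by lia.
      apply Rle_lt_trans with (1 := Hk' _ _). apply HN; auto. }
    pose proof (norm_minus_tri (s m) (s N) (s n)) as H1. rewrite (norm_minus_sym (s N)) in H1.
    pose proof (Hb m Hm). pose proof (Hb n Hn). lra. }
  exists x. split; auto. intros n. apply le_epsilon. intros e He.
  destruct (Hx e He) as [N HN]. specialize (HN (n + N)%nat ltac:(lia)).
  rewrite norm_minus_sym in HN. specialize (Hk' N n).
  pose proof (norm_minus_tri x (s (n + N)%nat) (s n)). lra.
Qed.

(** Successive approximation: if one step leaves a residual of half the size, the corrections sum to
    a geometric series, and closedness of [P] passes the congruence to the limit. It serves the open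
    mapping theorem, the Neumann series and the stability of surjectivity alike. *)
Lemma iter_solve A P Y (C : R) : bounded_op A -> subsp P -> nclosed P -> 0 <= C ->
  (forall y, Y y -> exists x y', Y y' /\ P (minus (minus y y') (A x)) /\
     norm x <= C * norm y /\ norm y' <= / 2 * norm y) ->
  forall y, Y y -> exists x, P (minus y (A x)) /\ norm x <= 2 * C * norm y.
Proof.
  intros HA HP Hc HC H y Hy.
  destruct (epsilon_choice (fun y (p : X * X) => Y y -> Y (snd p) /\
    P (minus (minus y (snd p)) (A (fst p))) /\ norm (fst p) <= C * norm y /\
    norm (snd p) <= / 2 * norm y)) as [f Hf].
  { intros z. destruct (classic (Y z)) as [Hz|Hz].
    - destruct (H z Hz) as [x [y' Hxy]]. exists (x, y'); auto.
    - exists (zero, zero); tauto. }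
  set (yn := fun n => Nat.iter n (fun z => snd (f z)) y).
  set (s := fix s (n : nat) : X := match n with O => zero | S n => plus (s n) (fst (f (yn n))) end).
  assert (HY : forall n, Y (yn n)).
  { induction n; simpl; auto. apply Hf; auto. }
  assert (Hn : forall n, norm (yn n) <= norm y * (/ 2) ^ n).
  { induction n; simpl; [lra|]. destruct (Hf (yn n) (HY n)) as [_ [_ [_ H1]]].
    change (Nat.iter n (fun z => snd (f z)) y) with (yn n). lra. }
  assert (HPn : forall n, P (minus (minus y (yn n)) (A (s n)))).
  { induction n as [|n IH].
    - simpl. rewrite (lin_zero A) by apply HA. as_mod (@zero X). apply HP.
    - destruct (Hf (yn n) (HY n)) as [_ [H1 _]]. simpl.
      change (Nat.iter n (fun z => snd (f z)) y) with (yn n).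
      destruct HA as [[Hp _] _]. rewrite Hp.
      as_mod (plus (minus (minus y (yn n)) (A (s n))) (minus (minus (yn n) (snd (f (yn n)))) (A (fst (f (yn n)))))).
      apply (subsp_plus _ _ _ HP); auto. }
  pose proof (norm_pos y) as Hy0.
  destruct (geometric_conv s (C * norm y)) as [x [Hx1 Hx2]].
  { apply Rmult_le_pos; auto. }
  { intros n. destruct (Hf (yn n) (HY n)) as [_ [_ [H1 _]]]. simpl.
    norm_as (fst (f (yn n))). specialize (Hn n).
    apply Rmult_le_compat_l with (r := C) in Hn; lra. }
  exists x. split.
  - apply Hc. intros e He. destruct (bounded_const A HA) as [M [HM0 HM]].
    destruct (pow_half_lt (norm y) (e / 2)) as [N1 HN1]; try lra.
    destruct (Hx1 (e / 2 / M)) as [N2 HN2]; [apply Rdiv_lt_0_compat; lra|].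
    exists (minus (minus y (yn (N1 + N2)%nat)) (A (s (N1 + N2)%nat))). split; auto.
    specialize (HN1 (N1 + N2)%nat ltac:(lia)). specialize (HN2 (N1 + N2)%nat ltac:(lia)).
    specialize (Hn (N1 + N2)%nat). set (n := (N1 + N2)%nat) in *.
    replace (minus (minus y (A x)) (minus (minus y (yn n)) (A (s n))))
      with (plus (yn n) (minus (A (s n)) (A x))) by mod_eq.
    apply Rle_lt_trans with (1 := norm_plus_le _ _).
    rewrite <- lin_minus by apply HA. specialize (HM (minus (s n) x)).
    apply Rmult_lt_compat_l with (r := M) in HN2; auto.
    replace (M * (e / 2 / M)) with (e / 2) in HN2 by (field; lra). lra.
  - specialize (Hx2 O). simpl in Hx2. norm_as_in Hx2 x. lra.
Qed.

(** Baire's argument for the sets of vectors [b] that are congruent modulo [P] to some [A x] with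
    [norm x <= INR n]: they cover [Y], so one of them is dense in a ball of [Y]. Otherwise shrinking
    balls avoiding them one by one have a common point, which lies in none. *)
Lemma baire_ball A P Y : subsp Y -> nclosed Y -> (forall y, Y y -> exists x, P (minus y (A x))) ->
  exists n y0 r, Y y0 /\ 0 < r /\ forall y, Y y -> norm (minus y y0) <= r ->
    forall e, 0 < e -> exists (b x : X), norm x <= INR n /\ P (minus b (A x)) /\ norm (minus y b) < e.
Proof.
  intros HY Hc HA. apply NNPP. intros Hno.
  assert (Hstep : forall n y0 r, Y y0 -> 0 < r -> exists y1 e, Y y1 /\ norm (minus y1 y0) <= r /\ 0 < e /\
    forall b x : X, norm x <= INR n -> P (minus b (A x)) -> e <= norm (minus y1 b)).
  { intros n y0 r Hy0 Hr. apply NNPP. intros Hn. apply Hno. exists n, y0, r. repeat split; auto.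
    intros y Hy Hyr e He. apply NNPP. intros Hn2. apply Hn. exists y, e. repeat split; auto.
    intros b x Hx Hb. apply Rnot_lt_le. intros Hl. apply Hn2. exists b, x; auto. }
  (* The limit lies within one radius of each centre, while the centre is at least two radii away
     from the set being avoided. *)
  destruct (epsilon_choice (fun (a : nat * (X * R)) (q : X * R) => let (n, p) := a in
     Y (fst p) -> 0 < snd p ->
     Y (fst q) /\ 0 < snd q <= / 2 * snd p /\ norm (minus (fst q) (fst p)) <= / 2 * snd p /\
     forall b x : X, norm x <= INR n -> P (minus b (A x)) -> 2 * snd q <= norm (minus (fst q) b))) as [f Hf].
  { intros [n [y0 r]]; simpl. destruct (classic (Y y0 /\ 0 < r)) as [[H1 H2]|H].
    - destruct (Hstep n y0 (/ 2 * r)) as [y1 [e [H3 [H4 [H5 H6]]]]]; auto; [lra|].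
      exists (y1, Rmin (/ 2 * r) (/ 2 * e)); simpl. intros _ _. split; auto. split.
      + split; [apply Rmin_pos; lra|apply Rmin_l].
      + split; auto. intros b x Hx Hb. pose proof (Rmin_r (/ 2 * r) (/ 2 * e)).
        specialize (H6 b x Hx Hb). lra.
    - exists (y0, r). tauto. }
  set (p := fix p (n : nat) : X * R := match n with O => (@zero X, 1) | S n => f (n, p n) end).
  assert (Hp : forall n, Y (fst (p n)) /\ 0 < snd (p n) <= (/ 2) ^ n).
  { induction n as [|n [IH1 [IH2 IH3]]]; simpl.
    - split; [apply HY|lra].
    - destruct (Hf (n, p n) IH1 IH2) as [H1 [[H2 H3] _]]. split; auto. lra. }
  assert (Hpn : forall n, snd (p (S n)) <= / 2 * snd (p n) /\
     norm (minus (fst (p (S n))) (fst (p n))) <= / 2 * snd (p n) /\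
     forall b x : X, norm x <= INR n -> P (minus b (A x)) -> 2 * snd (p (S n)) <= norm (minus (fst (p (S n))) b)).
  { intros n. destruct (Hp n) as [H1 [H2 _]]. destruct (Hf (n, p n) H1 H2) as [_ [[_ H3] [H4 H5]]]. auto. }
  destruct (geometric_conv (fun n => fst (p n)) (/ 2)) as [y [Hy1 _]]; [lra| |].
  { intros n. destruct (Hpn n) as [_ [H _]]. destruct (Hp n) as [_ [_ H']]. lra. }
  assert (Hin : forall k n, norm (minus (fst (p (n + k)%nat)) (fst (p n))) <= snd (p n) - snd (p (n + k)%nat)).
  { induction k as [|k IH]; intros n.
    - rewrite Nat.add_0_r. norm_as (@zero X). rewrite norm_0. lra.
    - rewrite Nat.add_succ_r. destruct (Hpn (n + k)%nat) as [H1 [H2 _]]. specialize (IH n).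
      pose proof (norm_minus_tri (fst (p (S (n + k)))) (fst (p (n + k)%nat)) (fst (p n))). lra. }
  assert (Hlim : forall n, norm (minus (fst (p n)) y) <= snd (p n)).
  { intros n. apply le_epsilon. intros e He. destruct (Hy1 e He) as [N HN].
    specialize (HN (n + N)%nat ltac:(lia)). specialize (Hin N n). rewrite norm_minus_sym in Hin.
    destruct (Hp (n + N)%nat) as [_ [H _]].
    pose proof (norm_minus_tri (fst (p n)) (fst (p (n + N)%nat)) y). lra. }
  assert (HYy : Y y).
  { apply Hc. intros e He. destruct (Hy1 e He) as [N HN]. exists (fst (p N)). split; [apply Hp|].
    rewrite norm_minus_sym. apply HN; lia. }
  destruct (HA y HYy) as [x Hx].
  destruct (INR_unbounded (norm x)) as [n Hn].
  destruct (Hpn n) as [_ [_ H]]. specialize (H y x ltac:(lra) Hx). specialize (Hlim (S n)).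
  destruct (Hp (S n)) as [_ [H0 _]]. lra.
Qed.

(** The closed subspace [P] allows two uses: an operator onto [X] up to a finite span, and, with [P]
    trivial, an operator onto its closed range [Y]. *)
Lemma open_mapping A P Y : bounded_op A -> subsp P -> nclosed P -> subsp Y -> nclosed Y ->
  (forall x, Y (A x)) -> (forall p, P p -> Y p) -> (forall y, Y y -> exists x, P (minus y (A x))) ->
  exists C, 0 < C /\ forall y, Y y -> exists x, P (minus y (A x)) /\ norm x <= C * norm y.
Proof.
  intros HA HP HcP HY HcY HAY HPY H.
  destruct (baire_ball A P Y HY HcY H) as [n [y0 [r [Hy0 [Hr Hb]]]]].
  pose proof (pos_INR n) as Hn0.
  assert (HC : 0 <= 2 * INR n / r) by (apply Rdiv_le_0_compat; lra).
  exists (2 * (2 * INR n / r) + 1). split; [lra|].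
  intros y Hy.
  destruct (iter_solve A P Y (2 * INR n / r)) with (y := y) as [x [Hx1 Hx2]]; auto.
  2:{ exists x; split; auto. pose proof (norm_pos y). lra. }
  clear y Hy. intros y Hy. destruct (Req_dec (norm y) 0) as [E|E].
  - apply norm_eq0 in E. subst y. exists zero, zero. split; auto. split.
    + rewrite (lin_zero A) by apply HA. as_mod (@zero X). apply HP.
    + rewrite norm_0. lra.
  - assert (Hy' : 0 < norm y) by (pose proof (norm_pos y); lra).
    (* [y] is scaled to length [r], and [y0 + t y] and [y0] are both approximated within [r / 4].
       The difference of the two preimages, scaled back, has norm at most [2 * INR n / t] and leaves
       half of [y]. *)
    set (t := r / norm y). assert (Ht : 0 < t) by (apply Rdiv_lt_0_compat; auto).
    assert (HtC : RtoC t <> RtoC 0) by (intros E'; injection E'; lra).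
    assert (HCt : Cmod (RtoC t) = t) by (rewrite Cmod_R, Rabs_pos_eq; lra).
    assert (HCi : Cmod (Cinv (RtoC t)) = / t) by (rewrite Cmod_inv by auto; rewrite HCt; auto).
    destruct (Hb (plus y0 (scal (RtoC t) y))) with (e := r / 4) as [b1 [x1 [Hx1 [Hb1 He1]]]]; [| |lra|].
    { apply subsp_plus; auto. apply subsp_scal; auto. }
    { norm_as (scal (RtoC t) y). rewrite norm_scal_C, HCt. unfold t. right; field; lra. }
    destruct (Hb y0) with (e := r / 4) as [b2 [x2 [Hx2 [Hb2 He2]]]]; auto; [|lra|].
    { norm_as (@zero X). rewrite norm_0. lra. }
    assert (HYb : forall b x : X, P (minus b (A x)) -> Y b).
    { intros b x Hbx. as_mod (plus (minus b (A x)) (A x)). apply (subsp_plus _ _ _ HY); auto. }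
    exists (scal (Cinv (RtoC t)) (minus x1 x2)), (minus y (scal (Cinv (RtoC t)) (minus b1 b2))).
    split; [|split; [|split]].
    + apply subsp_minus; auto. apply subsp_scal, subsp_minus; eauto.
    + destruct HA as [HL _]. pose proof HL as [_ Hs]. rewrite Hs, (lin_minus A) by auto.
      as_mod (scal (Cinv (RtoC t)) (minus (minus b1 (A x1)) (minus b2 (A x2)))).
      apply subsp_scal, subsp_minus; auto.
    + rewrite norm_scal_C, HCi. pose proof (norm_minus_le x1 x2).
      replace (2 * INR n / r * norm y) with (/ t * (2 * INR n)) by (unfold t; field; lra).
      apply Rmult_le_compat_l; [apply Rlt_le, Rinv_0_lt_compat; auto|lra].
    + replace (minus y (scal (Cinv (RtoC t)) (minus b1 b2)))
        with (scal (Cinv (RtoC t)) (minus (minus (plus y0 (scal (RtoC t) y)) b1) (minus y0 b2))) by mod_eq.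
      rewrite norm_scal_C, HCi.
      pose proof (norm_minus_le (minus (plus y0 (scal (RtoC t) y)) b1) (minus y0 b2)).
      replace (/ 2 * norm y) with (/ t * (r / 2)) by (unfold t; field; lra).
      apply Rmult_le_compat_l; [apply Rlt_le, Rinv_0_lt_compat; auto|lra].
Qed.

End Riesz.

(** * Stability of the index *)

Section Fredholm.
Context {X : CompleteNormedModule C_AbsRing}.
Implicit Types (P Q Y : X -> Prop) (l : list X) (A B S G V R : X -> X).

Lemma subsp_True : subsp (fun _ : X => True).
Proof. repeat split. Qed.

Lemma indmod_inter P l v : subsp P -> indmod P l -> span l v -> P v -> v = zero.
Proof.
  intros HP; revert v; induction l as [|w r IH]; simpl; intros v; auto.
  intros [H1 H2] [a Ha] Hv. destruct (classic (a = RtoC 0)) as [->|Hn].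
  - apply IH; auto. as_mod (minus v (scal (RtoC 0) w)). auto.
  - exfalso; apply H1.
    as_mod (scal (Cinv a) (minus v (minus v (scal a w)))).
    apply subsp_scal; auto using subsp_spanmod.
    apply subsp_minus; auto using subsp_spanmod, spanmod_base.
    revert Ha; apply spanmod_mono. unfold only0; intros ? ->; apply HP.
Qed.

Lemma spanmod_range A W y : is_linear A ->
  (spanmod (range A) W y <-> exists x, span W (minus y (A x))).
Proof.
  intros HA. rewrite spanmod_lincomb by auto using subsp_range. split.
  - intros [cs [Hl [x Hx]]]. exists x. apply spanmod_lincomb; auto using subsp_only0.
    exists cs; split; auto. unfold only0. rewrite <- Hx. mod_eq.
  - intros [x Hx]. apply spanmod_lincomb in Hx; auto using subsp_only0.
    destruct Hx as [cs [Hl Hx]]. exists cs; split; auto. exists x. unfold only0 in Hx.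
    replace (minus y (lincomb cs W)) with (plus (minus (minus y (A x)) (lincomb cs W)) (A x)) by mod_eq.
    rewrite Hx. mod_eq.
Qed.

Lemma open_mapping_mod A W : bounded_op A -> (forall y, spanmod (range A) W y) ->
  exists C, 0 < C /\ forall y, exists x, span W (minus y (A x)) /\ norm x <= C * norm y.
Proof.
  intros HA H. destruct (open_mapping A (span W) (fun _ => True)) as [C [HC HC']];
    auto using subsp_span, nclosed_span, subsp_True.
  - intros x _; auto.
  - intros y _. apply spanmod_range; auto. apply HA.
  - exists C; split; auto.
Qed.

(** If [A u] is close to [y], solving for [y - A u] modulo [W] changes [u] only slightly. By
    independence of [W] modulo the range, the [W]-part of [y] does not depend on the chosen
    preimage; it is therefore arbitrarily small, hence zero. *)
Lemma range_closed A W : bounded_op A -> indmod (range A) W -> (forall y, spanmod (range A) W y) ->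
  nclosed (range A).
Proof.
  intros HA Hi Hs y Hy. destruct (open_mapping_mod A W HA Hs) as [C [HC HC']].
  destruct (bounded_const A HA) as [M [HM0 HM]]. pose proof HA as [HL _].
  destruct (HC' y) as [x0 [Hx0 _]]. exists x0. apply norm_small_eq. intros e He.
  destruct (Hy (e / (1 + M * C))) as [b [[u ->] Hb]].
  { apply Rdiv_lt_0_compat; auto. nra. }
  destruct (HC' (minus y (A u))) as [x' [H1 H2]].
  assert (E : minus (minus y (A x0)) (minus (minus y (A u)) (A x')) = zero).
  { apply indmod_inter with (range A) W; auto using subsp_range.
    - apply subsp_minus; auto using subsp_span.
    - exists (minus (plus u x') x0). rewrite (lin_minus A) by auto. destruct HL as [Hp _].
      rewrite Hp. mod_eq. }
  assert (E' : minus y (A x0) = minus (minus y (A u)) (A x')).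
  { replace (minus y (A x0)) with
      (plus (minus (minus y (A x0)) (minus (minus y (A u)) (A x'))) (minus (minus y (A u)) (A x'))) by mod_eq.
    rewrite E. mod_eq. }
  rewrite E'. apply Rle_lt_trans with (1 := norm_minus_le _ _).
  apply Rle_lt_trans with ((1 + M * C) * norm (minus y (A u))).
  - specialize (HM x'). apply Rmult_le_compat_l with (r := M) in H2; lra.
  - apply Rmult_lt_compat_l with (r := 1 + M * C) in Hb; [|nra].
    replace ((1 + M * C) * (e / (1 + M * C))) with e in Hb by (field; nra). auto.
Qed.

Lemma surj_mod_semi_fredholm A W : bounded_op A -> (forall y, exists x, span W (minus y (A x))) ->
  semi_fredholm A.
Proof.
  intros HA H. pose proof HA as [HL _].
  destruct (basis_exists (range A) (fun _ => True) (length W)) as [b [_ [_ [Hb1 Hb2]]]]; auto using subsp_range.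
  { intros l _ Hi. apply steinitz with (range A); auto using subsp_range.
    intros x _. apply spanmod_range; auto. }
  split.
  - apply closed_nclosed. apply range_closed with b; auto.
  - right. exists (length b). apply beta_is_basis; auto. exists b; auto.
Qed.

Lemma beta_surj_mod A n : bounded_op A -> beta_is A n ->
  exists W C, length W = n /\ indmod (range A) W /\ 0 < C /\
    forall y, exists x, span W (minus y (A x)) /\ norm x <= C * norm y.
Proof.
  intros HA H. apply beta_is_basis in H; [|apply HA]. destruct H as [W [H1 [H2 H3]]].
  destruct (open_mapping_mod A W HA H3) as [C [HC HC']]. exists W, C; auto.
Qed.

(** A solution for [A] used in place of one for [B] leaves the residual [(A - B) x], at most half of
    [y]. The same finite span [W] works for both operators. *)
Lemma surj_mod_perturb A B W (C d : R) : bounded_op B -> 0 < C ->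
  (forall y, exists x, span W (minus y (A x)) /\ norm x <= C * norm y) ->
  (forall x, norm (minus (A x) (B x)) <= d * norm x) -> d * C <= / 2 ->
  forall y, exists x, span W (minus y (B x)) /\ norm x <= 2 * C * norm y.
Proof.
  intros HB HC HA Hd HdC y.
  apply (iter_solve B (span W) (fun _ => True)); auto using subsp_span, nclosed_span; [lra|].
  clear y. intros y _. destruct (HA y) as [x [Hx1 Hx2]]. exists x, (minus (A x) (B x)).
  split; auto. split; [|split; auto].
  - as_mod (minus y (A x)). auto.
  - apply Rle_trans with (1 := Hd x). pose proof (norm_pos x). pose proof (norm_pos y).
    destruct (Rle_dec 0 d).
    + apply Rle_trans with (d * (C * norm y)); [apply Rmult_le_compat_l; auto|].
      rewrite <- Rmult_assoc. apply Rmult_le_compat_r; auto.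
    + nra.
Qed.

(** Purely algebraic: the finite-rank part enters without any estimate. In the application [V] is a
    shift of [Tn n] and [G] a small perturbation of the same shift of [T]. *)
Definition finite_rank_of_invertible V R G : Prop :=
  is_linear V /\ is_linear R /\ is_linear G /\ (forall x, V (R x) = x) /\ (forall x, R (V x) = x) /\
  exists f, forall x, span f (minus (V x) (G x)).

Lemma span_mono_in l Q x : subsp Q -> (forall v, In v l -> Q v) -> span l x -> Q x.
Proof.
  intros HQ H. apply spanmod_least; auto. unfold only0; intros ? ->; apply HQ.
Qed.

Lemma only0_le P : subsp P -> forall x, only0 x -> P x.
Proof. unfold only0; intros HP x ->; apply HP. Qed.

Lemma small_exists (a b c h1 h2 : R) : 0 < a -> 0 < b -> 0 < c -> 0 < h1 -> 0 < h2 ->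
  exists d, 0 < d /\ d * a <= / 2 /\ b * d <= h1 /\ c * d <= h2.
Proof.
  intros Ha Hb Hc H1 H2. exists (Rmin (/ 2 / a) (Rmin (h1 / b) (h2 / c))).
  assert (Hm1 := Rmin_l (/ 2 / a) (Rmin (h1 / b) (h2 / c))).
  assert (Hm2 := Rmin_r (/ 2 / a) (Rmin (h1 / b) (h2 / c))).
  assert (Hm3 := Rmin_l (h1 / b) (h2 / c)). assert (Hm4 := Rmin_r (h1 / b) (h2 / c)).
  set (d := Rmin (/ 2 / a) (Rmin (h1 / b) (h2 / c))) in *.
  split; [|split; [|split]].
  - unfold d. repeat apply Rmin_pos; apply Rdiv_lt_0_compat; lra.
  - apply Rmult_le_compat_r with (r := a) in Hm1; [|lra].
    replace (/ 2 / a * a) with (/ 2) in Hm1 by (field; lra). auto.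
  - apply Rle_trans with (b * (h1 / b)); [apply Rmult_le_compat_l; lra|right; field; lra].
  - apply Rle_trans with (c * (h2 / c)); [apply Rmult_le_compat_l; lra|right; field; lra].
Qed.

Lemma bounded_near S G d : bounded_op S -> is_linear G ->
  (forall x, norm (minus (S x) (G x)) <= d * norm x) -> bounded_op G.
Proof.
  intros HS HG Hd. split; auto. destruct (bounded_const S HS) as [M [HM0 HM]].
  exists (M + d). intros x. pose proof (norm_minus_ge (G x) (S x)) as H. rewrite norm_minus_sym in H.
  specialize (Hd x). specialize (HM x). lra.
Qed.

(** Let [W] be a basis of a complement of the range of [S]. The preimage of [span W] under [S] is
    the kernel of [S]; under [G] it has dimension exactly [m], by the two counting lemmas. For small
    [d] each preimage is close to the other, so [gap_dim], applied both ways, identifies the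
    dimensions. *)
Lemma index0_of_beta S m : bounded_op S -> beta_is S m ->
  exists d, 0 < d /\ forall V R G, finite_rank_of_invertible V R G ->
    (forall x, norm (minus (S x) (G x)) <= d * norm x) -> alpha_is S m.
Proof.
  intros HS Hm. pose proof HS as [HL _].
  destruct (beta_surj_mod S m HS Hm) as [W [C [HW [Hi [HC HCs]]]]].
  destruct (@gap_dim X (Datatypes.S m)) as [h1 [Hh1 Hg1]]. destruct (@gap_dim X m) as [h2 [Hh2 Hg2]].
  (* [d * C <= / 2] keeps [G] onto modulo [W]. The other two bounds move kernel vectors of [S] into
     the preimage under [G] (solution constant [2 * C]) and back (solution constant [C]). *)
  destruct (small_exists C (2 * C) C h1 h2) as [d [Hd0 [Hd1 [Hd2 Hd3]]]]; auto; [lra|].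
  exists d; split; auto. intros V R G [HV [HR [HG [HVR [HRV [f Hf]]]]]] Hd.
  pose proof (bounded_near S G d HS HG Hd) as HGb.
  pose proof (surj_mod_perturb S G W C d HGb HC HCs Hd Hd1) as HGs.
  assert (HWi : indmod only0 W).
  { apply indmod_mono with (range S); auto. apply only0_le; auto using subsp_range. }
  assert (Hle : forall z, (forall x, In x z -> span W (G x)) -> indmod only0 z -> (length z <= m)%nat).
  { intros z Hz1 Hz2. rewrite <- HW. apply (preim_dim_le V R G f); auto.
    intros x. destruct (HGs x) as [y [Hy _]]; eauto. }
  destruct (basis_exists only0 (fun x => span W (G x)) m subsp_only0 Hle) as [zb [Hzb1 [_ [_ Hzb2]]]].
  destruct (dim_dichotomy only0 (kernel S) (Datatypes.S m) subsp_only0)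
    as [[l [Hl1 [Hl2 Hl3]]]|[l [Hl1 [Hl2 [Hl3 Hl4]]]]].
  - exfalso. assert (Datatypes.S m <= length zb)%nat; [|lia].
    apply (Hg1 l zb); auto. intros x Hx.
    assert (Hk : S x = zero) by (apply (span_mono_in l (kernel S)); auto using subsp_kernel).
    destruct (HGs (G x)) as [y [Hy1 Hy2]]. exists (minus x y). split.
    + apply Hzb2. rewrite (lin_minus G) by auto. auto.
    + norm_as y. specialize (Hd x). rewrite Hk in Hd.
      rewrite norm_minus_sym in Hd. norm_as_in Hd (G x). pose proof (norm_pos x).
      apply Rle_trans with (1 := Hy2). apply Rle_trans with (2 * C * (d * norm x)).
      * apply Rmult_le_compat_l; lra.
      * rewrite <- Rmult_assoc. apply Rmult_le_compat_r; auto.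
  - assert (Hge : (m <= length l)%nat).
    { destruct (preim_dim_ge V R G f W) as [z [Hz1 [Hz2 Hz3]]]; auto.
      rewrite HW in Hz1. apply (Hg2 z l); auto. intros x Hx.
      assert (HxW : span W (G x)).
      { apply (span_mono_in z (fun x => span W (G x))); auto. apply subsp_preim; auto using subsp_span. }
      destruct (HCs (minus (S x) (G x))) as [y [Hy1 Hy2]]. exists (minus x y). split.
      - apply Hl4. apply indmod_inter with (range S) W; auto using subsp_range.
        + rewrite (lin_minus S) by auto.
          as_mod (plus (G x) (minus (minus (S x) (G x)) (S y))).
          apply (subsp_plus _ _ _ (subsp_span W)); auto.
        + exists (minus x y); auto.
      - norm_as y. apply Rle_trans with (1 := Hy2). pose proof (norm_pos x).
        apply Rle_trans with (C * (d * norm x)).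
        + apply Rmult_le_compat_l; [lra|auto].
        + rewrite <- Rmult_assoc. apply Rmult_le_compat_r; auto. }
    apply alpha_is_basis; auto. exists l. repeat split; auto. lia.
Qed.

(** Suppose [k + 1] vectors [v] were independent modulo the range of [S]. The preimage of [span v]
    under [G] contains [k + 1] independent vectors, all nearly in the kernel of [S], which has
    dimension only [k]; [gap_dim] excludes this. *)
Lemma beta_of_alpha S k : bounded_op S -> closed (range S) -> alpha_is S k ->
  exists d, 0 < d /\ forall V R G, finite_rank_of_invertible V R G ->
    (forall x, norm (minus (S x) (G x)) <= d * norm x) -> beta_finite S.
Proof.
  intros HS Hc Hk. pose proof HS as [HL _]. apply closed_nclosed in Hc.
  apply alpha_is_basis in Hk; auto. destruct Hk as [l [Hl1 [Hl2 [Hl3 Hl4]]]].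
  destruct (dim_dichotomy (range S) (fun _ => True) (Datatypes.S k) (subsp_range S HL))
    as [[v [Hv1 [_ Hv2]]]|[b [_ [_ [Hb1 Hb2]]]]].
  2:{ exists 1. split; [lra|]. intros _ _ _ _ _. exists (length b). apply beta_is_basis; auto.
      exists b; auto. }
  destruct (span_dist (range S) v) as [C1 [HC1 Hsd]]; auto using subsp_range.
  destruct (open_mapping S only0 (range S)) as [C2 [HC2 Hom]];
    auto using subsp_only0, nclosed_only0, subsp_range.
  { intros x; exists x; auto. }
  { apply only0_le; auto using subsp_range. }
  { intros y [x ->]. exists x. unfold only0. mod_eq. }
  destruct (@gap_dim X (Datatypes.S k)) as [h [Hh Hg]].
  destruct (small_exists 1 (C2 * (C1 + 1)) 1 h 1) as [d [Hd0 [_ [Hd1 _]]]]; try lra.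
  { apply Rmult_lt_0_compat; lra. }
  exists d; split; auto. intros V R G [HV [HR [HG [HVR [HRV [f Hf]]]]]] Hd. exfalso.
  assert (Hvi : indmod only0 v).
  { apply indmod_mono with (range S); auto. apply only0_le; auto using subsp_range. }
  destruct (preim_dim_ge V R G f v) as [z [Hz1 [Hz2 Hz3]]]; auto. rewrite Hv1 in Hz1.
  assert (Datatypes.S k <= length l)%nat; [|lia].
  apply (Hg z l); auto. intros x Hx.
  assert (Hxv : span v (G x)).
  { apply (span_mono_in z (fun x => span v (G x))); auto. apply subsp_preim; auto using subsp_span. }
  (* [G x] is in [span v] and [S x] in the range, so [span_dist] bounds [G x] by their difference;
     then [S x] is small too, and [x] can be corrected into the kernel. *)
  assert (HGx : norm (G x) <= C1 * (d * norm x)).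
  { apply Rle_trans with (C1 * norm (minus (G x) (S x))).
    - apply Hsd; auto. exists x; auto.
    - rewrite norm_minus_sym. apply Rmult_le_compat_l; [lra|auto]. }
  assert (HSx : norm (S x) <= (C1 + 1) * (d * norm x)).
  { pose proof (norm_minus_ge (S x) (G x)). specialize (Hd x). lra. }
  destruct (Hom (S x)) as [y [Hy1 Hy2]]; [exists x; auto|]. exists (minus x y). split.
  - apply Hl4. unfold kernel. rewrite (lin_minus S) by auto. auto.
  - norm_as y. apply Rle_trans with (1 := Hy2). pose proof (norm_pos x).
    apply Rle_trans with (C2 * ((C1 + 1) * (d * norm x))).
    + apply Rmult_le_compat_l; lra.
    + replace (C2 * ((C1 + 1) * (d * norm x))) with (C2 * (C1 + 1) * d * norm x) by ring.
      apply Rmult_le_compat_r; auto.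
Qed.

Lemma semi_fredholm_index0 S : bounded_op S -> semi_fredholm S ->
  exists d, 0 < d /\ forall V R G, finite_rank_of_invertible V R G ->
    (forall x, norm (minus (S x) (G x)) <= d * norm x) -> index_is S 0%Z.
Proof.
  intros HS [Hc Hf]. destruct (classic (beta_finite S)) as [[m Hm]|Hn].
  - destruct (index0_of_beta S m HS Hm) as [d [Hd H]]. exists d; split; auto.
    intros V R G H1 H2. exists m, m. repeat split; auto; [eauto|lia].
  - destruct Hf as [[k Hk]|Hf]; [|tauto].
    destruct (beta_of_alpha S k HS Hc Hk) as [d [Hd H]]. exists d; split; auto.
    intros V R G H1 H2. exfalso; eauto.
Qed.

End Fredholm.

(** * Perturbation of the resolvent *)

Section Invert.
Context {X : CompleteNormedModule C_AbsRing}.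
Implicit Types (A B D S T R : X -> X).

Definition inverse_of A R : Prop :=
  bounded_op R /\ (forall x, R (A x) = x) /\ (forall x, A (R x) = x).

Lemma lin_plus A x y : is_linear A -> A (plus x y) = plus (A x) (A y).
Proof. intros H; apply H. Qed.

Lemma lin_scal A (c : CC) x : is_linear A -> A (scal c x) = scal c (A x).
Proof. intros H; apply H. Qed.

Lemma inverse_of_bijective A (C : R) : is_linear A -> (forall y, exists x, A x = y) ->
  (forall x, norm x <= C * norm (A x)) -> exists R, inverse_of A R /\ opnorm_le R C.
Proof.
  intros HA Hs Hb. destruct (epsilon_choice _ Hs) as [R HR].
  assert (Hinj : forall x y, A x = A y -> x = y).
  { intros x y E. apply norm_small_eq. intros e He. apply Rle_lt_trans with (1 := Hb _).
    rewrite (lin_minus A), E by auto. norm_as (@zero X). rewrite norm_0. lra. }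
  exists R. assert (HC : opnorm_le R C).
  { intros x. rewrite <- (HR x) at 2. apply Hb. }
  split; auto. split; [|split; auto].
  split; [split|exists C; auto].
  - intros x y. apply Hinj. rewrite (lin_plus A), !HR; auto.
  - intros c x. apply Hinj. rewrite (lin_scal A), !HR; auto.
Qed.

Lemma neumann_surj (K : X -> X) : is_linear K -> (forall x, norm (K x) <= / 2 * norm x) ->
  forall y, exists x, minus x (K x) = y.
Proof.
  intros HK Hb y.
  destruct (iter_solve (fun x => minus x (K x)) only0 (fun _ => True) 1) with (y := y) as [x [Hx _]];
    auto using subsp_only0, nclosed_only0; try lra.
  - split; [split|].
    + intros u v. rewrite (lin_plus K) by auto. mod_eq.
    + intros c u. rewrite (lin_scal K) by auto. mod_eq.
    + exists 2. intros u. apply Rle_trans with (1 := norm_minus_le _ _). specialize (Hb u).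
      pose proof (norm_pos u). lra.
  - intros z _. exists z, (K z). split; auto. split; [|split; [lra|auto]]. unfold only0. mod_eq.
  - exists x. unfold only0 in Hx.
    replace y with (plus (minus y (minus x (K x))) (minus x (K x))) by mod_eq. rewrite Hx. mod_eq.
Qed.

(* Only the square of [D R] has to be small, since
   [I - (DR)^2 = (I - DR)(I + DR) = (I + DR)(I - DR)]. *)
Lemma inverse_perturb (C d : R) A B D R : is_linear A -> is_linear D -> is_linear B ->
  inverse_of A R -> opnorm_le R C -> opnorm_le D d -> 0 <= C -> 0 <= d ->
  (forall x, B x = plus (A x) (D x)) ->
  (forall x, norm (D (R (D (R x)))) <= / 2 * norm x) ->
  exists R', inverse_of B R' /\ opnorm_le R' (2 * C * (1 + d * C)).
Proof.
  intros HA HD HB [[HR _] [HRA HAR]] HC Hd HC0 Hd0 E Hsq.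
  apply inverse_of_bijective; auto.
  - intros w. destruct (neumann_surj (fun x => D (R (D (R x))))) with (y := w) as [y Hy]; auto.
    { split; intros; repeat (rewrite ?(lin_plus R), ?(lin_plus D), ?(lin_scal R), ?(lin_scal D) by auto); auto. }
    exists (R (minus y (D (R y)))). rewrite E, HAR.
    rewrite (lin_minus R), (lin_minus D) by auto. rewrite <- Hy. mod_eq.
  - intros x. set (y := A x).
    assert (Hw : B x = plus y (D (R y))) by (rewrite E; unfold y; rewrite HRA; auto).
    assert (H1 : minus (B x) (D (R (B x))) = minus y (D (R (D (R y))))).
    { rewrite Hw. rewrite (lin_plus R), (lin_plus D) by auto. mod_eq. }
    pose proof (norm_minus_ge y (D (R (D (R y))))) as H2. rewrite <- H1 in H2.
    pose proof (norm_minus_le (B x) (D (R (B x)))) as H3.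
    specialize (Hsq y). pose proof (Hd (R (B x))) as H4. pose proof (HC (B x)) as H5.
    apply Rmult_le_compat_l with (r := d) in H5; auto.
    pose proof (HC y) as H6. unfold y in H6 at 1. rewrite HRA in H6.
    assert (H7 : norm y <= 2 * ((1 + d * C) * norm (B x))) by lra.
    apply Rmult_le_compat_l with (r := C) in H7; auto. lra.
Qed.

Lemma bounded_op_shift A (z : CC) : bounded_op A -> bounded_op (op_shift A z).
Proof.
  intros HA. split; [apply is_linear_shift, HA|]. destruct (bounded_const A HA) as [M [_ HM]].
  exists (M + Cmod z). intros x. unfold op_shift. apply Rle_trans with (1 := norm_minus_le _ _).
  rewrite norm_scal_C. specialize (HM x). lra.
Qed.

(** Stated symmetrically in the two operators, with exactly the products that nu-convergence
    controls, so that it carries the resolvent from [T] to [Tn n] and, with the roles exchanged,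
    back. *)
Lemma inverse_nu (C d e : R) A B (z : CC) R : is_linear A -> is_linear B ->
  inverse_of (op_shift A z) R -> opnorm_le R C -> 0 <= C -> 0 <= d -> 0 <= e ->
  opnorm_le (op_sub B A) d -> opnorm_le (op_comp (op_sub B A) A) e ->
  opnorm_le (op_comp (op_sub B A) (op_sub B A)) (2 * e) ->
  z <> RtoC 0 -> e * C * (d * C + 2) <= / 2 * Cmod z ->
  exists R', inverse_of (op_shift B z) R' /\ opnorm_le R' (2 * C * (1 + d * C)).
Proof.
  intros HA HB Hinv HC HC0 Hd0 He0 Hd HDA HDD Hz Hsmall. pose proof Hinv as [[HR _] [HRA HAR]].
  set (D := op_sub B A) in *.
  assert (HD : is_linear D).
  { split; intros; unfold D, op_sub.
    - rewrite (lin_plus A), (lin_plus B) by auto. mod_eq.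
    - rewrite (lin_scal A), (lin_scal B) by auto. mod_eq. }
  apply (inverse_perturb C d (op_shift A z) (op_shift B z) D R); auto using is_linear_shift.
  { intros x. unfold D, op_sub, op_shift. mod_eq. }
  intros x. set (u := D (R x)).
  assert (E : R u = scal (Cinv z) (minus (A (R u)) u)).
  { assert (E : minus (A (R u)) (scal z (R u)) = u) by apply (HAR u).
    rewrite <- E at 3. mod_eq. }
  rewrite E. rewrite (lin_scal D), (lin_minus D) by auto.
  rewrite norm_scal_C, Cmod_inv by auto.
  assert (Hcz : 0 < Cmod z) by (apply Cmod_gt_0; auto).
  pose proof (norm_minus_le (D (A (R u))) (D u)) as H1.
  pose proof (HDA (R u)) as H2. unfold op_comp in H2.
  pose proof (HDD (R x)) as H3. unfold op_comp in H3. fold u in H3.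
  pose proof (HC u) as H4. pose proof (Hd (R x)) as H5. fold u in H5.
  pose proof (HC x) as H6. pose proof (norm_pos x) as H7.
  apply Rmult_le_compat_l with (r := d) in H6 as H8; auto.
  assert (H9 : norm u <= d * (C * norm x)) by lra.
  apply Rmult_le_compat_l with (r := C) in H9; auto.
  assert (H10 : norm (R u) <= C * (d * (C * norm x))) by lra.
  apply Rmult_le_compat_l with (r := e) in H10; auto.
  apply Rmult_le_compat_l with (r := 2 * e) in H6; [|lra].
  apply Rmult_le_compat_r with (r := norm x) in Hsmall; auto.
  apply Rmult_le_reg_l with (Cmod z); auto. rewrite <- Rmult_assoc, Rinv_r by lra. lra.
Qed.

Lemma inverse_shift (C : R) A (z w : CC) R : is_linear A ->
  inverse_of (op_shift A z) R -> opnorm_le R C -> 0 <= C -> Cmod (Cminus w z) * C <= / 2 ->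
  exists R', inverse_of (op_shift A w) R' /\ opnorm_le R' (4 * C).
Proof.
  intros HA Hinv HC HC0 Hs. pose proof Hinv as [[HR _] [HRA HAR]].
  pose proof (Cmod_ge_0 (Cminus w z)) as Hc.
  destruct (inverse_perturb C (Cmod (Cminus w z)) (op_shift A z) (op_shift A w) (fun x => scal (Cminus z w) x) R)
    as [R' [H1 H2]]; auto using is_linear_shift.
  - split; intros; mod_eq.
  - intros x. rewrite norm_scal_C. replace (Cminus z w) with (Copp (Cminus w z)) by ring.
    rewrite Cmod_opp. lra.
  - intros x. unfold op_shift. mod_eq.
  - intros x. rewrite norm_scal_C, (lin_scal R), norm_scal_C by auto.
    replace (Cminus z w) with (Copp (Cminus w z)) by ring. rewrite Cmod_opp.
    set (t := Cmod (Cminus w z)) in *. pose proof (HC (R x)) as H1. pose proof (HC x) as H2.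
    pose proof (norm_pos x) as H3. pose proof (norm_pos (R x)) as H4.
    assert (H5 : t * norm (R x) <= / 2 * norm x).
    { apply Rle_trans with (t * (C * norm x)); [apply Rmult_le_compat_l; auto|].
      rewrite <- Rmult_assoc. apply Rmult_le_compat_r; auto. }
    assert (H6 : t * norm (R (R x)) <= / 2 * norm (R x)).
    { apply Rle_trans with (t * (C * norm (R x))); [apply Rmult_le_compat_l; auto|].
      rewrite <- Rmult_assoc. apply Rmult_le_compat_r; auto. }
    apply Rmult_le_compat_l with (r := t) in H6; auto. lra.
  - exists R'. split; auto. intros x. apply Rle_trans with (1 := H2 x).
    apply Rmult_le_compat_r; [apply norm_pos|]. nra.
Qed.

Lemma not_spectrum T (z : CC) : ~ spectrum T z -> exists R C, inverse_of (op_shift T z) R /\ opnorm_le R C /\ 0 < C.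
Proof.
  intros H. apply NNPP in H. destruct H as [R [HR H]]. destruct (bounded_const R HR) as [C [HC HC']].
  exists R, C. split; [split|split]; auto.
Qed.

Lemma inverse_not_spectrum T (z : CC) R : inverse_of (op_shift T z) R -> ~ spectrum T z.
Proof. intros H Hs. apply Hs. exists R. apply H. Qed.

Lemma spectrum_open_compl T (z : CC) : is_linear T -> ~ spectrum T z ->
  exists e, 0 < e /\ forall w, cdist w z < e -> ~ spectrum T w.
Proof.
  intros HT H. destruct (not_spectrum T z H) as [R [C [H1 [H2 H3]]]].
  exists (/ 2 / C). split; [apply Rdiv_lt_0_compat; lra|]. intros w Hw.
  destruct (inverse_shift C T z w R) as [R' [H4 _]]; auto; [lra| |].
  - apply Rmult_lt_compat_r with (r := C) in Hw; auto.
    replace (/ 2 / C * C) with (/ 2) in Hw by (field; lra). apply Rlt_le; auto.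
  - eapply inverse_not_spectrum; eauto.
Qed.

(** Here [T] is the perturbation and the scalar operator [-z] the invertible part. The crude factor
    2 is harmless, since only boundedness of the spectrum matters. *)
Lemma spectrum_bounded T (M : R) (z : CC) : is_linear T -> opnorm_le T M -> 0 < M ->
  spectrum T z -> Cmod z <= 2 * M.
Proof.
  intros HT HM HM0 Hz. apply Rnot_lt_le. intros Hl.
  assert (Hc : 0 < Cmod z) by lra.
  assert (Hz0 : z <> RtoC 0) by (apply Cmod_gt_0; auto).
  assert (Hi : Cmod (Copp (Cinv z)) = / Cmod z) by (rewrite Cmod_opp; apply Cmod_inv; auto).
  assert (Hi0 : 0 < / Cmod z) by (apply Rinv_0_lt_compat; auto).
  destruct (inverse_perturb (/ Cmod z) M (fun x => scal (Copp z) x) (op_shift T z) T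
    (fun x => scal (Copp (Cinv z)) x)) as [R' [H1 _]]; auto using is_linear_shift; try lra.
  - split; intros; mod_eq.
  - split; [|split].
    + split; [split; intros; mod_eq|]. exists (/ Cmod z). intros x. rewrite norm_scal_C, Hi. lra.
    + intros x. mod_eq.
    + intros x. mod_eq.
  - intros x. rewrite norm_scal_C, Hi. lra.
  - intros x. unfold op_shift. mod_eq.
  - intros x. apply Rle_trans with (1 := HM _). rewrite norm_scal_C, Hi.
    pose proof (HM (scal (Copp (Cinv z)) x)) as H1. rewrite norm_scal_C, Hi in H1.
    assert (Hm : M * / Cmod z <= / 2).
    { apply Rmult_le_reg_r with (Cmod z); auto. rewrite Rmult_assoc, Rinv_l; lra. }
    assert (Hm0 : 0 <= M * / Cmod z) by (apply Rmult_le_pos; lra).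
    pose proof (norm_pos x). set (N := norm (T (scal (Copp (Cinv z)) x))) in *.
    assert (H0 : N <= / 2 * norm x).
    { apply Rle_trans with (1 := H1). rewrite <- Rmult_assoc. apply Rmult_le_compat_r; auto. }
    rewrite <- Rmult_assoc. apply Rle_trans with (M * / Cmod z * (/ 2 * norm x)).
    + apply Rmult_le_compat_l; auto.
    + nra.
  - apply inverse_not_spectrum in H1. auto.
Qed.

Context (T : X -> X) (Tn : nat -> X -> X).
Context (HT : bounded_op T) (HTn : forall n, bounded_op (Tn n)) (Hnu : nu_converges Tn T).

Lemma nu_uniform : exists d, 0 < d /\ (forall n, opnorm_le (Tn n) d) /\
  forall n, opnorm_le (op_sub (Tn n) T) d /\ opnorm_le (op_sub T (Tn n)) d.
Proof.
  destruct Hnu as [[M HM] _]. destruct (bounded_const T HT) as [M' [HM0 HM']].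
  exists (Rabs M + M'). pose proof (Rabs_pos M) as H0. pose proof (Rle_abs M) as H1.
  assert (H : forall n x, norm (Tn n x) <= Rabs M * norm x).
  { intros n x. apply Rle_trans with (1 := HM n x). apply Rmult_le_compat_r; auto. apply norm_pos. }
  split; [lra|]. split.
  - intros n x. specialize (H n x). pose proof (norm_pos x). nra.
  - intros n. split; intros x; unfold op_sub; apply Rle_trans with (1 := norm_minus_le _ _);
    specialize (H n x); specialize (HM' x); lra.
Qed.

(** The square of [D = Tn n - T] is [D Tn - D T], whence the bound [2 * e]. The versions with the
    roles exchanged differ only by signs. *)
Lemma nu_small (e : R) : 0 < e -> exists N, forall n, (N <= n)%nat ->
  opnorm_le (op_comp (op_sub (Tn n) T) T) e /\
  opnorm_le (op_comp (op_sub (Tn n) T) (op_sub (Tn n) T)) (2 * e) /\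
  opnorm_le (op_comp (op_sub T (Tn n)) (Tn n)) e /\
  opnorm_le (op_comp (op_sub T (Tn n)) (op_sub T (Tn n))) (2 * e).
Proof.
  intros He. destruct Hnu as [_ [H1 H2]]. destruct (H1 e He) as [N1 HN1]. destruct (H2 e He) as [N2 HN2].
  exists (N1 + N2)%nat. intros n Hn. specialize (HN1 n ltac:(lia)). specialize (HN2 n ltac:(lia)).
  destruct (HTn n) as [HLn _]. destruct HT as [HL _].
  assert (HD : forall x y, op_sub (Tn n) T (minus x y) = minus (op_sub (Tn n) T x) (op_sub (Tn n) T y)).
  { intros x y. unfold op_sub. rewrite (lin_minus (Tn n)), (lin_minus T) by auto. mod_eq. }
  assert (HDD : opnorm_le (op_comp (op_sub (Tn n) T) (op_sub (Tn n) T)) (2 * e)).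
  { intros x. unfold op_comp. unfold op_sub at 2. rewrite HD.
    apply Rle_trans with (1 := norm_minus_le _ _). specialize (HN1 x). specialize (HN2 x).
    unfold op_comp in HN1, HN2. lra. }
  assert (Hsym : forall x, op_sub T (Tn n) x = scal (Copp (RtoC 1)) (op_sub (Tn n) T x)).
  { intros x. unfold op_sub. mod_eq. }
  assert (Hsc : forall c x, op_sub (Tn n) T (scal c x) = scal c (op_sub (Tn n) T x)).
  { intros c x. unfold op_sub. rewrite (lin_scal (Tn n)), (lin_scal T) by auto. mod_eq. }
  split; [auto|]. split; [auto|]. split.
  - intros x. unfold op_comp. rewrite Hsym, norm_scal_C, Cmod_opp, Cmod_1, Rmult_1_l. apply HN2.
  - intros x. unfold op_comp. rewrite Hsym, norm_scal_C, Cmod_opp, Cmod_1, Rmult_1_l.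
    rewrite Hsym, Hsc, norm_scal_C, Cmod_opp, Cmod_1, Rmult_1_l. apply HDD.
Qed.

Lemma small_mult (a b : R) : 0 <= a -> 0 < b -> exists e, 0 < e /\ e * a <= b.
Proof.
  intros Ha Hb. exists (b / (a + 1)). split; [apply Rdiv_lt_0_compat; lra|].
  apply Rle_trans with (b / (a + 1) * (a + 1)).
  - apply Rmult_le_compat_l; [apply Rdiv_le_0_compat; lra|lra].
  - right. field; lra.
Qed.

Lemma resolvent_stable (z : CC) : z <> RtoC 0 -> ~ spectrum T z ->
  exists r N C, 0 < r /\ 0 < C /\ forall w, cdist w z < r -> forall n, (N <= n)%nat ->
    exists R, inverse_of (op_shift (Tn n) w) R /\ opnorm_le R C.
Proof.
  intros Hz Hs. destruct (not_spectrum T z Hs) as [R [C [HR [HC HC0]]]].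
  destruct nu_uniform as [d [Hd0 [_ Hd]]].
  assert (Hz0 : 0 < Cmod z) by (apply Cmod_gt_0; auto).
  (* [4 * C] bounds the resolvent of [T] at all nearby [w], and [/ 4 * Cmod z] is at most the
     required [/ 2 * Cmod w], because [w] keeps at least half the modulus of [z]. *)
  destruct (small_mult (4 * C * (d * (4 * C) + 2)) (/ 4 * Cmod z)) as [e [He0 He]]; [|lra|].
  { apply Rmult_le_pos; [lra|]. nra. }
  destruct (nu_small e He0) as [N HN].
  exists (Rmin (/ 2 / C) (Cmod z / 2)), N, (2 * (4 * C) * (1 + d * (4 * C))).
  split; [apply Rmin_pos; [apply Rdiv_lt_0_compat; lra|lra]|].
  split; [apply Rmult_lt_0_compat; nra|].
  intros w Hw n Hn.
  pose proof (Rmin_l (/ 2 / C) (Cmod z / 2)). pose proof (Rmin_r (/ 2 / C) (Cmod z / 2)).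
  destruct (inverse_shift C T z w R) as [R' [HR' HC']]; auto; [apply HT|lra| |].
  { unfold cdist in Hw. apply Rle_trans with (/ 2 / C * C); [apply Rmult_le_compat_r; lra|].
    right; field; lra. }
  assert (Hw2 : / 2 * Cmod z <= Cmod w).
  { unfold cdist in Hw. pose proof (Cmod_triangle (Cminus z w) w) as Ht.
    replace (Cplus (Cminus z w) w) with z in Ht by ring.
    replace (Cminus z w) with (Copp (Cminus w z)) in Ht by ring. rewrite Cmod_opp in Ht. lra. }
  destruct (HN n Hn) as [H1 [H2 _]].
  apply (inverse_nu (4 * C) d e T (Tn n) w R'); auto; try lra.
  - apply HT.
  - apply HTn.
  - apply Hd.
  - apply Cmod_gt_0. lra.
Qed.

(** The index [N] depends on the bound [C] only, so a resolvent bound that is uniform in [n] brings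
    invertibility back to [T] from a single late [Tn n]. *)
Lemma resolvent_back (z : CC) (C : R) : z <> RtoC 0 -> 0 <= C ->
  exists N, forall n, (N <= n)%nat ->
    forall R, inverse_of (op_shift (Tn n) z) R -> opnorm_le R C -> ~ spectrum T z.
Proof.
  intros Hz HC0. destruct nu_uniform as [d [Hd0 [_ Hd]]].
  assert (Hz0 : 0 < Cmod z) by (apply Cmod_gt_0; auto).
  destruct (small_mult (C * (d * C + 2)) (/ 2 * Cmod z)) as [e [He0 He]]; [|lra|].
  { apply Rmult_le_pos; [lra|]. nra. }
  destruct (nu_small e He0) as [N HN]. exists N. intros n Hn R HR HC.
  destruct (HN n Hn) as [_ [_ [H1 H2]]].
  destruct (inverse_nu C d e (Tn n) T z R) as [R' [HR' _]]; auto; try lra.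
  - apply HTn.
  - apply HT.
  - apply Hd.
  - eapply inverse_not_spectrum; eauto.
Qed.

(* [E] is [(T_n - T)(I - Q)] for the projection [Q] onto a complement of the range of [T]. *)
Lemma nu_decomposition (e : R) : beta_finite T -> 0 < e -> exists N, forall n, (N <= n)%nat ->
  exists (E : X -> X) f, is_linear E /\ opnorm_le E e /\
    forall x, span f (minus (minus (Tn n x) (T x)) (E x)).
Proof.
  intros [b Hb] He. destruct (beta_surj_mod T b HT Hb) as [W [C [_ [Hi [HC HCs]]]]].
  destruct (epsilon_choice _ HCs) as [g Hg]. destruct HT as [HL _].
  (* The choice function [g] is not linear, but [T (g y)] is the component of [y] in the range of
     [T] along [span W]. Its uniqueness makes it linear in [y]. *)
  assert (Huniq : forall y u, span W (minus y (T u)) -> T (g y) = T u).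
  { intros y u Hu. destruct (Hg y) as [H1 _].
    assert (E0 : minus (minus y (T u)) (minus y (T (g y))) = zero).
    { apply indmod_inter with (range T) W; auto using subsp_range.
      - apply subsp_minus; auto using subsp_span.
      - exists (minus (g y) u). rewrite (lin_minus T) by auto. mod_eq. }
    replace (T (g y)) with (plus (minus (minus y (T u)) (minus y (T (g y)))) (T u)) by mod_eq.
    rewrite E0. mod_eq. }
  destruct Hnu as [_ [H1 _]].
  destruct (H1 (e / C)) as [N HN]; [apply Rdiv_lt_0_compat; auto|].
  exists N. intros n Hn. specialize (HN n Hn). destruct (HTn n) as [HLn _].
  set (D := op_sub (Tn n) T) in *.
  assert (HD : is_linear D).
  { split; intros; unfold D, op_sub.
    - rewrite (lin_plus T), (lin_plus (Tn n)) by auto. mod_eq.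
    - rewrite (lin_scal T), (lin_scal (Tn n)) by auto. mod_eq. }
  (* [D T] is small and [g] is bounded by [C]; what remains of [D] acts on [x - T (g x)], which lies
     in [span W]. *)
  exists (fun y => D (T (g y))), (map D W). split; [split|split].
  - intros x y. rewrite (Huniq (plus x y) (plus (g x) (g y))).
    + rewrite (lin_plus T), (lin_plus D) by auto. auto.
    + rewrite (lin_plus T) by auto. as_mod (plus (minus x (T (g x))) (minus y (T (g y)))).
      apply (subsp_plus _ _ _ (subsp_span W)); apply Hg.
  - intros c x. rewrite (Huniq (scal c x) (scal c (g x))).
    + rewrite (lin_scal T), (lin_scal D) by auto. auto.
    + rewrite (lin_scal T) by auto. as_mod (scal c (minus x (T (g x)))).
      apply (subsp_scal _ _ _ (subsp_span W)); apply Hg.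
  - intros y. destruct (Hg y) as [_ H2]. specialize (HN (g y)). unfold op_comp in HN.
    apply Rle_trans with (1 := HN). apply Rle_trans with (e / C * (C * norm y)).
    + apply Rmult_le_compat_l; auto. apply Rdiv_le_0_compat; lra.
    + right; field; lra.
  - intros x. change (minus (Tn n x) (T x)) with (D x). rewrite <- (lin_minus D) by auto.
    apply spanmod_map with only0; auto.
    + unfold only0; intros y ->. apply lin_zero; auto.
    + apply Hg.
Qed.

(** Invertibility of [Tn n - z] makes [T - z + E] a finite-rank perturbation of an invertible
    operator, and [E] is below the threshold of [semi_fredholm_index0]. *)
Lemma semi_fredholm_shift_index0 (z : CC) : beta_finite T -> semi_fredholm (op_shift T z) ->
  exists N, forall n, (N <= n)%nat -> ~ spectrum (Tn n) z -> index_is (op_shift T z) 0%Z.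
Proof.
  intros Hb Hsf.
  assert (HS : bounded_op (op_shift T z)) by (apply bounded_op_shift; auto).
  destruct (semi_fredholm_index0 _ HS Hsf) as [d [Hd H]].
  destruct (nu_decomposition d Hb Hd) as [N HN]. exists N. intros n Hn Hs.
  destruct (HN n Hn) as [E [f [HE [HEd Hf]]]].
  destruct (not_spectrum _ _ Hs) as [R [C [[[HR _] [HR1 HR2]] _]]].
  apply (H (op_shift (Tn n) z) R (fun x => plus (op_shift T z x) (E x))).
  - split; [apply is_linear_shift, HTn|]. split; [auto|]. split.
    + destruct HS as [HSl _]. split; intros.
      * rewrite (lin_plus (op_shift T z)), (lin_plus E) by auto. mod_eq.
      * rewrite (lin_scal (op_shift T z)), (lin_scal E) by auto. mod_eq.
    + split; [auto|]. split; [auto|]. exists f. intros x. unfold op_shift.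
      as_mod (minus (minus (Tn n x) (T x)) (E x)). auto.
  - intros x. norm_as (scal (Copp (RtoC 1)) (E x)).
    rewrite norm_scal_C, Cmod_opp, Cmod_1, Rmult_1_l. auto.
Qed.

End Invert.

(** * A maximum principle for the resolvent *)

Definition cclosed (H : CC -> Prop) : Prop := forall z, C_closure H z -> H z.

Lemma cdist_sym (z w : CC) : cdist z w = cdist w z.
Proof.
  unfold cdist. replace (Cminus z w) with (Copp (Cminus w z)) by ring. apply Cmod_opp.
Qed.

Lemma cdist_tri (z y w : CC) : cdist z w <= cdist z y + cdist y w.
Proof.
  unfold cdist. replace (Cminus z w) with (Cplus (Cminus z y) (Cminus y w)) by ring.
  apply Cmod_triangle.
Qed.

Lemma cdist_refl (z : CC) : cdist z z = 0.
Proof. unfold cdist. replace (Cminus z z) with (RtoC 0) by ring. apply Cmod_0. Qed.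

Lemma disc_bounded (l : CC) (r : R) (z : CC) : cdist z l <= r -> Cmod z <= r + Cmod l.
Proof.
  intros Hz. pose proof (Cmod_triangle (Cminus z l) l) as Ht.
  replace (Cplus (Cminus z l) l) with z in Ht by ring. unfold cdist in Hz. lra.
Qed.

(** The form in which compactness is used throughout: an eventual property that is locally uniform
    on [H] is uniform on [H]. A sequence of counterexamples would cluster at a point contradicting
    the local statement. *)
Lemma compact_uniform (H : CC -> Prop) (M : R) (Phi : CC -> nat -> Prop) :
  cclosed H -> (forall z, H z -> Cmod z <= M) ->
  (forall z, H z -> exists r N, 0 < r /\ forall w n, H w -> cdist w z < r -> (N <= n)%nat -> Phi w n) ->
  exists N, forall w n, H w -> (N <= n)%nat -> Phi w n.
Proof.
  intros Hc Hb Hl. apply NNPP. intros Hn.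
  destruct (epsilon_choice (fun N (p : CC * nat) => H (fst p) /\ (N <= snd p)%nat /\ ~ Phi (fst p) (snd p)))
    as [f Hf].
  { intros N. apply NNPP. intros Hn'. apply Hn. exists N. intros w n Hw HN. apply NNPP. intros Hp.
    apply Hn'. exists (w, n); auto. }
  destruct (bounded_cluster (fun k => fst (f k)) M) as [z Hz].
  { intros k. apply Hb, Hf. }
  assert (HHz : H z).
  { apply Hc. intros e He. destruct (Hz e O He) as [k [_ Hk]]. exists (fst (f k)). split; [apply Hf|auto]. }
  destruct (Hl z HHz) as [r [N [Hr HN]]]. destruct (Hz r N Hr) as [k [Hk1 Hk2]].
  destruct (Hf k) as [H1 [H2 H3]]. apply H3, HN; auto. lia.
Qed.

(** Upper semicontinuity suffices: points whose values approach the supremum cluster at a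
    maximiser. *)
Lemma compact_max (H : CC -> Prop) (M : R) (g : CC -> R) :
  cclosed H -> (forall z, H z -> Cmod z <= M) -> (exists z, H z) ->
  (forall z, H z -> forall e, 0 < e -> exists r, 0 < r /\ forall w, H w -> cdist w z < r -> g w <= g z + e) ->
  exists z, H z /\ forall w, H w -> g w <= g z.
Proof.
  intros Hc Hb [z0 Hz0] Hu.
  destruct (compact_uniform H M (fun w n => g w <= INR n)) as [N HN]; auto.
  { intros z Hz. destruct (Hu z Hz 1) as [r [Hr Hr']]; [lra|].
    destruct (INR_unbounded (g z + 1)) as [N HN]. exists r, N. split; auto. intros w n Hw Hd Hn.
    specialize (Hr' w Hw Hd). apply le_INR in Hn. lra. }
  destruct (completeness (fun y => exists z, H z /\ y = g z)) as [s [Hs1 Hs2]].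
  { exists (INR N). intros y [z [Hz ->]]. apply HN; auto. }
  { exists (g z0), z0; auto. }
  destruct (epsilon_choice (fun k w => H w /\ s - / (INR k + 1) < g w)) as [f Hf].
  { intros k. apply NNPP. intros Hn. pose proof (inv_INR_pos k) as Hk.
    assert (s <= s - / (INR k + 1)); [|lra]. apply Hs2. intros y [z [Hz ->]].
    apply Rnot_lt_le. intros Hl. apply Hn. exists z; auto. }
  destruct (bounded_cluster f M) as [z Hz].
  { intros k. apply Hb, Hf. }
  assert (HHz : H z).
  { apply Hc. intros e He. destruct (Hz e O He) as [k [_ Hk]]. exists (f k). split; [apply Hf|auto]. }
  exists z. split; auto. intros w Hw. apply Rle_trans with s; [apply Hs1; exists w; auto|].
  apply le_epsilon. intros e He. destruct (Hu z HHz (e / 2)) as [r [Hr Hr']]; [lra|].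
  destruct (inv_INR_lt (e / 2)) as [N1 HN1]; [lra|].
  destruct (Hz r N1 Hr) as [k [Hk1 Hk2]]. destruct (Hf k) as [H1 H2].
  specialize (Hr' (f k) H1 Hk2). specialize (HN1 k Hk1). lra.
Qed.

Lemma Cmod_sqr (z : CC) : Cmod z ^ 2 = fst z ^ 2 + snd z ^ 2.
Proof.
  unfold Cmod. rewrite <- Rsqr_pow2, Rsqr_sqrt; auto. nra.
Qed.

(* The factors [i^j h], for which the first three power sums vanish. *)
Definition cross (h : R) (j : nat) : CC :=
  match j with O => (h, 0) | 1%nat => (- h, 0) | 2%nat => (0, h) | _ => (0, - h) end.

Lemma cross_mod (h : R) j : 0 <= h -> Cmod (cross h j) = h.
Proof.
  intros Hh. assert (H : Cmod (cross h j) ^ 2 = h ^ 2).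
  { rewrite Cmod_sqr. destruct j as [|[|[|j]]]; simpl; ring. }
  pose proof (Cmod_ge_0 (cross h j)). nra.
Qed.

(** The average of the squared modulus over the four points exceeds its value at the centre by
    exactly [h ^ 2]. *)
Lemma cross_sqr_sum (z : CC) (h : R) :
  Cmod (Cplus z (cross h 0)) ^ 2 + Cmod (Cplus z (cross h 1)) ^ 2 +
  Cmod (Cplus z (cross h 2)) ^ 2 + Cmod (Cplus z (cross h 3)) ^ 2 = 4 * Cmod z ^ 2 + 4 * h ^ 2.
Proof. rewrite !Cmod_sqr. destruct z as [a b]. simpl. ring. Qed.

Section Gauge.
Context {X : CompleteNormedModule C_AbsRing}.
Implicit Types (A B S T : X -> X) (Q : (X -> X) -> R -> Prop).

(* [Q A c] stands for "the seminorm of [A] is at most [c]". *)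
Record gauge Q : Prop := {
  gauge_ext : forall A B c, (forall x, A x = B x) -> Q A c -> Q B c;
  gauge_plus : forall A B a b, Q A a -> Q B b -> Q (fun x => plus (A x) (B x)) (a + b);
  gauge_scal : forall (k : CC) A a, Q A a -> Q (fun x => scal k (A x)) (Cmod k * a);
  gauge_opnorm : forall A c, opnorm_le A c -> Q A c;
  gauge_le : forall A a b, a <= b -> Q A a -> Q A b }.

Lemma gauge_opnorm_le : gauge opnorm_le.
Proof.
  split; auto.
  - intros A B c E H x. rewrite <- E. auto.
  - intros A B a b HA HB x. apply Rle_trans with (1 := norm_plus_le _ _).
    specialize (HA x). specialize (HB x). lra.
  - intros k A a HA x. rewrite norm_scal_C, Rmult_assoc. apply Rmult_le_compat_l; auto. apply Cmod_ge_0.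
  - intros A a b Hab HA x. apply Rle_trans with (1 := HA x). apply Rmult_le_compat_r; auto. apply norm_pos.
Qed.

(* The norm of [A] modulo finite-dimensional subspaces of the target. *)
Definition ess_le A (c : R) : Prop :=
  exists l, forall x, exists w, span l w /\ norm (minus (A x) w) <= c * norm x.

Lemma gauge_ess_le : gauge ess_le.
Proof.
  split.
  - intros A B c E [l H]. exists l. intros x. rewrite <- E. auto.
  - intros A B a b [l Hl] [m Hm]. exists (l ++ m). intros x.
    destruct (Hl x) as [u [Hu1 Hu2]]. destruct (Hm x) as [v [Hv1 Hv2]]. exists (plus u v). split.
    + apply (subsp_plus _ _ _ (subsp_span (l ++ m))).
      * revert Hu1; apply spanmod_incl; [apply subsp_only0|apply incl_appl, incl_refl].
      * revert Hv1; apply spanmod_incl; [apply subsp_only0|apply incl_appr, incl_refl].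
    + norm_as (plus (minus (A x) u) (minus (B x) v)).
      apply Rle_trans with (1 := norm_plus_le _ _). lra.
  - intros k A a [l Hl]. exists l. intros x. destruct (Hl x) as [u [Hu1 Hu2]]. exists (scal k u). split.
    + apply (subsp_scal _ _ _ (subsp_span l)); auto.
    + norm_as (scal k (minus (A x) u)). rewrite norm_scal_C, Rmult_assoc.
      apply Rmult_le_compat_l; auto. apply Cmod_ge_0.
  - intros A c H. exists nil. intros x. exists zero. split; [reflexivity|]. norm_as (A x). auto.
  - intros A a b Hab [l Hl]. exists l. intros x. destruct (Hl x) as [u [Hu1 Hu2]]. exists u. split; auto.
    apply Rle_trans with (1 := Hu2). apply Rmult_le_compat_r; auto. apply norm_pos.
Qed.

(** The infimum of the bounds, obtained as a supremum of negatives. It need not itself be a bound,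
    hence the strict inequality; negative bounds are excluded because on the zero space every number
    is a bound. *)
Lemma gauge_value Q A (C : R) : gauge Q -> Q A C -> 0 <= C ->
  exists m, 0 <= m /\ (forall c, 0 <= c -> Q A c -> m <= c) /\ forall c, m < c -> Q A c.
Proof.
  intros HQ HC HC0.
  destruct (completeness (fun y => 0 <= - y /\ Q A (- y))) as [s [Hs1 Hs2]].
  { exists 0. intros y [Hy _]. lra. }
  { exists (- C). rewrite Ropp_involutive. auto. }
  exists (- s). split; [|split].
  - assert (s <= 0); [|lra]. apply Hs2. intros y [Hy _]. lra.
  - intros c Hc0 Hc. assert (- c <= s); [|lra]. apply Hs1. rewrite Ropp_involutive. auto.
  - intros c Hc. apply NNPP. intros Hn. assert (s <= - c); [|lra]. apply Hs2. intros y [Hy1 Hy2].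
    apply Rnot_lt_le. intros Hl. apply Hn. apply (gauge_le Q HQ) with (- y); auto. lra.
Qed.

Lemma resolvent_identity T (z c : CC) (R0 S : X -> X) : is_linear T -> inverse_of (op_shift T z) R0 ->
  inverse_of (op_shift T (Cplus z c)) S -> forall x, S x = plus (R0 x) (scal c (R0 (S x))).
Proof.
  intros HT [[HR _] [H1 H2]] [_ [H3 H4]] x.
  assert (E : op_shift T z (S x) = plus x (scal c (S x))).
  { rewrite <- (H4 x) at 2. unfold op_shift. mod_eq. }
  rewrite <- (H1 (S x)) at 1. rewrite E, (lin_plus R0), (lin_scal R0) by auto. auto.
Qed.

(** The Taylor expansion of the resolvent to third order with exact remainder, by iterating
    [resolvent_identity]. *)
Lemma resolvent_expand T (z c : CC) (R0 S : X -> X) : is_linear T -> inverse_of (op_shift T z) R0 ->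
  inverse_of (op_shift T (Cplus z c)) S -> forall x,
  S x = plus (plus (plus (R0 x) (scal c (R0 (R0 x))))
                   (plus (scal (Cmult c c) (R0 (R0 (R0 x))))
                         (scal (Cmult c (Cmult c c)) (R0 (R0 (R0 (R0 x)))))))
             (scal (Cmult (Cmult c c) (Cmult c c)) (R0 (R0 (R0 (R0 (S x)))))).
Proof.
  intros HT HR HS x. pose proof (resolvent_identity T z c R0 S HT HR HS x) as E.
  destruct HR as [[HR _] _].
  assert (E1 : R0 (S x) = plus (R0 (R0 x)) (scal c (R0 (R0 (S x))))).
  { rewrite E at 1. rewrite (lin_plus R0), (lin_scal R0) by auto. auto. }
  assert (E2 : R0 (R0 (S x)) = plus (R0 (R0 (R0 x))) (scal c (R0 (R0 (R0 (S x)))))).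
  { rewrite E1 at 1. rewrite (lin_plus R0), (lin_scal R0) by auto. auto. }
  assert (E3 : R0 (R0 (R0 (S x))) = plus (R0 (R0 (R0 (R0 x)))) (scal c (R0 (R0 (R0 (R0 (S x))))))).
  { rewrite E2 at 1. rewrite (lin_plus R0), (lin_scal R0) by auto. auto. }
  rewrite E at 1. rewrite E1 at 1. rewrite E2 at 1. rewrite E3 at 1. mod_eq.
Qed.

Lemma resolvent_bound T (z c : CC) (R0 S : X -> X) (C : R) : is_linear T -> inverse_of (op_shift T z) R0 ->
  inverse_of (op_shift T (Cplus z c)) S -> opnorm_le R0 C -> 0 <= C -> Cmod c * C <= / 2 ->
  opnorm_le S (2 * C).
Proof.
  intros HT HR HS HC HC0 Hc x. pose proof (resolvent_identity T z c R0 S HT HR HS x) as E.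
  assert (H1 : norm (S x) <= norm (R0 x) + Cmod c * norm (R0 (S x))).
  { rewrite E at 1. apply Rle_trans with (1 := norm_plus_le _ _). rewrite norm_scal_C. lra. }
  pose proof (HC x) as H2. pose proof (HC (S x)) as H3. pose proof (Cmod_ge_0 c) as H4.
  apply Rmult_le_compat_l with (r := Cmod c) in H3; auto.
  pose proof (norm_pos (S x)) as H5. apply Rmult_le_compat_r with (r := norm (S x)) in Hc; auto. lra.
Qed.

(** In the average of the four expansions the terms with [c], [c^2] and [c^3] cancel, and [c^4]
    equals [h^4] at all four points. Each remainder is [R0^4 S] with [S] bounded by [2 * C], whence
    [2 * C ^ 5]. *)
Lemma gauge_submean Q T (z : CC) (h C : R) (R0 : X -> X) (S : nat -> X -> X) (u : nat -> R) :
  gauge Q -> is_linear T -> inverse_of (op_shift T z) R0 -> opnorm_le R0 C -> 0 <= C ->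
  0 <= h -> h * C <= / 2 ->
  (forall j, inverse_of (op_shift T (Cplus z (cross h j))) (S j)) -> (forall j, Q (S j) (u j)) ->
  Q R0 (/ 4 * (u 0%nat + u 1%nat + u 2%nat + u 3%nat) + h ^ 4 * (2 * C ^ 5)).
Proof.
  intros HQ HT HR HC HC0 Hh HhC HS Hu.
  assert (HSC : forall j, opnorm_le (S j) (2 * C)).
  { intros j. apply resolvent_bound with T z (cross h j) R0; auto. rewrite cross_mod; auto. }
  set (k := RtoC (/ 4)). set (c4 := RtoC (- / 4 * h ^ 4)).
  set (F := fun y : X => R0 (R0 (R0 (R0 y)))).
  assert (HF : forall j, opnorm_le (fun x => F (S j x)) (2 * C ^ 5)).
  { intros j x. unfold F. set (y := S j x). pose proof (HSC j x) as H0. fold y in H0.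
    pose proof (HC y) as H1. pose proof (HC (R0 y)) as H2. pose proof (HC (R0 (R0 y))) as H3.
    pose proof (HC (R0 (R0 (R0 y)))) as H4.
    apply Rmult_le_compat_l with (r := C) in H0; auto.
    assert (A1 : norm (R0 y) <= C * (2 * C * norm x)) by lra.
    apply Rmult_le_compat_l with (r := C) in A1; auto.
    assert (A2 : norm (R0 (R0 y)) <= C * (C * (2 * C * norm x))) by lra.
    apply Rmult_le_compat_l with (r := C) in A2; auto.
    assert (A3 : norm (R0 (R0 (R0 y))) <= C * (C * (C * (2 * C * norm x)))) by lra.
    apply Rmult_le_compat_l with (r := C) in A3; auto. lra. }
  assert (HB : Q (fun x => plus (scal k (plus (plus (S 0%nat x) (S 1%nat x)) (plus (S 2%nat x) (S 3%nat x))))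
     (scal c4 (plus (plus (F (S 0%nat x)) (F (S 1%nat x))) (plus (F (S 2%nat x)) (F (S 3%nat x))))))
     (Cmod k * ((u 0%nat + u 1%nat) + (u 2%nat + u 3%nat)) +
      Cmod c4 * ((2 * C ^ 5 + 2 * C ^ 5) + (2 * C ^ 5 + 2 * C ^ 5)))).
  { assert (G := gauge_plus Q HQ). assert (G1 := gauge_opnorm Q HQ).
    apply G.
    - apply (gauge_scal Q HQ k (fun x => plus (plus (S 0%nat x) (S 1%nat x)) (plus (S 2%nat x) (S 3%nat x)))).
      apply (G (fun x => plus (S 0%nat x) (S 1%nat x)) (fun x => plus (S 2%nat x) (S 3%nat x))); apply G; auto.
    - apply (gauge_scal Q HQ c4 (fun x => plus (plus (F (S 0%nat x)) (F (S 1%nat x))) (plus (F (S 2%nat x)) (F (S 3%nat x))))).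
      apply (G (fun x => plus (F (S 0%nat x)) (F (S 1%nat x))) (fun x => plus (F (S 2%nat x)) (F (S 3%nat x))));
        apply (G (fun x => F (S _ x)) (fun x => F (S _ x))); auto. }
  assert (Hk : Cmod k = / 4) by (unfold k; rewrite Cmod_R, Rabs_pos_eq; lra).
  assert (Hh4 : 0 <= h ^ 4) by (apply pow_le; auto).
  assert (Hc4 : Cmod c4 = / 4 * h ^ 4).
  { unfold c4. rewrite Cmod_R, <- Rabs_Ropp, Rabs_pos_eq; lra. }
  rewrite Hk, Hc4 in HB.
  replace (/ 4 * (u 0%nat + u 1%nat + u 2%nat + u 3%nat) + h ^ 4 * (2 * C ^ 5)) with
    (/ 4 * ((u 0%nat + u 1%nat) + (u 2%nat + u 3%nat)) +
      / 4 * h ^ 4 * ((2 * C ^ 5 + 2 * C ^ 5) + (2 * C ^ 5 + 2 * C ^ 5))) by field.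
  apply (gauge_ext Q HQ) with (2 := HB).
  - intros x. unfold F.
    pose proof (resolvent_expand T z (cross h 0) R0 (S 0%nat) HT HR (HS 0%nat) x) as E0.
    pose proof (resolvent_expand T z (cross h 1) R0 (S 1%nat) HT HR (HS 1%nat) x) as E1.
    pose proof (resolvent_expand T z (cross h 2) R0 (S 2%nat) HT HR (HS 2%nat) x) as E2.
    pose proof (resolvent_expand T z (cross h 3) R0 (S 3%nat) HT HR (HS 3%nat) x) as E3.
    set (F0 := R0 (R0 (R0 (R0 (S 0%nat x))))) in *. set (F1 := R0 (R0 (R0 (R0 (S 1%nat x))))) in *.
    set (F2 := R0 (R0 (R0 (R0 (S 2%nat x))))) in *. set (F3 := R0 (R0 (R0 (R0 (S 3%nat x))))) in *.
    rewrite E0, E1, E2, E3. clear.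
    generalize (R0 (R0 (R0 (R0 x)))), (R0 (R0 (R0 x))), (R0 (R0 x)), (R0 x). intros a b c d.
    mod_pre; unfold k, c4, cross; apply injective_projections; simpl; field.
Qed.

End Gauge.

Section MaxPrinciple.
Context {X : CompleteNormedModule C_AbsRing}.

Lemma cdist_plus (z c : CC) : cdist (Cplus z c) z = Cmod c.
Proof. unfold cdist. f_equal. ring. Qed.

(** The nearby resolvent is [R0] plus [c R0 S], and the second term is small in operator norm, hence
    in every gauge. *)
Lemma gauge_resolvent_usc (Q : (X -> X) -> R -> Prop) (T : X -> X) (z : CC) (R0 : X -> X) (u0 : R) :
  gauge Q -> is_linear T -> inverse_of (op_shift T z) R0 -> (forall c, u0 < c -> Q R0 c) ->
  forall e, 0 < e -> exists r, 0 < r /\ forall w S, cdist w z < r -> inverse_of (op_shift T w) S -> Q S (u0 + e).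
Proof.
  intros HQ HT HR Hu e He. pose proof HR as [HRb _].
  destruct (bounded_const R0 HRb) as [C [HC0 HC]].
  destruct (small_mult (2 * C * C + 2 * C) (Rmin (/ 2) (e / 2))) as [r [Hr0 Hr]].
  { nra. }
  { apply Rmin_pos; lra. }
  pose proof (Rmin_l (/ 2) (e / 2)) as Hm1. pose proof (Rmin_r (/ 2) (e / 2)) as Hm2.
  exists r. split; auto. intros w S Hw HS.
  set (c := Cminus w z). assert (Ew : w = Cplus z c) by (unfold c; ring).
  assert (Hc : Cmod c < r) by exact Hw. rewrite Ew in HS. pose proof (Cmod_ge_0 c) as Hc0.
  assert (HcC : Cmod c * C <= / 2) by nra.
  pose proof (resolvent_bound T z c R0 S C HT HR HS HC (Rlt_le _ _ HC0) HcC) as HSC.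
  pose proof (resolvent_identity T z c R0 S HT HR HS) as E.
  assert (H1 : Q R0 (u0 + e / 2)) by (apply Hu; lra).
  assert (H2 : Q (fun x => R0 (S x)) (C * (2 * C))).
  { apply (gauge_opnorm Q HQ). intros x. apply Rle_trans with (1 := HC _).
    rewrite Rmult_assoc. apply Rmult_le_compat_l; [lra|]. apply HSC. }
  apply (gauge_scal Q HQ c) in H2.
  pose proof (gauge_plus Q HQ _ _ _ _ H1 H2) as H3.
  apply (gauge_le Q HQ) with (u0 + e / 2 + Cmod c * (C * (2 * C))); [nra|].
  apply (gauge_ext Q HQ) with (2 := H3). intros x. symmetry. apply E.
Qed.

(* At an interior maximum [z] of [u + k |z|^2], where [u] is the seminorm of the resolvent, the
   sub-mean value inequality is violated: its error is [O(h^4)] and [k |z|^2] contributes [k h^2]. *)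
Lemma resolvent_max_principle (Q : (X -> X) -> R -> Prop) (T : X -> X) (Rz : CC -> X -> X)
  (H : CC -> Prop) (B M : R) :
  gauge Q -> is_linear T -> (forall z, H z -> inverse_of (op_shift T z) (Rz z)) ->
  cclosed H -> (forall z, H z -> Cmod z <= B) -> 0 <= M ->
  (forall z, H z -> (exists r, 0 < r /\ forall w, cdist w z < r -> H w) \/ Q (Rz z) M) ->
  forall z M', H z -> M < M' -> Q (Rz z) M'.
Proof.
  intros HQ HT HRz Hc HB HM Hbd z M' Hz HMM.
  destruct (epsilon_choice (fun z m => H z -> 0 <= m /\ (forall c, 0 <= c -> Q (Rz z) c -> m <= c) /\
     forall c, m < c -> Q (Rz z) c)) as [u Hu].
  { intros w. destruct (classic (H w)) as [Hw|Hw]; [|exists 0; tauto].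
    destruct (HRz w Hw) as [HRb _]. destruct (bounded_const _ HRb) as [C [HC0 HC]].
    destruct (gauge_value Q (Rz w) C HQ) as [m Hm]; [apply (gauge_opnorm Q HQ); auto|lra|].
    exists m; auto. }
  (* The added term [k |z|^2] may cost at most half of the slack between [M] and [M'] on the whole
     of [H]. *)
  destruct (small_mult (B ^ 2) (/ 2 * (M' - M))) as [k [Hk0 Hk]]; [nra|lra|].
  assert (HB0 : 0 <= B) by (specialize (HB z Hz); pose proof (Cmod_ge_0 z); lra).
  destruct (compact_max H B (fun w => u w + k * Cmod w ^ 2)) as [z0 [Hz0 Hmax]]; auto.
  { exists z; auto. }
  { intros w Hw e He. destruct (Hu w Hw) as [Hu0 [Hu1 Hu2]].
    destruct (gauge_resolvent_usc Q T w (Rz w) (u w) HQ HT (HRz w Hw) Hu2 (e / 2)) as [r [Hr0 Hr]]; [lra|].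
    destruct (small_mult (k * (2 * B)) (e / 2)) as [r2 [Hr20 Hr2]]; [nra|lra|].
    exists (Rmin r r2). split; [apply Rmin_pos; auto|]. intros v Hv Hd.
    pose proof (Rmin_l r r2) as Hm1. pose proof (Rmin_r r r2) as Hm2.
    assert (H1 : u v <= u w + e / 2).
    { destruct (Hu v Hv) as [_ [Hv1 _]]. apply Hv1; [lra|]. apply Hr with v; auto. lra. }
    assert (H2 : Cmod v <= Cmod w + r2).
    { pose proof (Cmod_triangle (Cminus v w) w) as Ht.
      replace (Cplus (Cminus v w) w) with v in Ht by ring. unfold cdist in Hd. lra. }
    assert (H3 : Cmod v ^ 2 <= Cmod w ^ 2 + r2 * (2 * B)).
    { pose proof (HB v Hv). pose proof (HB w Hw). pose proof (Cmod_ge_0 v). pose proof (Cmod_ge_0 w).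
      destruct (Rle_dec (Cmod v) (Cmod w)); nra. }
    apply Rmult_le_compat_l with (r := k) in H3; lra. }
  assert (Hconcl : u z0 <= M -> Q (Rz z) M').
  { intros H0. destruct (Hu z Hz) as [_ [_ Hz2]]. apply Hz2. specialize (Hmax z Hz).
    pose proof (HB z0 Hz0). pose proof (Cmod_ge_0 z0). pose proof (Cmod_ge_0 z).
    assert (k * Cmod z0 ^ 2 <= k * B ^ 2) by (apply Rmult_le_compat_l; nra).
    assert (0 <= k * Cmod z ^ 2) by (apply Rmult_le_pos; nra). lra. }
  destruct (Hu z0 Hz0) as [Hu0 [Hu1 _]].
  destruct (Hbd z0 Hz0) as [[r [Hr0 Hr]]|HQM]; [|apply Hconcl, Hu1; auto].
  exfalso. pose proof (HRz z0 Hz0) as HR0. pose proof HR0 as [HRb _].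
  destruct (bounded_const _ HRb) as [C [HC0 HC]].
  assert (HC5 : 0 < C ^ 5) by (apply pow_lt; auto).
  (* The four bounds keep the cross inside [H], satisfy [gauge_submean], give [h ^ 2 <= h], and make
     the error [h ^ 2 * (2 * C ^ 5)] at most [k / 2], which contradicts
     [k <= h ^ 2 * (2 * C ^ 5)]. *)
  set (h := Rmin (r / 2) (Rmin (/ 2 / C) (Rmin 1 (k / (4 * C ^ 5))))).
  assert (Hh0 : 0 < h).
  { unfold h. repeat apply Rmin_pos; try lra; apply Rdiv_lt_0_compat; lra. }
  assert (Hh1 : h <= r / 2) by apply Rmin_l.
  assert (Hh2 : h <= / 2 / C) by (eapply Rle_trans; [apply Rmin_r|apply Rmin_l]).
  assert (Hh3 : h <= 1) by (eapply Rle_trans; [apply Rmin_r|eapply Rle_trans; [apply Rmin_r|apply Rmin_l]]).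
  assert (Hh4 : h <= k / (4 * C ^ 5))
    by (eapply Rle_trans; [apply Rmin_r|eapply Rle_trans; [apply Rmin_r|apply Rmin_r]]).
  assert (HhC : h * C <= / 2).
  { apply Rle_trans with (/ 2 / C * C); [apply Rmult_le_compat_r; lra|right; field; lra]. }
  assert (Hk4 : h * (4 * C ^ 5) <= k).
  { apply Rle_trans with (k / (4 * C ^ 5) * (4 * C ^ 5)); [apply Rmult_le_compat_r; lra|right; field; lra]. }
  assert (Hin : forall j, H (Cplus z0 (cross h j))).
  { intros j. apply Hr. rewrite cdist_plus, cross_mod; lra. }
  assert (Hmj : forall j, u (Cplus z0 (cross h j)) + k * Cmod (Cplus z0 (cross h j)) ^ 2 <=
     u z0 + k * Cmod z0 ^ 2) by (intros j; apply Hmax; auto).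
  assert (Hsub : u z0 <= / 4 * (u (Cplus z0 (cross h 0)) + u (Cplus z0 (cross h 1)) +
     u (Cplus z0 (cross h 2)) + u (Cplus z0 (cross h 3))) + h ^ 4 * (2 * C ^ 5)).
  { apply le_epsilon. intros e He. apply Hu1.
    - destruct (Hu _ (Hin 0%nat)) as [? _]. destruct (Hu _ (Hin 1%nat)) as [? _].
      destruct (Hu _ (Hin 2%nat)) as [? _]. destruct (Hu _ (Hin 3%nat)) as [? _].
      assert (0 <= h ^ 4) by (apply pow_le; lra). nra.
    - pose proof (gauge_submean Q T z0 h C (Rz z0) (fun j => Rz (Cplus z0 (cross h j)))
        (fun j => u (Cplus z0 (cross h j)) + e) HQ HT HR0 HC) as G.
      eapply (gauge_le Q HQ); [|apply G; auto; try lra].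
      + lra.
      + intros j. destruct (Hu _ (Hin j)) as [_ [_ Hj]]. apply Hj. lra. }
  pose proof (cross_sqr_sum z0 h) as Hs.
  pose proof (Hmj 0%nat). pose proof (Hmj 1%nat). pose proof (Hmj 2%nat). pose proof (Hmj 3%nat).
  assert (Hfin : k * h ^ 2 <= h ^ 4 * (2 * C ^ 5)).
  { assert (Hs' : k * (Cmod (Cplus z0 (cross h 0)) ^ 2 + Cmod (Cplus z0 (cross h 1)) ^ 2 +
      Cmod (Cplus z0 (cross h 2)) ^ 2 + Cmod (Cplus z0 (cross h 3)) ^ 2) = k * (4 * Cmod z0 ^ 2 + 4 * h ^ 2))
      by (rewrite Hs; auto). lra. }
  assert (Hh2' : 0 < h ^ 2) by (apply pow_lt; auto).
  assert (k <= h ^ 2 * (2 * C ^ 5)).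
  { apply Rmult_le_reg_r with (h ^ 2); auto. lra. }
  assert (h ^ 2 <= h) by nra.
  assert (h ^ 2 * (2 * C ^ 5) <= h * (2 * C ^ 5)) by (apply Rmult_le_compat_r; lra). lra.
Qed.

(** Writing [y] as [V x - e + v] with [v] in a fixed finite span and [e] at most half of [y]
    improves a bound [c] for [R0] to [C + c / 2]. Iteration from the operator norm, of which no
    uniform control is known, tends to [2 * C]; the result [3 * C] no longer depends on it. *)
Lemma ess_le_of_surj_mod (S V R0 : X -> X) (W f : list X) (C d : R) :
  is_linear V -> inverse_of V R0 -> 0 < C -> 0 <= d -> d * C <= / 2 ->
  (forall y : X, exists x, span W (minus y (S x)) /\ norm x <= C * norm y) ->
  (forall x, exists e, norm e <= d * norm x /\ span f (minus (minus (V x) (S x)) e)) ->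
  ess_le R0 (3 * C).
Proof.
  intros HV [HRb [HRV HVR]] HC Hd HdC HS HVS. pose proof HRb as [HR _].
  assert (Hstep : forall c, 0 <= c -> ess_le R0 c -> ess_le R0 (C + / 2 * c)).
  { intros c Hc [l Hl]. exists (l ++ map R0 (W ++ f)). intros y.
    destruct (HS y) as [x [Hx1 Hx2]]. destruct (HVS x) as [e [He1 He2]].
    destruct (Hl e) as [w [Hw1 Hw2]].
    assert (Hsp : forall (l1 l2 : list X) v, incl l1 l2 -> span l1 v -> span l2 v).
    { intros l1 l2 v Hi. apply spanmod_incl; auto using subsp_only0. }
    assert (Hmap : forall v, span (W ++ f) v -> span (map R0 (W ++ f)) (R0 v)).
    { intros v. apply spanmod_map; auto. unfold only0; intros ? ->; apply lin_zero; auto. }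
    set (v := minus (minus y (S x)) (minus (minus (V x) (S x)) e)).
    assert (Hv : span (W ++ f) v).
    { apply subsp_minus; [apply subsp_span| |].
      - apply Hsp with W; auto. apply incl_appl, incl_refl.
      - apply Hsp with f; auto. apply incl_appr, incl_refl. }
    assert (E : R0 y = plus (minus x (R0 e)) (R0 v)).
    { assert (Ey : y = plus (minus (V x) e) v) by (unfold v; mod_eq).
      rewrite Ey at 1. rewrite (lin_plus R0), (lin_minus R0), HRV by auto. auto. }
    exists (minus (R0 v) w). split.
    - apply subsp_minus; [apply subsp_span| |].
      + apply Hsp with (map R0 (W ++ f)); auto. apply incl_appr, incl_refl.
      + apply Hsp with l; auto. apply incl_appl, incl_refl.
    - rewrite E. norm_as (minus x (minus (R0 e) w)).
      apply Rle_trans with (1 := norm_minus_le _ _).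
      pose proof (norm_pos y) as Hy. pose proof (norm_pos x) as Hx0.
      assert (norm e <= / 2 * norm y).
      { apply Rle_trans with (1 := He1). apply Rle_trans with (d * (C * norm y)).
        - apply Rmult_le_compat_l; auto.
        - rewrite <- Rmult_assoc. apply Rmult_le_compat_r; auto. }
      assert (c * norm e <= c * (/ 2 * norm y)) by (apply Rmult_le_compat_l; auto). lra. }
  destruct (bounded_const R0 HRb) as [c0 [Hc0 Hc]].
  assert (Hn : forall n, ess_le R0 (2 * C + c0 * (/ 2) ^ n)).
  { induction n as [|n IH].
    - apply (gauge_opnorm ess_le gauge_ess_le). intros x. simpl. pose proof (norm_pos x).
      specialize (Hc x). nra.
    - assert (0 < (/ 2) ^ n) by (apply pow_lt; lra).
      apply Hstep in IH; [|nra]. eapply (gauge_le ess_le gauge_ess_le); [|exact IH]. simpl. lra. }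
  destruct (pow_half_lt c0 C) as [N HN]; [lra|lra|].
  apply (gauge_le ess_le gauge_ess_le) with (2 * C + c0 * (/ 2) ^ N); auto. specialize (HN N (Nat.le_refl _)). lra.
Qed.

(** [R0] is an approximate right inverse of [S]: modulo [f], the residual is [E (R0 y)]. Removing
    from [R0 y] its part [w] in [span l] makes the residual at most half of [y], at the price of
    adding the finite span of [map E l]. *)
Lemma semi_fredholm_of_ess_le (S V R0 E : X -> X) (f : list X) (c d : R) :
  bounded_op S -> inverse_of V R0 -> is_linear E -> opnorm_le E d -> 0 <= d -> d * c <= / 2 ->
  ess_le R0 c -> (forall x, span f (minus (minus (V x) (S x)) (E x))) ->
  semi_fredholm S.
Proof.
  intros HS [HRb [_ HVR]] HE Hd Hd0 Hdc [l Hl] Hf.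
  destruct (bounded_const R0 HRb) as [c0 [Hc0 Hc]].
  apply surj_mod_semi_fredholm with (map E l ++ f); auto. intros y.
  destruct (iter_solve S (span (map E l ++ f)) (fun _ => True) c0) with (y := y) as [x [Hx _]];
    auto using subsp_span, nclosed_span; [lra| |exists x; auto].
  clear y. intros y _. destruct (Hl y) as [w [Hw1 Hw2]].
  exists (R0 y), (E (minus (R0 y) w)). split; auto. split; [|split; auto].
  - pose proof (Hf (R0 y)) as H1. rewrite HVR in H1. rewrite (lin_minus E) by auto.
    as_mod (plus (E w) (minus (minus y (S (R0 y))) (E (R0 y)))).
    apply (subsp_plus _ _ _ (subsp_span (map E l ++ f))).
    + apply spanmod_incl with (map E l); [apply subsp_only0|apply incl_appl, incl_refl|].
      apply spanmod_map with only0; auto. unfold only0; intros ? ->; apply lin_zero; auto.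
    + apply spanmod_incl with f; [apply subsp_only0|apply incl_appr, incl_refl|auto].
  - apply Rle_trans with (1 := Hd _). pose proof (norm_pos y).
    apply Rle_trans with (d * (c * norm y)); [apply Rmult_le_compat_l; auto|].
    rewrite <- Rmult_assoc. apply Rmult_le_compat_r; auto.
Qed.

End MaxPrinciple.

(** * Components of the semi-Fredholm spectrum *)

Inductive reach (Q : CC -> Prop) (eta : R) (z0 : CC) : CC -> Prop :=
| reach_start : Q z0 -> reach Q eta z0 z0
| reach_step w z : reach Q eta z0 w -> Q z -> cdist z w < eta -> reach Q eta z0 z.

(** For compact [Q] this is the connected component of [z0], described through the parts that can be
    reached by steps shorter than [eta], which are relatively clopen. *)
Definition chain_component (Q : CC -> Prop) (z0 z : CC) : Prop :=
  forall eta, 0 < eta -> reach Q eta z0 z.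

Lemma reach_in Q eta z0 z : reach Q eta z0 z -> Q z.
Proof. intros H; destruct H; auto. Qed.

Lemma reach_mono Q (a b : R) z0 z : a <= b -> reach Q a z0 z -> reach Q b z0 z.
Proof.
  intros Hab H; induction H as [H|w z H IH Hz Hd]; [constructor; auto|].
  apply reach_step with w; auto. lra.
Qed.

Lemma reach_exit Q eta z0 b (O : CC -> Prop) : reach Q eta z0 b -> O z0 -> ~ O b ->
  exists w w', reach Q eta z0 w /\ reach Q eta z0 w' /\ cdist w' w < eta /\ O w /\ ~ O w'.
Proof.
  intros H H0; induction H as [H|w z H IH Hz Hd]; intros Hb; [tauto|].
  destruct (classic (O w)) as [Hw|Hw]; [|auto].
  exists w, z. repeat split; auto. apply reach_step with w; auto.
Qed.

Section Chains.
Context (Q : CC -> Prop) (B : R) (z0 : CC).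
Context (Hc : cclosed Q) (Hb : forall z, Q z -> Cmod z <= B) (Hz0 : Q z0).

(** A late endpoint is close to the cluster point and reached by fine steps, so one further short
    step reaches the cluster point itself. *)
Lemma chain_cluster (f : nat -> CC) : (forall k, reach Q (/ (INR k + 1)) z0 (f k)) ->
  exists z, chain_component Q z0 z /\
    forall e N, 0 < e -> exists n, (N <= n)%nat /\ cdist (f n) z < e.
Proof.
  intros Hf. destruct (bounded_cluster f B) as [z Hz].
  { intros k. apply Hb. apply reach_in with (1 := Hf k). }
  exists z. split; auto. intros eta He.
  destruct (inv_INR_lt eta He) as [N HN]. destruct (Hz eta N He) as [k [Hk1 Hk2]].
  apply reach_step with (f k).
  - apply reach_mono with (/ (INR k + 1)); auto. apply Rlt_le, HN; auto.
  - apply Hc. intros e He'. destruct (Hz e O He') as [n [_ Hn]]. exists (f n). split; auto.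
    apply reach_in with (1 := Hf n).
  - rewrite cdist_sym. exact Hk2.
Qed.

(* [O1] and [O2] shrink the separating open sets to disjoint ones; short chains leaving [O1]
   then cluster at a point of the chain component outside [O1] and [O2]. *)
Lemma chain_component_side (U V : CC -> Prop) (b : CC) : C_open U -> C_open V ->
  (forall z, chain_component Q z0 z -> U z \/ V z) ->
  (forall z, ~ (chain_component Q z0 z /\ U z /\ V z)) ->
  U z0 -> chain_component Q z0 b -> ~ V b.
Proof.
  intros HU HV Hcov Hdis HUz Hbc HVb.
  assert (HL0 : chain_component Q z0 z0) by (intros eta _; constructor; auto).
  set (O1 := fun z => exists a r, chain_component Q z0 a /\ U a /\ cdist z a < r / 2 /\
    forall w, cdist w a < r -> U w).
  set (O2 := fun z => exists a r, chain_component Q z0 a /\ V a /\ cdist z a < r / 2 /\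
    forall w, cdist w a < r -> V w).
  assert (Hd12 : forall z, O1 z -> O2 z -> False).
  { intros z [a [r [H1 [H2 [H3 H4]]]]] [a' [r' [H5 [H6 [H7 H8]]]]].
    pose proof (cdist_tri a z a') as Ht. rewrite (cdist_sym a z) in Ht.
    (* Two half-radii add up to at most the larger radius, so the centre of the smaller ball lies in
       the larger one and would belong to both [U] and [V]. *)
    destruct (Rle_dec r r') as [Hr|Hr].
    - apply (Hdis a). repeat split; auto. apply H8. lra.
    - apply (Hdis a'). repeat split; auto. apply H4. rewrite cdist_sym. lra. }
  assert (Hself : forall z, chain_component Q z0 z -> (U z -> O1 z) /\ (V z -> O2 z)).
  { intros z Hz. split; intros H.
    - destruct (HU z H) as [r [Hr Hr']]. exists z, r. rewrite cdist_refl. repeat split; auto. lra.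
    - destruct (HV z H) as [r [Hr Hr']]. exists z, r. rewrite cdist_refl. repeat split; auto. lra. }
  assert (Hb1 : ~ O1 b) by (intros H; apply (Hd12 b H), (Hself b Hbc); auto).
  destruct (epsilon_choice (fun k (p : CC * CC) => reach Q (/ (INR k + 1)) z0 (fst p) /\
     reach Q (/ (INR k + 1)) z0 (snd p) /\ cdist (snd p) (fst p) < / (INR k + 1) /\
     O1 (fst p) /\ ~ O1 (snd p))) as [f Hf].
  { intros k. destruct (reach_exit Q (/ (INR k + 1)) z0 b O1) as [w [w' H]].
    - apply Hbc, inv_INR_pos.
    - apply Hself; auto.
    - auto.
    - exists (w, w'); auto. }
  destruct (chain_cluster (fun k => fst (f k))) as [z [Hz Hcl]]; [intros k; apply Hf|].
  assert (Hopen : forall a r z, cdist z a < r / 2 -> exists e, 0 < e /\ forall w, cdist w z < e -> cdist w a < r / 2).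
  { intros a r y Hy. exists (r / 2 - cdist y a). split; [lra|]. intros w Hw.
    pose proof (cdist_tri w y a). lra. }
  destruct (Hcov z Hz) as [H|H]; apply Hself in H; auto; destruct H as [a [r [H1 [H2 [H3 H4]]]]];
    destruct (Hopen a r z H3) as [e [He He']].
  - destruct (inv_INR_lt (e / 2)) as [N HN]; [lra|].
    destruct (Hcl (e / 2) N) as [k [Hk1 Hk2]]; [lra|].
    destruct (Hf k) as [_ [_ [G1 [_ G2]]]]. apply G2. exists a, r. repeat split; auto. apply He'.
    pose proof (cdist_tri (snd (f k)) (fst (f k)) z). specialize (HN k Hk1). lra.
  - destruct (Hcl e O He) as [k [_ Hk2]]. destruct (Hf k) as [_ [_ [_ [G1 _]]]].
    apply (Hd12 _ G1). exists a, r. auto.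
Qed.

Lemma chain_component_connected : C_connected (chain_component Q z0).
Proof.
  intros U V HU HV Hcov Hdis.
  assert (HL0 : chain_component Q z0 z0) by (intros eta _; constructor; auto).
  destruct (Hcov z0 HL0) as [H|H].
  - right. intros z [Hz HVz]. apply (chain_component_side U V z); auto.
  - left. intros z [Hz HUz]. apply (chain_component_side V U z); auto.
    + intros w Hw. destruct (Hcov w Hw); auto.
    + intros w [Hw1 [Hw2 Hw3]]. apply (Hdis w); auto.
Qed.

End Chains.

(** If chains of every fineness came close to the boundary circle, their endpoints would cluster on
    that circle at a point of the chain component of [z0]. That set is connected and meets [K], so
    it lies in [K], which stays in the open ball. *)
Lemma component_separated (A sg : CC -> Prop) (K : CC -> Prop) (l z0 : CC) (r : R) :
  connected_component_of A K -> (forall z, K z -> open_ball l r z) -> (forall z, sg z -> A z) ->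
  cclosed (fun z => sg z /\ cdist z l <= r) -> K z0 -> sg z0 ->
  exists eta, 0 < eta /\
    forall z, reach (fun z => sg z /\ cdist z l <= r) eta z0 z -> cdist z l < r - eta.
Proof.
  intros [_ [_ [_ Hmax]]] HKl HsgA Hc HK0 Hs0. apply NNPP. intros Hn.
  set (Q := fun z => sg z /\ cdist z l <= r) in *.
  assert (HQ0 : Q z0) by (split; [auto|apply Rlt_le, (HKl z0 HK0)]).
  assert (HB : forall z, Q z -> Cmod z <= r + Cmod l).
  { intros z [_ Hz]. apply disc_bounded; auto. }
  destruct (epsilon_choice (fun k z => reach Q (/ (INR k + 1)) z0 z /\ r - / (INR k + 1) <= cdist z l))
    as [f Hf].
  { intros k. apply NNPP. intros Hn'. apply Hn. exists (/ (INR k + 1)). split; [apply inv_INR_pos|].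
    intros z Hz. apply Rnot_le_lt. intros Hl. apply Hn'. exists z; auto. }
  destruct (chain_cluster Q (r + Cmod l) z0 Hc HB f) as [z [Hz Hcl]]; [apply Hf|].
  assert (HKz : K z).
  { apply (Hmax (chain_component Q z0)); auto.
    - apply chain_component_connected with (r + Cmod l); auto.
    - intros w Hw. apply HsgA. apply (reach_in _ _ _ _ (Hw 1 Rlt_0_1)).
    - exists z0. split; auto. intros eta _; constructor; auto. }
  assert (Hlt : cdist z l < r) by apply (HKl z HKz).
  set (e := (r - cdist z l) / 2). assert (He : 0 < e) by (unfold e; lra).
  destruct (inv_INR_lt e He) as [N HN]. destruct (Hcl e N He) as [k [Hk1 Hk2]].
  destruct (Hf k) as [_ H]. specialize (HN k Hk1). pose proof (cdist_tri (f k) z l).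
  unfold e in *. lra.
Qed.

(** * Upper and lower semicontinuity of the spectrum *)

Section Continuity.
Context {X : CompleteNormedModule C_AbsRing} (T : X -> X) (Tn : nat -> X -> X).
Context (HT : bounded_op T) (HTn : forall n, bounded_op (Tn n)) (Hnu : nu_converges Tn T).
Context (Hfred : fredholm T) (Hacc : accumulation_point (spectrum T) (RtoC 0)).

Lemma spectrum_closed (A : X -> X) : is_linear A -> cclosed (spectrum A).
Proof.
  intros HA z Hz. apply NNPP. intros Hn. destruct (spectrum_open_compl A z HA Hn) as [e [He H]].
  destruct (Hz e He) as [w [Hw1 Hw2]]. apply (H w); auto.
Qed.

Lemma zero_in_spectrum : spectrum T (RtoC 0).
Proof.
  apply spectrum_closed; [apply HT|]. intros e He. destruct (Hacc e He) as [w [H1 [_ H2]]]. exists w; auto.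
Qed.

Lemma spectrum_upper (eps : R) : 0 < eps -> exists N, forall n, (N <= n)%nat ->
  forall z, spectrum (Tn n) z -> exists w, spectrum T w /\ cdist z w < eps.
Proof.
  intros He. destruct (nu_uniform T Tn HT Hnu) as [d [Hd0 [Hd _]]].
  (* A compact set containing every point of the spectra of the [Tn n] that is not within [eps] of
     the spectrum of [T]. It omits [0], so the resolvents there are stable. *)
  set (H := fun z => Cmod z <= 2 * d /\ forall w, spectrum T w -> eps <= cdist z w).
  destruct (compact_uniform H (2 * d) (fun z n => ~ spectrum (Tn n) z)) as [N HN].
  - intros z Hz. split.
    + apply le_epsilon. intros e He'. destruct (Hz e He') as [w [[Hw _] Hd']].
      pose proof (Cmod_triangle (Cminus z w) w) as Ht.
      replace (Cplus (Cminus z w) w) with z in Ht by ring. rewrite cdist_sym in Hd'.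
      unfold cdist in Hd'. lra.
    + intros w Hw. apply le_epsilon. intros e He'. destruct (Hz e He') as [v [[_ Hv] Hd']].
      specialize (Hv w Hw). pose proof (cdist_tri v z w). lra.
  - intros z [Hz _]; auto.
  - intros z [_ Hz].
    assert (Hns : ~ spectrum T z) by (intros Hs; specialize (Hz z Hs); rewrite cdist_refl in Hz; lra).
    assert (Hz0 : z <> RtoC 0) by (intros ->; apply Hns, zero_in_spectrum).
    destruct (resolvent_stable T Tn HT HTn Hnu z Hz0 Hns) as [r [N [C [Hr [_ HrN]]]]].
    exists r, N. split; auto. intros w n _ Hw Hn. destruct (HrN w Hw n Hn) as [R [HR _]].
    apply inverse_not_spectrum with R; auto.
  - exists N. intros n Hn z Hz. apply NNPP. intros Hno. apply (HN z n); auto. split.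
    + apply spectrum_bounded with (Tn n); auto. apply HTn.
    + intros w Hw. apply Rnot_lt_le. intros Hl. apply Hno. exists w; auto.
Qed.

Lemma inverse_unique (A R1 R2 : X -> X) : inverse_of A R1 -> inverse_of A R2 -> forall x, R1 x = R2 x.
Proof. intros [_ [_ H1]] [_ [H2 _]] x. rewrite <- (H2 (R1 x)), H1. auto. Qed.

Section FreeBall.
Context (l : CC) (eps : R).
(** Together with [Hfree] this is the failure of lower semicontinuity at [l], from which the lemmas
    of the section derive contradictions. *)
Let free (n : nat) : Prop := forall z, cdist z l < eps -> ~ spectrum (Tn n) z.
Context (Hfree : forall N, exists n, (N <= n)%nat /\ free n).

Lemma free_resolvent n : free n -> exists Rz : CC -> X -> X,
  forall z, cdist z l < eps -> inverse_of (op_shift (Tn n) z) (Rz z).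
Proof.
  intros Hn. apply (epsilon_choice (fun z R => cdist z l < eps -> inverse_of (op_shift (Tn n) z) R)).
  intros z. destruct (classic (cdist z l < eps)) as [Hz|Hz].
  - destruct (not_spectrum _ _ (Hn z Hz)) as [R [C [HR _]]]. exists R; auto.
  - exists (fun x => x). tauto.
Qed.

Lemma free_not_isolated (z0 : CC) : isolated_in (spectrum T) z0 -> ~ cdist z0 l < eps.
Proof.
  intros [Hs [e [He Hiso]]] Hz0.
  (* An accumulation point of the spectrum is not isolated in it; [resolvent_back] needs [z0] to be
     nonzero. *)
  assert (Hz00 : z0 <> RtoC 0).
  { intros ->. destruct (Hacc e He) as [w [H1 [H2 H3]]]. apply H2, Hiso; auto. }
  set (rho := Rmin (e / 2) ((eps - cdist z0 l) / 2)).
  assert (Hr0 : 0 < rho) by (apply Rmin_pos; lra).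
  assert (Hr1 : rho <= e / 2) by apply Rmin_l.
  assert (Hr2 : rho <= (eps - cdist z0 l) / 2) by apply Rmin_r.
  (* The same [n] serves as threshold for [m] and as bound, so that one application of
     [compact_uniform] yields both. *)
  set (Phi := fun w n => forall m, (n <= m)%nat -> forall R : X -> X,
    inverse_of (op_shift (Tn m) w) R -> opnorm_le R (INR n)).
  destruct (compact_uniform (fun w => cdist w z0 = rho) (rho + Cmod z0) Phi) as [N HN].
  - intros z Hz. apply Rle_antisym; apply le_epsilon; intros e' He'; destruct (Hz e' He') as [w [Hw1 Hw2]].
    + pose proof (cdist_tri z w z0) as Ht. rewrite (cdist_sym z w) in Ht. lra.
    + pose proof (cdist_tri w z z0) as Ht. lra.
  - intros z Hz. apply disc_bounded. lra.
  - intros z Hz.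
    assert (Hns : ~ spectrum T z).
    { intros H. assert (z = z0) by (apply Hiso; auto; unfold cdist in Hz; lra). subst z.
      rewrite cdist_refl in Hz. lra. }
    assert (Hnz : z <> RtoC 0) by (intros ->; apply Hns, zero_in_spectrum).
    destruct (resolvent_stable T Tn HT HTn Hnu z Hnz Hns) as [r [N [C [Hr [HC HrN]]]]].
    destruct (INR_unbounded C) as [N2 HN2].
    exists r, (N + N2)%nat. split; auto. intros w n _ Hw Hn m Hm R HR.
    destruct (HrN w Hw m ltac:(lia)) as [R' [HR' HC']].
    apply (gauge_le opnorm_le gauge_opnorm_le) with C.
    + assert (INR N2 <= INR n) by (apply le_INR; lia). lra.
    + intros x. rewrite (inverse_unique _ R R' HR HR'). apply HC'.
  - destruct (resolvent_back T Tn HT HTn Hnu z0 (INR N + 1) Hz00) as [N1 HN1].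
    { pose proof (pos_INR N); lra. }
    destruct (Hfree (N + N1)%nat) as [m [Hm Hfm]]. destruct (free_resolvent m Hfm) as [Rz HRz].
    assert (Hin : forall z, cdist z z0 <= rho -> cdist z l < eps).
    { intros z Hz. pose proof (cdist_tri z z0 l). lra. }
    apply (HN1 m ltac:(lia) (Rz z0)); auto.
    apply (resolvent_max_principle opnorm_le (Tn m) Rz (fun w => cdist w z0 <= rho) (rho + Cmod z0) (INR N));
      auto using gauge_opnorm_le, pos_INR, disc_bounded; try lra.
    + apply HTn.
    + intros z Hz. apply le_epsilon. intros e' He'. destruct (Hz e' He') as [w [Hw1 Hw2]].
      pose proof (cdist_tri z w z0) as Ht. rewrite (cdist_sym z w) in Ht. lra.
    + intros z Hz. destruct (Req_dec (cdist z z0) rho) as [E|E].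
      * right. apply (HN z N E (Nat.le_refl _) m); auto; lia.
      * left. exists (rho - cdist z z0). split; [lra|]. intros w Hw. pose proof (cdist_tri w z z0). lra.
    + rewrite cdist_refl; lra.
Qed.

(** The free operators force index zero, so even a point where only the kernel was known to be
    finite-dimensional has a range of finite codimension. *)
Lemma free_surj_mod (z : CC) : cdist z l < eps -> semi_fredholm (op_shift T z) ->
  exists W C, 0 < C /\ forall y, exists x, span W (minus y (op_shift T z x)) /\ norm x <= C * norm y.
Proof.
  intros Hz Hsf. destruct Hfred as [_ [_ Hbeta]].
  destruct (semi_fredholm_shift_index0 T Tn HT HTn Hnu z Hbeta Hsf) as [N HN].
  destruct (Hfree N) as [n [Hn Hfn]]. destruct (HN n Hn (Hfn z Hz)) as [a [b [_ [Hb _]]]].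
  destruct (beta_surj_mod _ b (bounded_op_shift T z HT) Hb) as [W [C [_ [_ [HC H]]]]]. exists W, C; auto.
Qed.

(** Inside the free ball semi-Fredholm points are onto modulo a finite span, and that property is
    open by [surj_mod_perturb]. *)
Lemma free_sf_closed (r : R) : r < eps -> cclosed (fun z => sigma_sf T z /\ cdist z l <= r).
Proof.
  intros Hr z Hz.
  assert (Hzl : cdist z l <= r).
  { apply le_epsilon. intros e He. destruct (Hz e He) as [w [[_ Hw1] Hw2]].
    pose proof (cdist_tri z w l) as Ht. rewrite (cdist_sym z w) in Ht. lra. }
  split; auto. intros Hsf.
  destruct (free_surj_mod z ltac:(lra) Hsf) as [W [C [HC Hs]]].
  destruct (Hz (/ 2 / C)) as [w [[Hw _] Hwz]]; [apply Rdiv_lt_0_compat; lra|].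
  apply Hw. apply surj_mod_semi_fredholm with W; [apply bounded_op_shift; auto|].
  intros y. destruct (surj_mod_perturb (op_shift T z) (op_shift T w) W C (cdist w z)) with (y := y) as [x [Hx _]];
    auto using bounded_op_shift.
  - intros x. unfold op_shift. norm_as (scal (Cminus w z) x). rewrite norm_scal_C. right; auto.
  - apply Rle_trans with (/ 2 / C * C); [apply Rmult_le_compat_r; lra|right; field; lra].
  - exists x; auto.
Qed.

Lemma free_no_sf_component (K : CC -> Prop) (r : R) (z0 : CC) : r < eps ->
  connected_component_of (fun z => sigma_sf T z \/ pi0 T z) K -> (forall z, K z -> open_ball l r z) ->
  K z0 -> ~ sigma_sf T z0.
Proof.
  intros Hr HK HKl HK0 Hs0.
  destruct (component_separated _ (sigma_sf T) K l z0 r HK HKl) as [eta [Heta Hsep]]; auto.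
  { apply free_sf_closed; auto. }
  set (Q := fun z => sigma_sf T z /\ cdist z l <= r) in *.
  assert (Hr0 : reach Q eta z0 z0) by (constructor; split; [auto|apply Rlt_le, (HKl z0 HK0)]).
  (* The closed [eta / 3]-neighbourhood of the part of [sigma_sf T] reachable from [z0]; the slack
     [e] makes it closed. *)
  set (H := fun z => forall e, 0 < e -> exists w, reach Q eta z0 w /\ cdist z w < eta / 3 + e).
  assert (HHr : forall z, H z -> cdist z l < r).
  { intros z Hz. destruct (Hz (eta / 3)) as [w [Hw1 Hw2]]; [lra|]. apply Hsep in Hw1.
    pose proof (cdist_tri z w l). lra. }
  assert (HHc : cclosed H).
  { intros z Hz e He. destruct (Hz (e / 2)) as [w [Hw1 Hw2]]; [lra|].
    destruct (Hw1 (e / 2)) as [v [Hv1 Hv2]]; [lra|]. exists v. split; auto.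
    pose proof (cdist_tri z w v) as Ht. rewrite (cdist_sym z w) in Ht. lra. }
  (* The rim of [H]: a point of [H] outside [D] is closer than [eta / 3] to a reachable point, hence
     interior to [H]. *)
  set (D := fun z => H z /\ forall w, reach Q eta z0 w -> eta / 3 <= cdist z w).
  set (Phi := fun w n => forall m, (n <= m)%nat -> forall R : X -> X,
    inverse_of (op_shift (Tn m) w) R -> ess_le R (INR n)).
  assert (Hbeta : beta_finite T) by apply Hfred.
  destruct (compact_uniform D (r + Cmod l) Phi) as [N HN].
  - intros z Hz. split.
    + apply HHc. intros e He. destruct (Hz e He) as [w [[Hw _] Hd]]. exists w; auto.
    + intros w Hw. apply le_epsilon. intros e He. destruct (Hz e He) as [v [[_ Hv] Hd]].
      specialize (Hv w Hw). pose proof (cdist_tri v z w). lra.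
  - intros z [Hz _]. apply disc_bounded. apply Rlt_le; auto.
  - intros z [Hz HzD].
    assert (Hsf : semi_fredholm (op_shift T z)).
    { apply NNPP. intros Hn. destruct (Hz (eta / 3)) as [w [Hw1 Hw2]]; [lra|].
      assert (Hre : reach Q eta z0 z).
      { apply reach_step with w; auto; [split; [exact Hn|apply Rlt_le; auto]|lra]. }
      specialize (HzD z Hre). rewrite cdist_refl in HzD. lra. }
    destruct (free_surj_mod z) as [W [C [HC Hs]]]; auto; [specialize (HHr z Hz); lra|].
    (* One quarter of [1 / C] is spent on [E] and one on moving from [z] to [w]; together they meet
       the condition [d * C <= / 2]. *)
    assert (H4 : 0 < / 4 / C) by (apply Rdiv_lt_0_compat; lra).
    destruct (nu_decomposition T Tn HT HTn Hnu (/ 4 / C) Hbeta H4) as [N1 HN1].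
    destruct (INR_unbounded (3 * C)) as [N2 HN2].
    exists (/ 4 / C), (N1 + N2)%nat. split; auto. intros w n _ Hw Hn m Hm R HR.
    destruct (HN1 m ltac:(lia)) as [E [f [HE [HEd Hf]]]].
    apply (gauge_le ess_le gauge_ess_le) with (3 * C).
    { assert (INR N2 <= INR n) by (apply le_INR; lia). lra. }
    apply (ess_le_of_surj_mod (op_shift T z) (op_shift (Tn m) w) R W f C (/ 2 / C)); auto.
    + apply is_linear_shift, HTn.
    + apply Rdiv_le_0_compat; lra.
    + right; field; lra.
    + intros x. exists (minus (E x) (scal (Cminus w z) x)). split.
      * apply Rle_trans with (norm (E x) + Cmod (Cminus w z) * norm x).
        { rewrite <- norm_scal_C. apply norm_minus_le. }
        specialize (HEd x).
        pose proof (norm_pos x) as Hx.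
        assert (Cmod (Cminus w z) * norm x <= / 4 / C * norm x)
          by (apply Rmult_le_compat_r; [auto|apply Rlt_le; exact Hw]).
        replace (/ 2 / C * norm x) with (/ 4 / C * norm x + / 4 / C * norm x) by (field; lra). lra.
      * unfold op_shift. as_mod (minus (minus (Tn m x) (T x)) (E x)). auto.
  - pose proof (pos_INR N) as HN0.
    assert (Hd : 0 < / 2 / (INR N + 1)) by (apply Rdiv_lt_0_compat; lra).
    destruct (nu_decomposition T Tn HT HTn Hnu _ Hbeta Hd) as [N1 HN1].
    destruct (Hfree (N + N1)%nat) as [m [Hm Hfm]]. destruct (free_resolvent m Hfm) as [Rz HRz].
    destruct (HN1 m ltac:(lia)) as [E [f [HE [HEd Hf]]]].
    (* The maximum principle gives every bound above [INR N]; the smallness of [E] was chosen for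
       [INR N + 1]. *)
    assert (Hess : ess_le (Rz z0) (INR N + 1)).
    { apply (resolvent_max_principle ess_le (Tn m) Rz H (r + Cmod l) (INR N)); auto using gauge_ess_le; try lra.
      - apply HTn.
      - intros z Hz. apply HRz. specialize (HHr z Hz). lra.
      - intros z Hz. apply disc_bounded. apply Rlt_le; auto.
      - intros z Hz. destruct (classic (D z)) as [HD|HD].
        + right. apply (HN z N HD (Nat.le_refl _) m); [lia|]. apply HRz. specialize (HHr z Hz). lra.
        + left. assert (Hex : exists w, reach Q eta z0 w /\ cdist z w < eta / 3).
          { apply NNPP. intros Hn. apply HD. split; auto. intros w Hw. apply Rnot_lt_le. intros Hl.
            apply Hn. exists w; auto. }
          destruct Hex as [w [Hw1 Hw2]]. exists (eta / 3 - cdist z w). split; [lra|].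
          intros v Hv e He. exists w. split; auto. pose proof (cdist_tri v z w). lra.
      - intros e He. exists z0. rewrite cdist_refl. split; auto. lra. }
    apply Hs0.
    apply (semi_fredholm_of_ess_le (op_shift T z0) (op_shift (Tn m) z0) (Rz z0) E f (INR N + 1) (/ 2 / (INR N + 1)));
      auto using bounded_op_shift; try lra.
    + apply HRz. pose proof (HKl z0 HK0) as Hk. unfold open_ball in Hk. lra.
    + right; field; lra.
    + intros x. unfold op_shift. as_mod (minus (minus (Tn m x) (T x)) (E x)). auto.
Qed.

End FreeBall.

(** The component is requested in the half-size ball, so that the closed ball of radius [eps / 2] in
    which chains are run stays inside the free ball. *)
Lemma spectrum_lower_at (l : CC) (eps : R) : 0 < eps -> spectrum T l ->
  (~ C_closure (rho_sf_pm T) l -> exists K,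
     connected_component_of (fun z => sigma_sf T z \/ pi0 T z) K /\
     (forall z, K z -> open_ball l (eps / 2) z)) ->
  exists N, forall n, (N <= n)%nat -> exists z, spectrum (Tn n) z /\ cdist z l < eps.
Proof.
  intros He Hl Hcomp. destruct (classic (C_closure (rho_sf_pm T) l)) as [Hcl|Hcl].
  - destruct (Hcl eps He) as [mu [[Hsf Hidx] Hmu]]. destruct Hfred as [_ [_ Hbeta]].
    destruct (semi_fredholm_shift_index0 T Tn HT HTn Hnu mu Hbeta Hsf) as [N HN].
    exists N. intros n Hn. exists mu. split; auto. apply NNPP. intros Hs. apply Hidx, (HN n); auto.
  - destruct (Hcomp Hcl) as [K [HK HKl]]. apply NNPP. intros Hn.
    assert (Hfree : forall N, exists n, (N <= n)%nat /\ forall z, cdist z l < eps -> ~ spectrum (Tn n) z).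
    { intros N. apply NNPP. intros Hn'. apply Hn. exists N. intros n HNn. apply NNPP. intros Hz.
      apply Hn'. exists n. split; auto. intros z Hzl Hzs. apply Hz. exists z; auto. }
    pose proof HK as [[z0 Hz0] [HKA _]]. destruct (HKA z0 Hz0) as [Hs|[Hiso _]].
    + apply (free_no_sf_component l eps Hfree K (eps / 2) z0); auto. lra.
    + apply (free_not_isolated l eps Hfree z0 Hiso). pose proof (HKl z0 Hz0) as Hk.
      unfold open_ball in Hk. lra.
Qed.

End Continuity.

Theorem theorem3p2 (X : CompleteNormedModule C_AbsRing) (T : X -> X) :
  bounded_op T ->
  fredholm T ->
  accumulation_point (spectrum T) (RtoC 0) ->
  (forall l : CC, spectrum T l -> ~ C_closure (rho_sf_pm T) l ->
     forall eps : R, (0 < eps)%R ->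
       exists K : CC -> Prop,
         connected_component_of (fun z => sigma_sf T z \/ pi0 T z) K /\
         (forall z, K z -> open_ball l eps z)) ->
  forall Tn : nat -> X -> X,
    (forall n, bounded_op (Tn n)) ->
    nu_converges Tn T ->
    hausdorff_converges (fun n => spectrum (Tn n)) (spectrum T).
Proof.
  intros HT Hfred Hacc Hcomp Tn HTn Hnu eps He.
  destruct (spectrum_upper T Tn HT HTn Hnu Hacc eps He) as [N1 HN1].
  destruct (bounded_const T HT) as [M [HM0 HM]].
  (* Lower semicontinuity is known point by point with an index depending on the point; compactness
     of the spectrum makes it uniform, half of [eps] being spent on moving to a neighbouring
     point. *)
  destruct (compact_uniform (spectrum T) (2 * M)
    (fun w n => exists z, spectrum (Tn n) z /\ cdist z w < eps)) as [N2 HN2].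
  - apply spectrum_closed, HT.
  - intros z Hz. apply spectrum_bounded with T; auto. apply HT.
  - intros w Hw.
    destruct (spectrum_lower_at T Tn HT HTn Hnu Hfred Hacc w (eps / 2)) as [N HN]; auto; [lra| |].
    { intros Hcl. apply Hcomp; auto. lra. }
    exists (eps / 2), N. split; [lra|]. intros v n Hv Hvw Hn.
    destruct (HN n Hn) as [z [Hz1 Hz2]]. exists z. split; auto.
    pose proof (cdist_tri z w v) as Ht. rewrite (cdist_sym w v) in Ht. lra.
  - exists (N1 + N2)%nat. intros n Hn. split.
    + apply HN1. lia.
    + intros w Hw. apply HN2; auto. lia.
Qed.
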